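(* Let $T=\{(0,0),(1,0),(0,1)\}\subset\mathbb{Z}^2$ and consider triangle solitaire. There exist a constant $K>0$ and an algorithm running in time polynomial in $|P|$ which, given any finite set $P\Subset\mathbb{Z}^2$, outputs a sequence of at most $K|P|^3$ triangle solitaire moves transforming $P$ into its normal form. Here the normal form of $P$ is the unique (up to reordering of the indices) set $\bigcup_{i=1}^r(\vec v_i+P_{n_i,k_i})$ in the solitaire orbit of $P$ such that the triangles $\vec v_i+T_{n_i}$ pairwise do not touch; two finite sets lie in the same solitaire orbit if and only if they have the same normal form.
   Context: A triangle solitaire move is a pair $(P,Q)$ of subsets of $\mathbb{Z}^2$ such that for some $\vec v\in\mathbb{Z}^2$, $|P\cap(\vec v+T)|=|Q\cap(\vec v+T)|=2$ and $P\triangle Q$ is a $2$-element subset of $\vec v+T$ (i.e. inside a translate of $T$ containing exactly one hole, one point is moved into the hole). The orbit $\mathcal{O}(P)$ is the equivalence class of $P$ under the reflexive-transitive closure of this relation. For $n\ge1$, $T_n=\{(a,b)\in\{0,\dots,n-1\}^2: a+b\le n-1\}$ and $L_n=\{0,\dots,n-1\}\times\{0\}$. Order $T_n\setminus L_n$ by $(a,b)<(c,d)$ iff $b<d$, or $b=d$ and $a<c$; for $0\le k\le n(n-1)/2$, $P_{n,k}$ is $L_n$ together with the first $k$ points of $T_n\setminus L_n$ in this order. The neighbourhood of $x\in\mathbb{Z}^2$ is $x+\{(\pm1,0),(0,\pm1),(1,-1),(-1,1)\}$; $N(A)$ is the union of neighbourhoods of points of $A$, and $A,B$ touch if $A\cap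 N(B)\neq\varnothing$. *)

(* Defs.v *)
From mathcomp Require Import all_boot all_order all_algebra.
From mathcomp Require Export finmap.
From Stdlib Require Export Relation_Operators.
From Stdlib Require List.

Set Implicit Arguments.
Unset Strict Implicit.
Unset Printing Implicit Defensive.

Import Order.TTheory GRing.Theory Num.Theory.
Local Open Scope fset_scope.
Local Open Scope ring_scope.

Definition point : Type := (int * int)%type.

Definition config : Type := {fset point}.

Definition shift (v : point) (A : config) : config := [fset v + x | x in A].

Definition T : config := [fset (0, 0); (1, 0); (0, 1)].

(* Only finite configurations are considered: a move changes two points, so
   the orbit of a finite set consists of finite sets. *)
Definition move (P Q : config) : Prop :=
  exists v : point,
    let D := (P `\` Q) `|` (Q `\` P) in
    [/\ #|` P `&` shift v T| = 2%N,
        #|` Q `&` shift v T| = 2%N,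
        #|` D| = 2%N
      & D `<=` shift v T].

Definition solitaire_orbit (P Q : config) : Prop :=
  clos_refl_trans config move P Q.

(* [Qs] lists the successive configurations after each move, so that the
   number of moves is [size Qs] and the final configuration [last P Qs]. *)
Fixpoint moves (P : config) (Qs : seq config) : Prop :=
  if Qs is Q :: Qs' then move P Q /\ moves Q Qs' else True.

Definition tri (n : nat) : config :=
  [fset x in [seq (Posz a, Posz b) | a <- iota 0 n, b <- iota 0 n]
     | x.1 + x.2 <= Posz n - 1].

Definition line (n : nat) : config :=
  [fset x in [seq (Posz a, 0 : int) | a <- iota 0 n]].

(* The reflexive closure of the row-by-row order, as required by [sort]. *)
Definition row_le (x y : point) : bool :=
  (x.2 < y.2) || ((x.2 == y.2) && (x.1 <= y.1)).

Definition Pnk (n k : nat) : config :=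
  line n `|` [fset x in take k (sort row_le (tri n `\` line n))].

Definition nbhd (x : point) : config :=
  [fset x + d | d in [:: (1, 0); (-1, 0); (0, 1); (0, -1); (1, -1); (-1, 1)]].

Definition nbhds (A : config) : config := \bigcup_(x <- A) nbhd x.

Definition touch (A B : config) : bool := A `&` nbhds B != fset0.

(* The index (v, n, k) stands for v + P_{n,k} inside the triangle v + T_n. *)
Definition piece : Type := (point * nat * nat)%type.

Definition piece_ok (p : piece) : bool :=
  let: (_, n, k) := p in (1 <= n)%N && (k <= (n * (n - 1)) %/ 2)%N.

Definition piece_tri (p : piece) : config :=
  let: (v, n, _) := p in shift v (tri n).

Definition piece_set (p : piece) : config :=
  let: (v, n, k) := p in shift v (Pnk n k).

(* [uniq] only excludes listing the same singleton v + T_1 several times: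
   since no point is its own neighbour, a singleton does not touch itself,
   whereas triangles that meet touch in every other case. *)
Definition normal_family (F : seq piece) : bool :=
  [&& uniq F, all piece_ok F
    & pairwise (fun p q => ~~ touch (piece_tri p) (piece_tri q)) F].

Definition family_set (F : seq piece) : config := \bigcup_(p <- F) piece_set p.

Definition normal_form (P N : config) : Prop :=
  solitaire_orbit P N /\ exists2 F, normal_family F & N = family_set F.

(* The model of computation is a first-order LISP with unit cost: a value is
   an integer or a pointer to a pair of values, variables are de Bruijn
   indices, and a program is a list of mutually recursive unary functions.
   Addition and subtraction are the only arithmetic operations, so that within
   t steps integers grow by at most t + O(1) bits: as for the additive
   random-access machine, unit cost agrees with bit cost up to a polynomial in
   the time and the bit length of the input.  With unit cost one can speak of
   time polynomial in the number of points, whatever their coordinates. *)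
Inductive value : Type :=
  | Int of int
  | Pair of value & value.

Inductive exp : Type :=
  | Var of nat
  | Lit of int
  | Add of exp & exp
  | Sub of exp & exp
  | Cons of exp & exp
  | Fst of exp
  | Snd of exp
  | IfPos of exp & exp & exp
  | IfPair of exp & exp & exp
  | Let of exp & exp
  | Call of nat & exp.

Definition program : Type := seq exp.

(* [eval p env e v t]: in the environment [env], [e] evaluates to [v] in
   exactly [t] steps.  There is no rule for ill-typed operations. *)
Inductive eval (p : program) : seq value -> exp -> value -> nat -> Prop :=
  | EvalVar env i v :
      onth env i = Some v -> eval p env (Var i) v 1
  | EvalLit env z :
      eval p env (Lit z) (Int z) 1
  | EvalAdd env e1 e2 z1 z2 t1 t2 :
      eval p env e1 (Int z1) t1 -> eval p env e2 (Int z2) t2 ->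
      eval p env (Add e1 e2) (Int (z1 + z2)) (t1 + t2).+1
  | EvalSub env e1 e2 z1 z2 t1 t2 :
      eval p env e1 (Int z1) t1 -> eval p env e2 (Int z2) t2 ->
      eval p env (Sub e1 e2) (Int (z1 - z2)) (t1 + t2).+1
  | EvalCons env e1 e2 v1 v2 t1 t2 :
      eval p env e1 v1 t1 -> eval p env e2 v2 t2 ->
      eval p env (Cons e1 e2) (Pair v1 v2) (t1 + t2).+1
  | EvalFst env e v1 v2 t :
      eval p env e (Pair v1 v2) t -> eval p env (Fst e) v1 t.+1
  | EvalSnd env e v1 v2 t :
      eval p env e (Pair v1 v2) t -> eval p env (Snd e) v2 t.+1
  | EvalIfPosT env e e1 e2 z v t t1 :
      eval p env e (Int z) t -> 0 < z -> eval p env e1 v t1 ->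
      eval p env (IfPos e e1 e2) v (t + t1).+1
  | EvalIfPosF env e e1 e2 z v t t2 :
      eval p env e (Int z) t -> z <= 0 -> eval p env e2 v t2 ->
      eval p env (IfPos e e1 e2) v (t + t2).+1
  | EvalIfPairT env e e1 e2 a b v t t1 :
      eval p env e (Pair a b) t -> eval p env e1 v t1 ->
      eval p env (IfPair e e1 e2) v (t + t1).+1
  | EvalIfPairF env e e1 e2 z v t t2 :
      eval p env e (Int z) t -> eval p env e2 v t2 ->
      eval p env (IfPair e e1 e2) v (t + t2).+1
  | EvalLet env e1 e2 v1 v t1 t2 :
      eval p env e1 v1 t1 -> eval p (v1 :: env) e2 v t2 ->
      eval p env (Let e1 e2) v (t1 + t2).+1
  | EvalCall env f e body v w t1 t2 :
      eval p env e v t1 -> onth p f = Some body ->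
      eval p [:: v] body w t2 ->
      eval p env (Call f e) w (t1 + t2).+1.

Lemma eval_det (p : program) env e v1 t1 v2 t2 :
  eval p env e v1 t1 -> eval p env e v2 t2 -> v1 = v2 /\ t1 = t2.
Proof.
move=> ev1; elim: ev1 v2 t2 => {env e v1 t1}; intros;
match goal with
| H : eval _ _ _ ?v ?t |- _ = ?v /\ _ = ?t => inversion H; clear H; subst
end;
repeat match goal with
| IH : (forall v t, eval p ?env ?e v t -> _), H : eval p ?env ?e _ _ |- _ =>
    case: (IH _ _ H) => ? ?; clear H; subst
| E : Int _ = Int _ |- _ => injection E as E; subst
| E : Pair _ _ = Pair _ _ |- _ => injection E as ? ?; subst
| E1 : onth p ?f = _, E2 : onth p ?f = _ |- _ =>
    rewrite E1 in E2; injection E2 as E2; subst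
| H1 : is_true (0 < ?z), H2 : is_true (?z <= 0) |- _ =>
    by rewrite ltNge H2 in H1
end; by [|split; congruence].
Qed.

(* The main function of a program is the first one. *)
Definition runs (p : program) (input output : value) (t : nat) : Prop :=
  eval p [:: input] (Call 0 (Var 0)) output t.

Definition list_val (vs : seq value) : value := foldr Pair (Int 0) vs.

Definition point_val (x : point) : value := Pair (Int x.1) (Int x.2).

(* The points are listed in an arbitrary order, without repetition. *)
Definition encodes (v : value) (P : config) : Prop :=
  exists2 s : seq point, perm_eq s P & v = list_val (map point_val s).

Definition encodes_seq (v : value) (Ps : seq config) : Prop :=
  exists2 vs : seq value, List.Forall2 encodes vs Ps & v = list_val vs.

(* Main.v *)
(* A move inside a translate {x, y, z} of T, with y occupied, exchanges the
   contents of x and z.  As a transposition it is defined whether x and z are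
   occupied or not (it is a legal move if exactly one is, and does nothing if
   both are), so a sequence of such exchanges that is legal for a
   configuration is legal for every larger one, and can be undone.  One may
   therefore move a full line of n points through a triangle of size n while
   ignoring all the other points.

   Points are inserted one by one, keeping a family of pairwise remote
   triangles whose bottom rows are full.  Two neighbouring triangles are
   merged by turning the bottom row of the lower one to its left edge, which
   then absorbs one by one, in linear time, the points of the bottom row of the
   other one that stick out on the left; then likewise on the right.  A merge
   costs O(n^2) moves and there are at most |P| of them.

   In each final triangle, the first hole in row order is filled by the next
   excess point: the line is lifted just below that point, which slides along
   it to the right edge of the triangle, descends together with the line, and
   slides to the hole.  The cells crossed come after the hole, so the cells
   already filled are not disturbed.  This costs O(n^2) moves per excess point.

   For uniqueness, the union of pairwise non-touching triangles is closed under
   completing a translate of T with two occupied points, so a move stays in one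
   triangle and preserves the number of points in each of them. *)
Require Import Defs.
From mathcomp Require Import all_boot all_order all_algebra finmap.
From mathcomp Require Import zify.

Set Implicit Arguments.
Unset Strict Implicit.
Unset Printing Implicit Defensive.

Import Order.TTheory GRing.Theory Num.Theory.
Local Open Scope fset_scope.
Local Open Scope ring_scope.

(** Runs are stated on arbitrary predicates [point -> bool]. An exchange permutes cells, so the
    exact state during a lift can be written down over any background [Z]; [run_mono] then replaces
    the points that matter by any larger set, at the price of an inclusion at the end. Where a
    triangle must keep its exact contents, counting its points turns the inclusion into an equality.
    Lists of points appear only when a run is executed.

    The exponent and the constant of the bound come from two potentials. A merge costs at most 6 W^2
    moves and removes a triangle; a transport costs at most 14 W^2 and lowers the number of points
    on the cells still to be visited. Here W bounds the sizes of all triangles, and W = |P| will do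
    because the join of two near triangles is no larger than the sum of their sizes. Hence 20 = 6 +
    14.

    The recursive generators of exchanges take the list to be continued as an argument, so that
    their transcription into the LISP needs no concatenation. The two are compared function by
    function, the time being counted in calls. *)

(** * Triangles described by linear inequalities *)

Definition in_tri (v : point) (n : nat) (p : point) : bool :=
  [&& v.1 <= p.1, v.2 <= p.2 & p.1 + p.2 < v.1 + v.2 + n%:Z].

Lemma shiftP (v p : point) (A : config) :
  (p \in shift v A) = ((p.1 - v.1, p.2 - v.2) \in A).
Proof.
have e (x : point) : v + x = (v.1 + x.1, v.2 + x.2) by [].
apply/imfsetP/idP => [[x /= xA ->]|h].
  by rewrite e /=; case: x xA => x1 x2 /=; rewrite ![_ + _ - _]addrAC !subrr !add0r.
exists (p.1 - v.1, p.2 - v.2) => //=.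
by rewrite e; case: p {h} => p1 p2 /=; congr pair; lia.
Qed.

Lemma in_triE (n : nat) (p : point) : (p \in tri n) = in_tri (0, 0) n p.
Proof.
rewrite /tri !inE /in_tri /=.
apply/andP/idP.
  case=> /allpairsP [[a b] /= [ha hb ->]] /=.
  by rewrite !mem_iota in ha hb *; move: ha hb; move: (a : nat) (b : nat) => {}a {}b; lia.
case: p => x y /= h; split; last by lia.
apply/allpairsP; exists (`|x|%N, `|y|%N) => /=.
by rewrite !mem_iota; split; try lia; congr pair; lia.
Qed.

Lemma shift_triE v n p : (p \in shift v (tri n)) = in_tri v n p.
Proof. by rewrite shiftP in_triE /in_tri /=; lia. Qed.

Lemma in_lineE (n : nat) (p : point) :
  (p \in line n) = in_tri (0, 0) n p && (p.2 == 0).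
Proof.
rewrite /line !inE /in_tri /=.
apply/mapP/idP.
  by case=> a; rewrite mem_iota => ha -> /=; lia.
case: p => x y /= h; exists `|x|%N; first by rewrite mem_iota; lia.
by congr pair; lia.
Qed.

Lemma shift_TE v p : (p \in shift v T) = in_tri v 2 p.
Proof. by case: p => x y; rewrite shiftP !inE /in_tri !xpair_eqE /=; lia. Qed.

(** * Sequences of exchanges *)

Definition op : Type := (point * point)%type.

Definition tri3 (x y z : point) : Prop :=
  exists v, [&& uniq [:: x; y; z], in_tri v 2 x, in_tri v 2 y & in_tri v 2 z].

Definition tau (o : op) (p : point) : point :=
  if p == o.1 then o.2 else if p == o.2 then o.1 else p.

Definition enabled (S : point -> bool) (o : op) : Prop :=
  S o.1 /\ exists2 y, S y & tri3 o.1 y o.2.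

Fixpoint run (S : point -> bool) (ops : seq op) (S' : point -> bool) : Prop :=
  if ops is o :: ops' then enabled S o /\ run (S \o tau o) ops' S' else S =1 S'.

Definition flip (o : op) : op := (o.2, o.1).

Definition map_op (f : point -> point) (o : op) : op := (f o.1, f o.2).

Lemma tauK o : involutive (tau o).
Proof.
move=> p; rewrite /tau; case: (eqVneq p o.1) => [->|n1].
  by rewrite eqxx; case: eqP.
case: (eqVneq p o.2) => [->|n2]; first by rewrite eqxx.
by rewrite (negbTE n1) (negbTE n2).
Qed.

Lemma tau1 o : tau o o.1 = o.2.
Proof. by rewrite /tau eqxx. Qed.

Lemma tau2 o : tau o o.2 = o.1.
Proof. by rewrite /tau eqxx; case: eqP. Qed.

Lemma tau_flip o : tau (flip o) =1 tau o.
Proof.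
move=> p; rewrite /tau /=; case: (eqVneq p o.2) => [->|//].
by case: eqP => // ->.
Qed.

Lemma enabled_ext S S' o : S =1 S' -> enabled S o -> enabled S' o.
Proof. by move=> e [h1 [y h2 h3]]; split; [|exists y]; rewrite -?e. Qed.

Lemma run_ext ops S1 S2 S1' S2' :
  S1 =1 S2 -> S1' =1 S2' -> run S1 ops S1' -> run S2 ops S2'.
Proof.
elim: ops S1 S2 => [|o ops IH] S1 S2 e e' /= => [h p|[h1 h2]].
  by rewrite -e -e' h.
by split; [exact: enabled_ext h1 | apply: IH h2 => // p /=; rewrite e].
Qed.

Lemma run_cat o1 o2 S1 S2 S3 : run S1 o1 S2 -> run S2 o2 S3 -> run S1 (o1 ++ o2) S3.
Proof.
elim: o1 S1 => [|o o1 IH] S1 /= => [h|[h1 h2] h3]; last by split => //; exact: IH.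
by apply: run_ext => // p; rewrite h.
Qed.

Lemma tri3C x y z : tri3 x y z -> tri3 z y x.
Proof.
case=> v /and4P [u ? ? ?]; exists v; apply/and4P; split => //.
by rewrite -(rev_uniq [:: x; y; z]) in u.
Qed.

(** The source is occupied before the exchange, so the target is occupied after it whatever it held,
    and the third point is fixed by [tau o]. This is what makes runs reversible. *)
Lemma enabled_flip S o : enabled S o -> enabled (S \o tau o) (flip o).
Proof.
case=> h1 [y h2 h3]; split; first by rewrite /= tau2.
exists y; last exact: tri3C.
case: h3 => v /and4P [/= /and3P [n1 n2 _] _ _ _].
rewrite !inE in n1 n2; rewrite /= /tau; move: n1; rewrite negb_or => /andP [n1 _].
by rewrite eq_sym (negbTE n1) (negbTE n2).
Qed.

Lemma run_rev ops S S' : run S ops S' -> run S' (rev (map flip ops)) S.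
Proof.
elim: ops S => [|o ops IH] S /= => [h p|[h1 h2]]; first by rewrite h.
rewrite rev_cons -cats1; apply: run_cat (IH _ h2) _ => /=; split.
  exact: enabled_flip.
by move=> p /=; rewrite tau_flip tauK.
Qed.

(** The conditions of an exchange only ask for occupied points, and precomposition with [tau o]
    respects inclusion. The extra points of [P] are not tracked, whence an inclusion at the end. *)
Lemma run_mono ops S S' P :
  run S ops S' -> subpred S P -> exists2 P', run P ops P' & subpred S' P'.
Proof.
elim: ops S P => [|o ops IH] S P /= => [h s|[[h1 [y h2 h3]] h] s].
  by exists P => // p; rewrite -h; exact: s.
have s' : subpred (S \o tau o) (P \o tau o) by move=> p; exact: s.
have [P' r u] := IH _ _ h s'.
exists P' => //; split => //; split; first exact: s.
by exists y; first exact: s.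
Qed.

Lemma run_map f g ops S S' :
  cancel f g -> cancel g f ->
  (forall x y z, tri3 x y z -> tri3 (f x) (f y) (f z)) ->
  run S ops S' -> run (S \o g) (map (map_op f) ops) (S' \o g).
Proof.
move=> fK gK ft; elim: ops S => [|o ops IH] S /= => [h p|[[h1 [y h2 h3]] h]].
  by rewrite /= h.
split; first split; rewrite /= ?fK //.
  by exists (f y); rewrite /= ?fK //; exact: ft.
apply: run_ext (IH _ h) => // p.
rewrite /= /tau /= !(can2_eq gK fK).
by case: (p == f o.1); [|case: (p == f o.2)]; rewrite ?fK.
Qed.

(** * Moving a line through a triangle *)

Definition padd (p q : point) : point := (p.1 + q.1, p.2 + q.2).

(** The positive part. A loop of the program runs while its counter is positive, so the recursion on
    [tn m] and the loop on [m] stop together, also for negative [m]. *)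
Definition tn (z : int) : nat := if z is Posz n then n else 0%N.

Lemma tn_pos z : 0 <= z -> (tn z)%:Z = z.
Proof. by case: z. Qed.

Lemma tn_neg z : z <= 0 -> tn z = 0%N.
Proof. by case: z => [[]|]. Qed.

(** [d] leads from one source to the next, and [s] from a source to its target. *)
Fixpoint push (x d s : point) (m : nat) (tl : seq op) : seq op :=
  if m is m'.+1 then (x, padd x s) :: push (padd x d) d s m' tl else tl.

(** In row [r] the points are pushed up starting from the right, each leaning on its left neighbour,
    so the leftmost one stays behind. After [n - 1] rows these left ends and the last lifted point
    form the full left edge. *)
Fixpoint sweep (N r : int) (m : nat) (tl : seq op) : seq op :=
  if m is m'.+1 then
    push (N, r) (-1, 0) (-1, 1) (tn N) (sweep (N - 1) (r + 1) m' tl)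
  else tl.

(** The outer point [(x - 1, h)] is the pivot: the edge moves to column [x - 1], diagonally upwards
    from height [h] on and straight left below it, each exchange leaning on the pivot or on the cell
    just reached. The gap left at height [h] is the pivot itself, so [N] exchanges make the edge one
    longer. *)
Fixpoint absorb (x N h : int) (l : nat) (tl : seq op) : seq op :=
  if l is l'.+1 then
    push (x, h) (0, 1) (-1, 1) (tn (N - h))
      (push (x, h - 1) (0, -1) (-1, 0) (tn h) (absorb (x - 1) (N + 1) h l' tl))
  else tl.

Fixpoint revops (ops acc : seq op) : seq op :=
  if ops is o :: ops' then revops ops' (flip o :: acc) else acc.

(* Moves the point (i, j), lying on a full row j - 1, along that row to (0, j). *)
Fixpoint slides (i : nat) (j : int) (tl : seq op) : seq op :=
  if i is i'.+1 then
    [:: ((i'%:Z, j - 1), (i'%:Z, j)), ((i%:Z, j - 1), (i'%:Z, j - 1)),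
        ((i%:Z, j), (i%:Z, j - 1)) & slides i' j tl]
  else tl.

(* Moves the point (0, j), lying on the line at row j - 1, down to row j - 1
   and the line to row j - 2; repeated [d] times. *)
Fixpoint descend (n j : int) (d : nat) (tl : seq op) : seq op :=
  if d is d'.+1 then
    [:: ((0, j - 1), (1, j - 2)), ((0, j), (0, j - 1)) &
        push (0, j - 1) (1, 0) (1, -1) (tn (n + 1 - j)) (descend n (j - 1) d' tl)]
  else tl.

(** A transport consists of two of these glued in the middle: the one from the excess point, with
    [d] the difference of heights, and the one from the hole with [d = 0], run backwards. Both end
    with the line just below the travelling point, which is on the edge in the row of the hole. *)
Definition approach (n i j d : int) (tl : seq op) : seq op :=
  sweep (n - 1) 0 (tn (j - 1)) (slides (tn i) j (descend n j (tn d) tl)).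

(* Everything is done in the frame whose origin is the right corner, so that
   the points slide to the right edge. *)
Definition transport (n : int) (e t : point) : seq op :=
  approach n e.1 e.2 (e.2 - t.2) (revops (approach n t.1 t.2 0 [::]) [::]).

(* The bottom row of the triangle has been lifted to row m, leaving a point at
   the left end of each lower row; the former content Z of the cells passed over
   is shifted by (1, -1).  The lifting to row m + 1 is in progress: the columns
   beyond q of row m are done. *)
Definition level_q (n : nat) (m q : int) (Z : point -> bool) (p : point) : bool :=
  if in_tri (0, 0) n p then
    if p.2 < m then (p.1 == 0) || Z (p.1 - 1, p.2 + 1) else
    if p.2 == m then (p.1 <= q) || Z (p.1 - 1, p.2 + 1) else
    if p.2 == m + 1 then (q <= p.1) || Z p else Z p
  else Z p.

Definition level (n : nat) (m : int) := level_q n m (n%:Z - 1 - m).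

Lemma tri3_intro (v x y z : point) :
  x != y -> y != z -> x != z -> in_tri v 2 x -> in_tri v 2 y -> in_tri v 2 z ->
  tri3 x y z.
Proof. by move=> n1 n2 n3 h1 h2 h3; exists v; rewrite h1 h2 h3 /= !inE negb_or n1 n2 n3. Qed.

Ltac tri3_tac v := apply: (@tri3_intro v); rewrite /in_tri ?xpair_eqE /=; lia.

Lemma level_step (n : nat) (m q : int) Z :
  0 <= m -> 1 <= q -> q + m < n%:Z ->
  let o := ((q, m), (q - 1, m + 1)) in
  enabled (level_q n m q Z) o /\
  level_q n m (q - 1) Z =1 level_q n m q Z \o tau o.
Proof.
move=> m0 q1 qm; split.
  split; first by rewrite /level_q /in_tri /=; do ?case: ifP; lia.
  exists (q - 1, m); first by rewrite /level_q /in_tri /=; do ?case: ifP; lia.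
  by tri3_tac (q - 1, m).
move=> [x y]; rewrite /= /tau /= !xpair_eqE /=.
case: (boolP (_ && _)) => [/andP [/eqP -> /eqP ->]|n1].
  by rewrite /level_q /in_tri /=; do ?case: ifP; lia.
case: (boolP (_ && _)) => [/andP [/eqP -> /eqP ->]|n2];
  by rewrite /level_q /in_tri /=; do ?case: ifP; lia.
Qed.

Lemma push_cat x d s m tl : push x d s m tl = push x d s m [::] ++ tl.
Proof. by elim: m x => //= m IH x; rewrite IH. Qed.

Lemma sweep_cat N r m tl : sweep N r m tl = sweep N r m [::] ++ tl.
Proof.
elim: m N r => //= m IH N r; rewrite push_cat [in RHS]push_cat.
by rewrite IH catA.
Qed.

Lemma slides_cat i j tl : slides i j tl = slides i j [::] ++ tl.
Proof. by elim: i => //= i ->. Qed.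

Lemma descend_cat n j d tl : descend n j d tl = descend n j d [::] ++ tl.
Proof.
by elim: d j => //= d IH j; rewrite push_cat [in RHS]push_cat IH catA.
Qed.

Lemma revopsE ops acc : revops ops acc = rev (map flip ops) ++ acc.
Proof.
elim: ops acc => //= o ops IH acc.
by rewrite IH rev_cons -cats1 -catA.
Qed.

Lemma run_push (pos : nat -> point) (St : nat -> point -> bool) d s m :
  (forall k, pos k.+1 = padd (pos k) d) ->
  (forall k, (k < m)%N -> let o := (pos k, padd (pos k) s) in
     enabled (St k) o /\ St k.+1 =1 St k \o tau o) ->
  run (St 0%N) (push (pos 0%N) d s m [::]) (St m).
Proof.
move=> posS; elim: m pos St posS => [|m IH] pos St posS h //=.
have [h1 h2] := h 0%N isT; split => //.
apply: (@run_ext _ (St 1%N)) => //; rewrite -posS.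
apply: (IH (fun k => pos k.+1) (fun k => St k.+1)) => k; first exact: posS.
by move=> km; exact: (h k.+1).
Qed.

Lemma run_row (n : nat) (m : int) Z : 0 <= m -> m < n%:Z ->
  run (level n m Z) (push (n%:Z - 1 - m, m) (-1, 0) (-1, 1) (tn (n%:Z - 1 - m)) [::])
      (level n (m + 1) Z).
Proof.
move=> m0 mn.
pose pos (k : nat) : point := (n%:Z - 1 - m - k%:Z, m).
pose St (k : nat) := level_q n m (n%:Z - 1 - m - k%:Z) Z.
have /(@run_push pos St) : forall k, pos k.+1 = padd (pos k) (-1, 0).
  by move=> k; rewrite /pos /padd /=; congr pair; lia.
move=> /(_ (-1, 1) (tn (n%:Z - 1 - m))) h.
have e : (tn (n%:Z - 1 - m))%:Z = n%:Z - 1 - m by apply: tn_pos; lia.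
have -> : (n%:Z - 1 - m, m) = pos 0%N by rewrite /pos subr0.
apply: run_ext (h _).
- by move=> p; rewrite /St subr0.
- move=> p; rewrite /St e subrr /level /level_q /in_tri /=.
  by do ?case: ifP; lia.
move=> k km o; rewrite /St /o /pos.
have := @level_step n m (n%:Z - 1 - m - k%:Z) Z m0.
rewrite /padd /= => /(_ _ _) [||h1 h2]; [lia|lia|].
by split => // p; rewrite -h2; congr level_q; lia.
Qed.

Lemma run_sweep (n : nat) (m : int) (k : nat) Z :
  0 <= m -> m + k%:Z < n%:Z ->
  run (level n m Z) (sweep (n%:Z - 1 - m) m k [::]) (level n (m + k%:Z) Z).
Proof.
elim: k m => [|k IH] m m0 mk /=; first by move=> p; rewrite addr0.
rewrite push_cat; apply: run_cat (run_row _ _ _) _; try lia.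
have -> : n%:Z - 1 - m - 1 = n%:Z - 1 - (m + 1) by lia.
have -> : m + k.+1%:Z = (m + 1) + k%:Z by lia.
by apply: IH; lia.
Qed.

Lemma tauL (a b c d e f : int) : e = a -> f = b ->
  tau ((a, b), (c, d)) (e, f) = (c, d).
Proof. by move=> -> ->; exact: tau1. Qed.

Lemma tauR (a b c d e f : int) : e = c -> f = d ->
  tau ((a, b), (c, d)) (e, f) = (a, b).
Proof. by move=> -> ->; exact: tau2. Qed.

Lemma tauN (a b c d e f : int) :
  (e != a) || (f != b) -> (e != c) || (f != d) ->
  tau ((a, b), (c, d)) (e, f) = (e, f).
Proof. by rewrite /tau /= !xpair_eqE => h1 h2; do ?case: ifP => //; lia. Qed.

Ltac tau_tac :=
  rewrite /=;
  repeat match goal with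
  | |- context [tau (?a, ?b, (?c, ?d)) (?e, ?f)] =>
      first [ rewrite (@tauL a b c d e f); [|lia|lia]
            | rewrite (@tauR a b c d e f); [|lia|lia]
            | rewrite (@tauN a b c d e f); [|lia|lia] ]
  end;
  by repeat match goal with
  | H : is_true (?S ?a) |- context [?S ?a] => rewrite H
  end.

(** The three exchanges compose to a 4-cycle, but three of its cells are occupied, so on contents it
    is one exchange of [(i, j)] with [(i - 1, j)]. The last step leans on [(i + 1, j - 1)]: the
    supporting row extends one cell beyond the sliding point. *)
Lemma run_slide (S : point -> bool) (i j : int) :
  S (i - 1, j - 1) -> S (i, j - 1) -> S (i + 1, j - 1) -> S (i, j) ->
  run S [:: ((i - 1, j - 1), (i - 1, j)); ((i, j - 1), (i - 1, j - 1)); ((i, j), (i, j - 1))]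
    (S \o tau ((i, j), (i - 1, j))).
Proof.
move=> hA hB hC he /=; do ?split => /=.
- by [].
- by exists (i, j - 1) => //; tri3_tac (i - 1, j - 1).
- by tau_tac.
- by exists (i - 1, j); [tau_tac | tri3_tac (i - 1, j - 1)].
- by tau_tac.
- by exists (i + 1, j - 1); [tau_tac | tri3_tac (i, j - 1)].
move=> [x y] /=.
have [[-> ->]|n1] := eqVneq (x, y) (i - 1, j - 1); first by tau_tac.
have [[-> ->]|n2] := eqVneq (x, y) (i, j - 1); first by tau_tac.
have [[-> ->]|n3] := eqVneq (x, y) (i - 1, j); first by tau_tac.
have [[-> ->]|n4] := eqVneq (x, y) (i, j); first by tau_tac.
have t o : (x, y) != o.1 -> (x, y) != o.2 -> tau o (x, y) = (x, y).
  by move=> /negbTE h1 /negbTE h2; rewrite /tau h1 h2.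
by rewrite !t.
Qed.

Lemma run_fall (S : point -> bool) (j : int) :
  S (0, j - 2) -> S (0, j - 1) -> S (1, j - 1) -> S (0, j) ->
  run S [:: ((0, j - 1), (1, j - 2)); ((0, j), (0, j - 1))]
    (S \o tau ((0, j), (1, j - 2))).
Proof.
move=> hA hB hC he /=; do ?split => /=.
- by [].
- by exists (0, j - 2) => //; tri3_tac ((0, j - 2) : point).
- by tau_tac.
- by exists (1, j - 1); [tau_tac | tri3_tac ((0, j - 1) : point)].
move=> [x y] /=.
have [[-> ->]|n1] := eqVneq (x, y) (0, j - 1); first by tau_tac.
have [[-> ->]|n2] := eqVneq (x, y) (1, j - 2); first by tau_tac.
have [[-> ->]|n3] := eqVneq (x, y) (0, j); first by tau_tac.
have t o : (x, y) != o.1 -> (x, y) != o.2 -> tau o (x, y) = (x, y).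
  by move=> /negbTE h1 /negbTE h2; rewrite /tau h1 h2.
by rewrite !t.
Qed.

Definition add_cell (e : point) (Z : point -> bool) (p : point) : bool :=
  (p == e) || Z p.

Lemma slide_level (n : nat) (i j : int) (Z : point -> bool) :
  1 <= j -> 1 <= i -> i + j < n%:Z -> ~~ Z (i, j) -> ~~ Z (i - 1, j) ->
  level n (j - 1) (add_cell (i, j) Z) \o tau ((i, j), (i - 1, j)) =1
  level n (j - 1) (add_cell (i - 1, j) Z).
Proof.
move=> j1 i1 ij ze zf [x y]; rewrite /= /tau /= !xpair_eqE /=.
case: (boolP (_ && _)) => [/andP [/eqP -> /eqP ->]|n1].
  by rewrite /level /level_q /in_tri /add_cell /= !xpair_eqE /= ?(negbTE ze) ?(negbTE zf);
    do ?case: ifP; lia.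
case: (boolP (_ && _)) => [/andP [/eqP -> /eqP ->]|n2];
  by rewrite /level /level_q /in_tri /add_cell /= !xpair_eqE /= ?(negbTE ze) ?(negbTE zf);
    do ?case: ifP; lia.
Qed.

(** [level n (j - 1)] stores the background cell [(0, j - 1)] at [(1, j - 2)], shifted by the
    passage of the line. A point landing there already counts as lying at [(0, j - 1)], and lowering
    the line puts it there. *)
Lemma fall_level (n : nat) (j : int) (Z : point -> bool) :
  2 <= j -> j < n%:Z -> ~~ Z (0, j) -> ~~ Z (0, j - 1) ->
  level n (j - 1) (add_cell (0, j) Z) \o tau ((0, j), (1, j - 2)) =1
  level n (j - 1) (add_cell (0, j - 1) Z).
Proof.
move=> j1 jn ze zf [x y]; rewrite /= /tau /= !xpair_eqE /=.
have e : j - 2 + 1 = j - 1 by lia.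
case: (boolP (_ && _)) => [/andP [/eqP -> /eqP ->]|n1].
  by rewrite /level /level_q /in_tri /add_cell /= subrr !xpair_eqE /= ?e ?(negbTE ze)
    ?(negbTE zf); do ?case: ifP; lia.
case: (boolP (_ && _)) => [/andP [/eqP -> /eqP ->]|n2];
  by rewrite /level /level_q /in_tri /add_cell /= ?subrr !xpair_eqE /= ?e ?(negbTE ze)
    ?(negbTE zf); do ?case: ifP; lia.
Qed.

Lemma run_slides (n : nat) (i : nat) (j : int) (Z : point -> bool) :
  1 <= j -> i%:Z + j < n%:Z -> (forall x : int, 0 <= x <= i%:Z -> ~~ Z (x, j)) ->
  run (level n (j - 1) (add_cell (i%:Z, j) Z)) (slides i j [::])
      (level n (j - 1) (add_cell (0, j) Z)).
Proof.
move=> j1; elim: i => [|i IH] ij zx //.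
rewrite [slides _ _ _]/= -[X in run _ X]/([:: _; _; _] ++ slides i j [::]).
have e : i%:Z = i.+1%:Z - 1 by lia.
apply: run_cat (IH _ _); [|lia|by move=> x xi; apply: zx; lia].
rewrite e; apply: run_ext (run_slide _ _ _ _) => //.
1: apply: slide_level; try lia; apply: zx; lia.
all: rewrite /level /level_q /in_tri /add_cell /= !xpair_eqE /=; do ?case: ifP; lia.
Qed.

(** The states of [level_step] for increasing [q]: the exchanges of a lift, flipped and in reverse
    order, are again a [push]. *)
Lemma run_unrow (n : nat) (m : int) (Z : point -> bool) : 0 <= m -> m < n%:Z ->
  run (level n (m + 1) Z) (push (0, m + 1) (1, 0) (1, -1) (tn (n%:Z - 1 - m)) [::])
      (level n m Z).
Proof.
move=> m0 mn.
pose pos (k : nat) : point := (k%:Z, m + 1).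
pose St (k : nat) := level_q n m k%:Z Z.
have /(@run_push pos St) : forall k, pos k.+1 = padd (pos k) (1, 0).
  by move=> k; rewrite /pos /padd /=; congr pair; lia.
move=> /(_ (1, -1) (tn (n%:Z - 1 - m))) h.
have e : (tn (n%:Z - 1 - m))%:Z = n%:Z - 1 - m by apply: tn_pos; lia.
apply: run_ext (h _).
- move=> p; rewrite /St /level /level_q /in_tri /=.
  by do ?case: ifP; lia.
- by move=> p; rewrite /St e.
move=> k km o; rewrite /St /o /pos.
have := @level_step n m (k.+1%:Z) Z m0.
rewrite /padd /= => /(_ _ _) [||h1 h2]; [lia|lia|].
have e1 : k.+1%:Z - 1 = k%:Z by lia.
have e2 : k%:Z + 1 = k.+1%:Z by lia.
rewrite e1 in h1 h2; rewrite addrK e2; split.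
  by apply: enabled_ext (enabled_flip h1) => p; rewrite h2.
move=> p; rewrite /= h2 /=.
by rewrite [X in tau _ X](tau_flip ((k.+1%:Z, m), (k%:Z, m + 1)) p) tauK.
Qed.

Lemma run_descend (n : nat) (j : int) (d : nat) (Z : point -> bool) :
  d%:Z < j -> j < n%:Z -> (forall y : int, j - d%:Z <= y <= j -> ~~ Z (0, y)) ->
  run (level n (j - 1) (add_cell (0, j) Z)) (descend n j d [::])
      (level n (j - 1 - d%:Z) (add_cell (0, j - d%:Z) Z)).
Proof.
elim: d j => [|d IH] j dj jn zy; first by move=> p; rewrite !subr0.
rewrite [descend _ _ _ _]/= push_cat -[X in run _ X]/([:: _; _] ++ _).
apply: (@run_cat _ _ _ (level n (j - 1) (add_cell (0, j - 1) Z))).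
{ have fl := @fall_level n j Z.
  apply: (run_ext _ (fl _ _ _ _) (run_fall _ _ _ _)) => //; try lia; try (apply: zy; lia).
  all: rewrite /level /level_q /in_tri /add_cell /= ?xpair_eqE /=; do ?case: ifP; lia. }
apply: (@run_cat _ _ _ (level n (j - 2) (add_cell (0, j - 1) Z))).
  have := @run_unrow n (j - 2) (add_cell (0, j - 1) Z).
  have -> : j - 2 + 1 = j - 1 by lia.
  have -> : n%:Z - 1 - (j - 2) = n%:Z + 1 - j by lia.
  by apply; lia.
have e1 : j - 2 = j - 1 - 1 by lia.
have e2 : j - 1 - d.+1%:Z = j - 1 - 1 - d%:Z by lia.
have e3 : j - d.+1%:Z = j - 1 - d%:Z by lia.
rewrite e1 e2 e3; apply: IH; try lia.
by move=> y yy; apply: zy; lia.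
Qed.

Lemma approach_cat n i j d tl : approach n i j d tl = approach n i j d [::] ++ tl.
Proof.
rewrite /approach sweep_cat [in RHS]sweep_cat -catA; congr (_ ++ _).
rewrite slides_cat [in RHS]slides_cat -catA; congr (_ ++ _).
by rewrite descend_cat.
Qed.

Lemma run_approach (n : nat) (i j d : int) (Z : point -> bool) :
  0 <= i -> 0 <= d -> d < j -> i + j < n%:Z ->
  (forall x : int, 0 <= x <= i -> ~~ Z (x, j)) ->
  (forall y : int, j - d <= y <= j -> ~~ Z (0, y)) ->
  run (level n 0 (add_cell (i, j) Z)) (approach n i j d [::])
      (level n (j - 1 - d) (add_cell (0, j - d) Z)).
Proof.
move=> i0 d0 dj ijn zx zy; rewrite /approach sweep_cat slides_cat.
have ej : (tn (j - 1))%:Z = j - 1 by apply: tn_pos; lia.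
have ei : (tn i)%:Z = i by apply: tn_pos; lia.
have ed : (tn d)%:Z = d by apply: tn_pos; lia.
apply: (@run_cat _ _ _ (level n (j - 1) (add_cell (i, j) Z))).
  have := @run_sweep n 0 (tn (j - 1)) (add_cell (i, j) Z).
  by rewrite ej subr0 add0r; apply; lia.
apply: (@run_cat _ _ _ (level n (j - 1) (add_cell (0, j) Z))).
  rewrite -[X in add_cell (X, j)]ei; apply: run_slides; rewrite ?ei //; lia.
have := @run_descend n j (tn d) Z.
by rewrite ed; apply => //; lia.
Qed.

Lemma run_transport (n : nat) (e t : point) (Z : point -> bool) :
  0 <= e.1 -> 0 <= t.1 -> 1 <= t.2 -> t.2 <= e.2 -> e.1 + e.2 < n%:Z ->
  t.1 + t.2 < n%:Z ->
  (forall x : int, 0 <= x <= e.1 -> ~~ Z (x, e.2)) ->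
  (forall x : int, 0 <= x <= t.1 -> ~~ Z (x, t.2)) ->
  (forall y : int, t.2 <= y <= e.2 -> ~~ Z (0, y)) ->
  run (level n 0 (add_cell e Z)) (transport n e t) (level n 0 (add_cell t Z)).
Proof.
case: e t => [i j] [s r] /= i0 s0 r1 rj ij sr z1 z2 z3.
rewrite /transport /= approach_cat revopsE cats0.
apply: (@run_cat _ _ _ (level n (r - 1) (add_cell (0, r) Z))).
  have := @run_approach n i j (j - r) Z.
  have -> : j - (j - r) = r by lia.
  have -> : j - 1 - (j - r) = r - 1 by lia.
  by apply => //; try lia.
apply: run_rev; have := @run_approach n s r 0 Z.
rewrite !subr0; apply => //; try lia.
by move=> y yy; apply: z3; lia.
Qed.

(* A full edge in column x is being shifted to column x - 1, away from the point
   (x - 1, h): the rows from lo to hi are done.  The points at height h to the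
   left of the edge are still to be absorbed, and xl is their least abscissa. *)
Definition edge_q (M : nat) (xl h x lo hi : int) (Z : point -> bool) (p : point) :=
  if in_tri (xl, 0) M p then
    [|| (p.1 == x) && ((p.2 < lo) || (hi <= p.2)),
        (p.1 == x - 1) && (lo <= p.2 <= hi) | (p.2 == h) && (p.1 < x - 1)]
  else Z p.

Definition edge (M : nat) (xl h x : int) (Z : point -> bool) (p : point) :=
  if in_tri (xl, 0) M p then (p.1 == x) || ((p.2 == h) && (p.1 < x)) else Z p.

Lemma edge_up (M : nat) (xl h x N hi : int) Z :
  N = M%:Z + xl - x -> xl < x -> 0 <= h -> h <= hi -> hi < N ->
  let o := ((x, hi), (x - 1, hi + 1)) in
  enabled (edge_q M xl h x h hi Z) o /\
  edge_q M xl h x h (hi + 1) Z =1 edge_q M xl h x h hi Z \o tau o.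
Proof.
move=> eN xx h0 hh hn; split.
  split; first by rewrite /edge_q /in_tri /=; do ?case: ifP; lia.
  exists (x - 1, hi); first by rewrite /edge_q /in_tri /=; do ?case: ifP; lia.
  by tri3_tac (x - 1, hi).
move=> [a b]; rewrite /= /tau /= !xpair_eqE /=.
case: (boolP (_ && _)) => [/andP [/eqP -> /eqP ->]|n1].
  by rewrite /edge_q /in_tri /=; do ?case: ifP; lia.
case: (boolP (_ && _)) => [/andP [/eqP -> /eqP ->]|n2];
  by rewrite /edge_q /in_tri /=; do ?case: ifP; lia.
Qed.

Lemma edge_down (M : nat) (xl h x N lo hi : int) Z :
  N = M%:Z + xl - x -> xl < x -> 1 <= lo -> lo <= h -> h <= hi -> hi <= N ->
  let o := ((x, lo - 1), (x - 1, lo - 1)) in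
  enabled (edge_q M xl h x lo hi Z) o /\
  edge_q M xl h x (lo - 1) hi Z =1 edge_q M xl h x lo hi Z \o tau o.
Proof.
move=> eN xx h0 hh hn hN; split.
  split; first by rewrite /edge_q /in_tri /=; do ?case: ifP; lia.
  exists (x - 1, lo); first by rewrite /edge_q /in_tri /=; do ?case: ifP; lia.
  by tri3_tac (x - 1, lo - 1).
move=> [a b]; rewrite /= /tau /= !xpair_eqE /=.
case: (boolP (_ && _)) => [/andP [/eqP -> /eqP ->]|n1].
  by rewrite /edge_q /in_tri /=; do ?case: ifP; lia.
case: (boolP (_ && _)) => [/andP [/eqP -> /eqP ->]|n2];
  by rewrite /edge_q /in_tri /=; do ?case: ifP; lia.
Qed.

Lemma run_absorb (M l : nat) (xl h x N : int) Z :
  N = M%:Z - l%:Z -> x = xl + l%:Z -> 0 <= h -> h <= N ->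
  run (edge M xl h x Z) (absorb x N h l [::]) (edge M xl h xl Z).
Proof.
elim: l x N => [|l IH] x N eN ex h0 hN; first by have -> : xl = x by lia.
rewrite [absorb _ _ _ _ _]/= push_cat.
apply: (@run_cat _ _ _ (edge_q M xl h x h N Z)).
  pose pos (k : nat) : point := (x, h + k%:Z).
  pose St (k : nat) := edge_q M xl h x h (h + k%:Z) Z.
  have /(@run_push pos St) : forall k, pos k.+1 = padd (pos k) (0, 1).
    by move=> k; rewrite /pos /padd /=; congr pair; lia.
  move=> /(_ (-1, 1) (tn (N - h))) hh.
  have e : (tn (N - h))%:Z = N - h by apply: tn_pos; lia.
  have -> : (x, h) = pos 0%N by rewrite /pos addr0.
  apply: run_ext (hh _).
  - move=> p; rewrite /St addr0 /edge /edge_q /in_tri /=.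
    by do ?case: ifP; lia.
  - by move=> p; rewrite /St e addrC subrK.
  move=> k km o; rewrite /St /o /pos /padd /=.
  have -> : h + k.+1%:Z = h + k%:Z + 1 by lia.
  by apply: (@edge_up _ _ _ _ N); lia.
rewrite push_cat; apply: (@run_cat _ _ _ (edge_q M xl h x 0 N Z)).
  pose pos (k : nat) : point := (x, h - k%:Z - 1).
  pose St (k : nat) := edge_q M xl h x (h - k%:Z) N Z.
  have /(@run_push pos St) : forall k, pos k.+1 = padd (pos k) (0, -1).
    by move=> k; rewrite /pos /padd /=; congr pair; lia.
  move=> /(_ (-1, 0) (tn h)) hh.
  have e : (tn h)%:Z = h by apply: tn_pos; lia.
  have -> : (x, h - 1) = pos 0%N by rewrite /pos subr0.
  apply: run_ext (hh _).
  - by move=> p; rewrite /St subr0.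
  - by move=> p; rewrite /St e subrr.
  move=> k km o; rewrite /St /o /pos /padd /= addr0.
  have -> : h - k.+1%:Z = h - k%:Z - 1 by lia.
  by apply: (@edge_down _ _ _ _ N); lia.
apply: run_ext (IH (x - 1) (N + 1) _ _ _ _) => //; try lia.
by move=> p; rewrite /edge /edge_q /in_tri /=; do ?case: ifP; lia.
Qed.

(** * Widening a triangle *)

(** The row is stood up as the left edge, which moves left while absorbing [l] points, and is laid
    down again by a sweep of size [n + l] run backwards from the corner [(- l, 0)]. *)
Definition widen_ops (n h l : int) : seq op :=
  sweep (n - 1) 0 (tn (n - 1)) (absorb 0 n h (tn l) [::]) ++
  map (map_op (padd (- l, 0)))
    (revops (sweep (n + l - 1) 0 (tn (n + l - 1)) [::]) [::]).

Lemma tri3_padd v x y z : tri3 x y z -> tri3 (padd v x) (padd v y) (padd v z).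
Proof.
case: x y z => [x1 x2] [y1 y2] [z1 z2] [[u1 u2]].
rewrite /in_tri /= !inE !xpair_eqE => h.
by exists (padd v (u1, u2)); rewrite /in_tri /= !inE !xpair_eqE /=; lia.
Qed.

Lemma run_widen_ops (n l : nat) (h : int) (Z : point -> bool) :
  (0 < n)%N -> (l = 0%N \/ 0 <= h <= n%:Z) ->
  run (fun p => if in_tri (- l%:Z, 0) (n + l) p
                then ((p.2 == 0) && (0 <= p.1)) || ((p.2 == h) && (p.1 < 0)) else Z p)
    (widen_ops n%:Z h l%:Z)
    (fun p => if in_tri (- l%:Z, 0) (n + l) p then p.2 == 0 else Z p).
Proof.
move=> n0 hl; rewrite /widen_ops sweep_cat -catA.
(* The points that stick out lie outside the small triangle, so for its sweep they belong to the
   background. *)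
pose Z1 p := if in_tri (- l%:Z, 0) (n + l) p then (p.2 == h) && (p.1 < 0) else Z p.
have en : (tn (n%:Z - 1))%:Z = n%:Z - 1 by apply: tn_pos; lia.
have enl : (tn (n%:Z + l%:Z - 1))%:Z = n%:Z + l%:Z - 1 by apply: tn_pos; lia.
apply: (@run_cat _ _ _ (edge (n + l) (- l%:Z) h 0 Z)).
  have := @run_sweep n 0 (tn (n%:Z - 1)) Z1; rewrite en subr0 add0r => r.
  apply: run_ext (r _ _); try lia.
    by move=> [x y]; rewrite /level /level_q /Z1 /in_tri /=; do ?case: ifP; lia.
  by move=> [x y]; rewrite /level /level_q /edge /Z1 /in_tri /=; do ?case: ifP; lia.
apply: (@run_cat _ _ _ (edge (n + l) (- l%:Z) h (- l%:Z) Z)).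
  case: hl => [-> //|hl].
  by apply: run_absorb; rewrite /=; lia.
(* The same background seen from the corner of the widened triangle, inside which it is empty. *)
pose Z2 p := if in_tri (0, 0) (n + l) p then false else Z (padd (- l%:Z, 0) p).
have K1 : cancel (padd (- l%:Z, 0)) (padd (l%:Z, 0)).
  by move=> [x y]; rewrite /padd /=; congr pair; lia.
have K2 : cancel (padd (l%:Z, 0)) (padd (- l%:Z, 0)).
  by move=> [x y]; rewrite /padd /=; congr pair; lia.
rewrite revopsE cats0.
have r : run (level (n + l) 0 Z2) (sweep (n%:Z + l%:Z - 1) 0 (tn (n%:Z + l%:Z - 1)) [::])
             (level (n + l) (n%:Z + l%:Z - 1) Z2).
  by have := @run_sweep (n + l) 0 (tn (n%:Z + l%:Z - 1)) Z2; rewrite enl subr0 add0r PoszD;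
    apply; lia.
have := run_map K1 K2 (@tri3_padd _) (run_rev r).
apply: run_ext => [[x y]|[x y]];
  rewrite /= /edge /level /level_q /Z2 /in_tri /padd /= addNKr addKr.
  by do ?case: ifP; lia.
by do ?case: ifP; lia.
Qed.

(** * Merging two triangles *)

(* The frame at the right corner reflects the lattice and permutes the
   translates of T. *)
Definition frame (f : bool) (o p : point) : point :=
  if f then (o.1 - p.1 - p.2, o.2 + p.2) else (o.1 + p.1, o.2 + p.2).

Definition unframe (f : bool) (o p : point) : point :=
  if f then (o.1 + o.2 - p.1 - p.2, p.2 - o.2) else (p.1 - o.1, p.2 - o.2).

Lemma frameK f o : cancel (frame f o) (unframe f o).
Proof. by move=> [x y]; rewrite /frame /unframe; case: f => /=; congr pair; lia. Qed.

Lemma unframeK f o : cancel (unframe f o) (frame f o).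
Proof. by move=> [x y]; rewrite /frame /unframe; case: f => /=; congr pair; lia. Qed.

Lemma tri3_frame f o x y z :
  tri3 x y z -> tri3 (frame f o x) (frame f o y) (frame f o z).
Proof.
case: x y z => [x1 x2] [y1 y2] [z1 z2] [[u1 u2]].
rewrite /in_tri /= !inE !xpair_eqE => h.
exists (if f then (o.1 - u1 - u2 - 1, o.2 + u2) else (o.1 + u1, o.2 + u2)).
by rewrite /frame; case: f; rewrite /in_tri /= !inE !xpair_eqE /=; lia.
Qed.

Fixpoint map_frame (f : bool) (o : point) (ops tl : seq op) : seq op :=
  if ops is x :: ops' then map_op (frame f o) x :: map_frame f o ops' tl else tl.

Lemma map_frameE f o ops tl :
  map_frame f o ops tl = map (map_op (frame f o)) ops ++ tl.
Proof. by elim: ops => //= x ops ->. Qed.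

Lemma run_frame f o ops (S S' : point -> bool) :
  run S ops S' ->
  run (S \o unframe f o) (map_frame f o ops [::]) (S' \o unframe f o).
Proof.
by rewrite map_frameE cats0; apply: run_map (@tri3_frame f o);
  [exact: frameK | exact: unframeK].
Qed.

Definition widen (f : bool) (o : point) (n h l : int) (tl : seq op) : seq op :=
  map_frame f o (sweep (n - 1) 0 (tn (n - 1)) (absorb 0 n h (tn l) [::]))
    (map_frame f (frame f o (- l, 0))
      (revops (sweep (n + l - 1) 0 (tn (n + l - 1)) [::]) [::]) tl).

(** A translation by [- l] inside a frame only moves the origin of the frame, so the program
    composes no maps. *)
Lemma widenE f o n h l tl :
  widen f o n h l tl = map_frame f o (widen_ops n h l) [::] ++ tl.
Proof.
rewrite /widen /widen_ops !map_frameE cats0 map_cat -catA; congr (_ ++ (_ ++ _)).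
rewrite -map_comp; apply: eq_map => -[[x1 x2] [y1 y2]].
by rewrite /map_op /frame /padd /=; case: f => /=; congr pair; congr pair; lia.
Qed.

Lemma run_widen (f : bool) (o : point) (n l : nat) (h : int) (S : point -> bool) :
  (0 < n)%N -> (l = 0%N \/ 0 <= h <= n%:Z) ->
  (forall i : int, 0 <= i < n%:Z -> S (frame f o (i, 0))) ->
  (forall i : int, - l%:Z <= i < 0 -> S (frame f o (i, h))) ->
  exists S' : point -> bool,
  [/\ run S (map_frame f o (widen_ops n%:Z h l%:Z) [::]) S',
      forall i : int, - l%:Z <= i < n%:Z -> S' (frame f o (i, 0))
    & forall p, ~~ in_tri (- l%:Z, 0) (n + l) (unframe f o p) -> S p -> S' p].
Proof.
move=> n0 hl h1 h2.
have r := run_frame f o (run_widen_ops (S \o frame f o) n0 hl).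
have [|S' r' s'] := run_mono r (P := S).
  move=> p; rewrite /= -[in S p](unframeK f o p); move: (unframe f o p) => [x y].
  rewrite /in_tri /=; case: ifP => // h3 /orP [/andP [/eqP -> h4]|/andP [/eqP -> h4]].
    by apply: h1; lia.
  by apply: h2; lia.
exists S'; split => //.
  by move=> i hi; apply: s'; rewrite /= frameK /in_tri /=; case: ifP; lia.
by move=> p hp sp; apply: s'; rewrite /= (negbTE hp) unframeK.
Qed.

Definition tria : Type := (point * nat)%type.

Definition inside (A : tria) : point -> bool := in_tri A.1 A.2.

Definition bottom (A : tria) (p : point) : bool := inside A p && (p.2 == A.1.2).

(** The strict bound of the third side. Two triangles intersect in the triangle whose corner has the
    two maxima as coordinates and whose bound is the smaller [csum]; [near] also admits size 0 for
    it. *)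
Definition csum (A : tria) : int := A.1.1 + A.1.2 + A.2%:Z.

(* The triangles meet or touch. *)
Definition near (A D : tria) : bool :=
  Num.max A.1.1 D.1.1 + Num.max A.1.2 D.1.2 <= Num.min (csum A) (csum D).

Definition lefto (lo up : tria) : nat := tn (lo.1.1 - up.1.1).
Definition righto (lo up : tria) : nat := tn (csum up - csum lo).

Definition merge_ops (lo up : tria) : seq op :=
  let n := lo.2%:Z in
  let h := up.1.2 - lo.1.2 in
  let l := (lefto lo up)%:Z in
  widen false lo.1 n h l
    (widen true (lo.1.1 + n - 1, lo.1.2) (n + l) h (righto lo up)%:Z [::]).

Definition join (lo up : tria) : tria :=
  ((lo.1.1 - (lefto lo up)%:Z, lo.1.2), (lo.2 + lefto lo up + righto lo up)%N).

Lemma tnE z : (tn z)%:Z = Num.max 0 z.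
Proof. by case: z => //= n; lia. Qed.

Lemma near_sym A D : near A D = near D A.
Proof. by rewrite /near; lia. Qed.

(** When [up] overhangs on both sides, the overhangs add up to [up.2] plus its height above [lo]
    minus [lo.2], and nearness makes that height at most [lo.2]. This keeps the total size of the
    triangles below the number of inserted points. *)
Lemma join_size lo up : near lo up -> lo.1.2 <= up.1.2 ->
  (0 < up.2)%N -> ((join lo up).2 <= lo.2 + up.2)%N.
Proof.
case: lo up => [[a b] n] [[a' b'] n'].
rewrite /near /csum /= /lefto /righto /csum /= => h1 h2 h3.
by have := tnE (a - a'); have := tnE (a' + b' + n'%:Z - (a + b + n%:Z)); lia.
Qed.

Lemma join_insideL lo up p : inside lo p -> inside (join lo up) p.
Proof.
case: lo up => [[a b] n] [[a' b'] n'].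
rewrite /inside /in_tri /join /lefto /righto /csum /=.
by have := tnE (a - a'); have := tnE (a' + b' + n'%:Z - (a + b + n%:Z)); lia.
Qed.

Lemma join_insideR lo up p : lo.1.2 <= up.1.2 -> inside up p -> inside (join lo up) p.
Proof.
case: lo up => [[a b] n] [[a' b'] n'].
rewrite /inside /in_tri /join /lefto /righto /csum /=.
by have := tnE (a - a'); have := tnE (a' + b' + n'%:Z - (a + b + n%:Z)); lia.
Qed.

Lemma run_merge lo up (S : point -> bool) :
  near lo up -> lo.1.2 <= up.1.2 -> (0 < lo.2)%N -> (0 < up.2)%N ->
  (forall p, bottom lo p -> S p) ->
  (forall p, bottom up p -> ~~ inside lo p -> S p) ->
  exists S' : point -> bool,
  [/\ run S (merge_ops lo up) S',
      forall p, bottom (join lo up) p -> S' p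
    & forall p, ~~ inside (join lo up) p -> S p -> S' p].
Proof.
case: lo up => [[a b] n] [[a' b'] n'].
rewrite /near /csum /= /lefto /righto /csum /= => nr bb n0 n0' Slo Sup.
rewrite /merge_ops /join /lefto /righto /csum /=.
have := tnE (a - a'); have := tnE (a' + b' + n'%:Z - (a + b + n%:Z)).
move: (tn (a - a')) (tn _) => l r er el.
have [||i hi|i hi|S1 [r1 bot1 out1]] :=
  @run_widen false (a, b) n l (b' - b) S.
- by [].
- lia.
- by apply: Slo; rewrite /bottom /inside /in_tri /frame /=; lia.
- by apply: Sup; rewrite /bottom /inside /in_tri /frame /=; lia.
have [||i hi|i hi|S2 [r2 bot2 out2]] :=
  @run_widen true (a + n%:Z - 1, b) (n + l) r (b' - b) S1.
- by lia.
- lia.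
- have := bot1 (n%:Z - 1 - i); rewrite /frame /=.
  have -> : a + (n%:Z - 1 - i) = a + n%:Z - 1 - i - 0 by lia.
  by apply; lia.
(* The points that stick out on the right are outside the triangle widened first, which has left
   them in place. *)
- apply: out1; rewrite /frame /unframe /in_tri /=; first by lia.
  by apply: Sup; rewrite /bottom /inside /in_tri /frame /=; lia.
exists S2; split.
- by rewrite !widenE cats0; apply: run_cat r1 _; rewrite PoszD in r2.
- move=> [x y]; rewrite /bottom /inside /in_tri /= => hp.
  have := bot2 (a + n%:Z - 1 - x); rewrite /frame /=.
  have -> : a + n%:Z - 1 - (a + n%:Z - 1 - x) - 0 = x by lia.
  have -> : b + 0 = y by lia.
  by apply; lia.
move=> [x y]; rewrite /inside /in_tri /= => hp sp.
apply: out2; first by rewrite /unframe /in_tri /=; lia.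
by apply: out1 => //; rewrite /unframe /in_tri /=; lia.
Qed.

(** * Number of moves of a merge *)

Lemma size_push x d s m tl : size (push x d s m tl) = (m + size tl)%N.
Proof. by elim: m x => //= m IH x; rewrite IH. Qed.

Lemma size_sweep (N : nat) (z r : int) m tl : z <= N%:Z ->
  (size (sweep z r m tl) <= m * N + size tl)%N.
Proof.
elim: m z r => [|m IH] z r zN //=; rewrite size_push.
by have := IH (z - 1) (r + 1); have := tnE z; lia.
Qed.

Lemma size_absorb (M : nat) (x N h : int) l tl :
  (l = 0%N \/ 0 <= h <= N) -> N + l%:Z <= M%:Z ->
  (size (absorb x N h l tl) <= l * M + size tl)%N.
Proof.
elim: l x N => [|l IH] x N hN NM //=; rewrite !size_push.
case: hN => // hN; have := IH (x - 1) (N + 1).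
by have := tnE (N - h); have := tnE h; lia.
Qed.

Lemma size_revops ops acc : size (revops ops acc) = (size ops + size acc)%N.
Proof. by rewrite revopsE size_cat size_rev size_map. Qed.

Lemma size_map_frame f o ops tl : size (map_frame f o ops tl) = (size ops + size tl)%N.
Proof. by rewrite map_frameE size_cat size_map. Qed.

(** [M ^ 2] for each of the two sweeps and for the absorption; a merge widens twice, whence its
    [6 * M ^ 2]. *)
Lemma size_widen f o (n l M : nat) (h : int) tl :
  (0 < n)%N -> (l = 0%N \/ 0 <= h <= n%:Z) -> (n + l <= M)%N ->
  (size (widen f o n%:Z h l%:Z tl) <= 3 * M ^ 2 + size tl)%N.
Proof.
move=> n0 hl nM; have lM : (l <= M)%N by lia.
 rewrite /widen !size_map_frame size_revops /=.
have := @size_absorb M 0 n h l [::] hl; rewrite /=.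
have := @size_sweep M (n%:Z - 1) 0 (tn (n%:Z - 1)) (absorb 0 n h l [::]).
have := @size_sweep M (n%:Z + l%:Z - 1) 0 (tn (n%:Z + l%:Z - 1)) [::].
have : (tn (n%:Z - 1) <= M)%N by have := tnE (n%:Z - 1); lia.
have : (tn (n%:Z + l%:Z - 1) <= M)%N by have := tnE (n%:Z + l%:Z - 1); lia.
move: (tn _) (tn _) => u v hu hv h1 h2 h3.
have : (u * M <= M * M)%N by rewrite leq_mul2r; lia.
have : (v * M <= M * M)%N by rewrite leq_mul2r; lia.
have : (l * M <= M * M)%N by rewrite leq_mul2r lM orbT.
rewrite /= in h1 h2 h3; have {}h1 := h1 ltac:(lia).
have {}h2 := h2 ltac:(lia); have {}h3 := h3 ltac:(lia).
by rewrite expnS expn1 /=; lia.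
Qed.

Lemma size_merge_ops (M : nat) lo up :
  near lo up -> lo.1.2 <= up.1.2 -> (0 < lo.2)%N -> (0 < up.2)%N ->
  ((join lo up).2 <= M)%N -> (size (merge_ops lo up) <= 6 * M ^ 2)%N.
Proof.
case: lo up => [[a b] n] [[a' b'] n'].
rewrite /near /csum /= /lefto /righto /csum /= => nr bb n0 n0'.
rewrite /merge_ops /join /lefto /righto /csum /=.
have := tnE (a - a'); have := tnE (a' + b' + n'%:Z - (a + b + n%:Z)).
move: (tn (a - a')) (tn _) => l r er el hM.
apply: leq_trans (@size_widen false (a, b) n l M _ _ _ _ _) _ => //; try lia.
rewrite -PoszD.
have := @size_widen true (a + n%:Z - 1, b) (n + l) r M (b' - b) [::].
by move=> /(_ _ _ _) h; rewrite /= in h; have := h ltac:(lia) ltac:(lia) ltac:(lia); lia.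
Qed.

(** * Executing a run on lists of points *)

Definition repl (x z : point) (c : seq point) : seq point :=
  [seq if p == x then z else p | p <- c].

(** An enabled exchange with occupied target changes nothing and is not a move, so it is not
    recorded. The newest configuration comes first. *)
Fixpoint exec (h : seq (seq point)) (ops : seq op) : seq (seq point) :=
  if ops is o :: ops' then
    exec (if o.2 \in head [::] h then h else repl o.1 o.2 (head [::] h) :: h) ops'
  else h.

Definition fs (c : seq point) : config := [fset p in c].

Lemma fsE c p : (p \in fs c) = (p \in c).
Proof. by rewrite in_fset. Qed.

Fixpoint history (s : seq point) (h : seq (seq point)) : Prop :=
  if h is c :: r then
    uniq c /\ size c = size s /\
    (if r is c' :: _ then move (fs c') (fs c) /\ history s r else c = s)
  else False.

Lemma tri3_mem v x y z : uniq [:: x; y; z] ->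
  in_tri v 2 x -> in_tri v 2 y -> in_tri v 2 z -> in_tri v 2 =i [:: x; y; z].
Proof.
move=> u hx hy hz.
pose s3 := [:: v; (v.1 + 1, v.2); (v.1, v.2 + 1)].
have e p : in_tri v 2 p = (p \in s3).
  rewrite /s3; case: v {s3 hx hy hz} p => v1 v2 [p1 p2].
  by rewrite /in_tri /= !inE !xpair_eqE /=; lia.
have sub : {subset [:: x; y; z] <= s3}.
  by move=> p; rewrite -e !inE => /or3P [] /eqP ->.
have [_ h] := uniq_min_size u sub isT.
by move=> p; rewrite h -e.
Qed.

Lemma repl_mem x z c p : uniq c -> x \in c -> z \notin c ->
  (p \in repl x z c) = (tau (x, z) p \in c).
Proof.
move=> u xc zc; apply/mapP/idP.
  case=> q qc ->; case: eqP => [_|/eqP qx]; first by rewrite (tau2 (x, z)).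
  rewrite /tau /= (negbTE qx); case: eqP => // e; by rewrite -e qc in zc.
rewrite /tau /=; case: (eqVneq p x) => [->|px]; first by rewrite (negbTE zc).
case: (eqVneq p z) => [->|pz] h; first by exists x; rewrite ?eqxx.
by exists p; rewrite // (negbTE px).
Qed.

Lemma repl_uniq x z c : uniq c -> z \notin c -> uniq (repl x z c).
Proof.
move=> u zc; rewrite map_inj_in_uniq // => p q pc qc.
case: eqP => [->|_]; case: eqP => [->|_] // e.
  by rewrite e qc in zc.
by rewrite -e pc in zc.
Qed.

Lemma move_repl c x z : uniq c -> z \notin c -> enabled (mem c) (x, z) ->
  move (fs c) (fs (repl x z c)).
Proof.
move=> u zc [/= xc [y yc [v /and4P [u3 hx hy hz]]]].
have tE := tri3_mem u3 hx hy hz.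
have nxz : x != z by apply: contraNneq zc => <-.
have nyz : y != z by apply: contraNneq zc => <-.
have nxy : x != y by move: u3; rewrite /= !inE; lia.
have mR p : (p \in repl x z c) = (tau (x, z) p \in c) by rewrite repl_mem.
have inT p : (p \in shift v T) = (p \in [:: x; y; z]) by rewrite shift_TE -(tE p).
have ty : tau (x, z) y = y by rewrite /tau /= eq_sym (negbTE nxy) (negbTE nyz).
exists v; split.
- have -> : fs c `&` shift v T = [fset x; y].
    apply/fsetP => p; rewrite in_fsetI in_fset2 fsE inT !inE.
    case: (eqVneq p x) => [->|px]; first by rewrite xc.
    case: (eqVneq p y) => [->|py]; first by rewrite yc.
    by case: (eqVneq p z) => [->|pz]; [rewrite (negbTE zc) | rewrite andbF].
  by rewrite cardfs2 nxy.
- have -> : fs (repl x z c) `&` shift v T = [fset y; z].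
    apply/fsetP => p; rewrite in_fsetI in_fset2 fsE inT !inE mR.
    case: (eqVneq p x) => [->|px].
      by rewrite (tau1 (x, z)) /= (negbTE zc) (negbTE nxy) (negbTE nxz).
    case: (eqVneq p y) => [->|py]; first by rewrite ty yc.
    by case: (eqVneq p z) => [->|pz]; [rewrite (tau2 (x, z)) xc | rewrite andbF].
  by rewrite cardfs2 nyz.
- have -> : (fs c `\` fs (repl x z c)) `|` (fs (repl x z c) `\` fs c) = [fset x; z].
    apply/fsetP => p; rewrite in_fsetU !in_fsetD in_fset2 !fsE !mR.
    case: (eqVneq p x) => [->|px]; first by rewrite (tau1 (x, z)) /= xc (negbTE zc).
    case: (eqVneq p z) => [->|pz]; first by rewrite (tau2 (x, z)) xc (negbTE zc).
    by rewrite /tau /= (negbTE px) (negbTE pz); case: (p \in c).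
  by rewrite cardfs2 nxz.
apply/fsubsetP => p; rewrite in_fsetU !in_fsetD !fsE !mR inT !inE.
case: (eqVneq p x) => // px.
case: (eqVneq p z) => [|pz]; first by rewrite !orbT.
by rewrite /tau /= (negbTE px) (negbTE pz); case: (p \in c).
Qed.

Lemma exec_run s h ops (S' : point -> bool) :
  history s h -> run (mem (head [::] h)) ops S' ->
  [/\ history s (exec h ops), mem (head [::] (exec h ops)) =1 S'
    & (size (exec h ops) <= size h + size ops)%N].
Proof.
elim: ops h => [|o ops IH] h hs /=; first by move=> e; split; rewrite ?addn0.
case=> en r; case: ifP => oc.
  have e : mem (head [::] h) \o tau o =1 mem (head [::] h).
    have xh : o.1 \in head [::] h := en.1.
    move=> p; change ((tau o p \in head [::] h) = (p \in head [::] h)).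
    by rewrite /tau; do 2?case: eqP => [->|_] //; rewrite oc xh.
  have [h1 h2 h3] := IH h hs (run_ext e (frefl _) r).
  by split => //; lia.
case: h hs en r oc => // c h [uc [sc hh]] /= en r /negbT oc.
have xc : o.1 \in c := en.1.
have e : mem c \o tau o =1 mem (repl o.1 o.2 c).
  move=> p; change ((tau o p \in c) = (p \in repl o.1 o.2 c)).
  by rewrite repl_mem //; case: (o).
have [|h1 h2 h3] := IH (repl o.1 o.2 c :: c :: h) _ (run_ext e (frefl _) r).
  split; first exact: repl_uniq.
  split; first by rewrite size_map.
  by split => //; apply: move_repl => //; case: (o) en.
by split => //=; rewrite /= in h3; lia.
Qed.

(** * Insertion of the points *)

(** Ties make [A] the lower triangle: the bottom row of [D] is known to be full only outside [A],
    which is what [run_merge] asks of the upper one. *)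
Definition lower_first (A D : tria) : tria * tria :=
  if D.1.2 < A.1.2 then (D, A) else (A, D).

(** After a merge [A] has grown and may come near triangles already put aside in [G], so a single
    pass need not suffice. *)
Fixpoint pass (h : seq (seq point)) (A : tria) (F G : seq tria) :=
  if F is D :: F' then
    if near A D then
      pass (exec h (merge_ops (lower_first A D).1 (lower_first A D).2))
           (join (lower_first A D).1 (lower_first A D).2) F' G
    else pass h A F' (D :: G)
  else (h, A, G).

(** One pass per triangle is enough, because a pass that merges shortens the list and after one that
    does not, all is done. Taking that list as the fuel saves the program a counter. *)
Fixpoint passes (fuel : seq tria) (st : seq (seq point) * tria * seq tria) :=
  if fuel is _ :: fuel' then passes fuel' (pass st.1.1 st.1.2 st.2 [::]) else st.

Definition covered (F : seq tria) (x : point) : bool := has (fun D => inside D x) F.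

Fixpoint build (s : seq point) (h : seq (seq point)) (F : seq tria) :=
  if s is x :: s' then
    if covered F x then build s' h F else
    let st := passes F (h, (x, 1%N), F) in
    build s' st.1.1 (st.1.2 :: st.2)
  else (h, F).

(* The bottom rows of the triangles in L are only known to be full outside the
   growing triangle A, whose moves may have disturbed them. *)
Definition good (s : seq point) (h : seq (seq point)) (A : tria) (L : seq tria) : Prop :=
  [/\ history s h,
      forall p, bottom A p -> p \in head [::] h,
      forall D p, D \in L -> bottom D p -> ~~ inside A p -> p \in head [::] h,
      (0 < A.2)%N /\ forall D, D \in L -> (0 < D.2)%N
    & forall p, p \in s -> ~~ inside A p -> ~~ covered L p -> p \in head [::] h].

Definition separated (L : seq tria) : Prop :=
  uniq L /\ forall D E, D \in L -> E \in L -> near D E -> D = E.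

Definition weight (L : seq tria) : nat := \sum_(D <- L) D.2.

Lemma covered_perm L1 L2 : perm_eq L1 L2 -> covered L1 =1 covered L2.
Proof. by move=> h x; rewrite /covered; apply: perm_has. Qed.

Lemma good_perm s h A L1 L2 : perm_eq L1 L2 -> good s h A L1 -> good s h A L2.
Proof.
move=> pl [h1 h2 h3 [h4 h4'] h5]; split => //.
- by move=> D p; rewrite -(perm_mem pl); exact: h3.
- by split=> // D; rewrite -(perm_mem pl); exact: h4'.
by move=> p; rewrite -(covered_perm pl); exact: h5.
Qed.

Lemma separated_perm L1 L2 : perm_eq L1 L2 -> separated L1 -> separated L2.
Proof.
move=> pl [u h]; split; first by rewrite -(perm_uniq pl).
by move=> D E; rewrite -!(perm_mem pl); exact: h.
Qed.

Lemma weight_perm L1 L2 : perm_eq L1 L2 -> weight L1 = weight L2.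
Proof. by move=> h; rewrite /weight (perm_big _ h). Qed.

Lemma weight_cons D L : weight (D :: L) = (D.2 + weight L)%N.
Proof. by rewrite /weight big_cons. Qed.

Lemma good_merge s h A D L (lo := (lower_first A D).1) (up := (lower_first A D).2) :
  near A D -> good s h A (D :: L) ->
  [/\ good s (exec h (merge_ops lo up)) (join lo up) L,
      ((join lo up).2 <= A.2 + D.2)%N,
      (size (exec h (merge_ops lo up)) <= size h + 6 * (join lo up).2 ^ 2)%N
    & forall p, inside A p || inside D p -> inside (join lo up) p].
Proof.
move=> nr [hs bA bD [A0 D0] out].
have DL : D \in D :: L by rewrite mem_head.
have D0' := D0 D DL.
have [nr' le lo0 up0 [blo [bup sz ins]]] :
  [/\ near lo up, lo.1.2 <= up.1.2, (0 < lo.2)%N, (0 < up.2)%N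
    & (forall p, bottom lo p -> p \in head [::] h) /\
    [/\ forall p, bottom up p -> ~~ inside lo p -> p \in head [::] h,
        (lo.2 + up.2 = A.2 + D.2)%N & forall p,
          inside lo p || inside up p = inside A p || inside D p]].
  rewrite /lo /up /lower_first; case: ifP => dA /=; split => //; try (by rewrite near_sym);
    try lia.
    split; last by split => [p bp _| |p]; [exact: bA | rewrite addnC | rewrite orbC].
    (* [D] is strictly lower than [A], so its bottom row is outside [A] and therefore full. *)
    move=> p bp; apply: (bD _ _ DL bp).
    by move: bp; rewrite /bottom /inside /in_tri; lia.
  by split => //; split => // p bp ip; exact: (bD _ _ DL bp ip).
have [S' [r b' o']] := run_merge nr' le lo0 up0 blo bup.
have [hs' e' sz'] := exec_run hs r.
have e p : (p \in head [::] (exec h (merge_ops lo up))) = S' p := e' p.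
have szj := join_size nr' le up0.
have ins' p : inside A p || inside D p -> inside (join lo up) p.
  rewrite -ins => /orP [|]; first exact: join_insideL.
  exact: join_insideR.
split => //; last 2 first.
- by rewrite -sz.
- apply: leq_trans sz' _; rewrite leq_add2l; exact: (size_merge_ops nr' le lo0 up0 (leqnn _)).
split => //.
- by move=> p; rewrite e; exact: b'.
- move=> E p EL bE np; rewrite e; apply: o' => //.
  apply: (bD E) => //; first by rewrite inE EL orbT.
  by apply: contra np => h1; apply: ins'; rewrite h1.
- split; first by rewrite /join /=; lia.
  by move=> E EL; apply: D0; rewrite inE EL orbT.
move=> p ps np nc; rewrite e; apply: o' => //; apply: out => //.
  by apply: contra np => h1; apply: ins'; rewrite h1.
rewrite /covered /= negb_or; apply/andP; split => //.
by apply: contra np => h1; apply: ins'; rewrite h1 orbT.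
Qed.

(** The length of the history plus [6 * W ^ 2] times the number of triangles is a potential: each
    merge is paid by the triangle it removes. The last clause separates a pass that merged, which
    shortens the list, from one that left [A] as it was and compared it with every triangle. *)
Lemma pass_ok s (W : nat) h A F G :
  good s h A (F ++ G) -> separated (F ++ G) -> (A.2 + weight (F ++ G) <= W)%N ->
  let st := pass h A F G in
  [/\ good s st.1.1 st.1.2 st.2, separated st.2, (st.1.2.2 + weight st.2 <= W)%N,
      (size st.1.1 + 6 * W ^ 2 * size st.2 <= size h + 6 * W ^ 2 * (size F + size G))%N
    & (forall p, inside A p || covered (F ++ G) p -> inside st.1.2 p || covered st.2 p) /\
      ((forall D, D \in G -> ~~ near A D) ->
       (size st.2 < size F + size G)%N \/
       size st.2 = (size F + size G)%N /\ forall D, D \in st.2 -> ~~ near st.1.2 D)].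
Proof.
elim: F h A G => [|D F IH] h A G gd sp wt /=.
  by split => //; split => // h1; right; split.
case: ifP => nr; last first.
  have pl : perm_eq ((D :: F) ++ G) (F ++ D :: G).
    by rewrite perm_sym; apply/permPl; exact: (perm_catCA F [:: D] G).
  have wt' : (A.2 + weight (F ++ D :: G) <= W)%N by rewrite -(weight_perm pl).
  have [h1 h2 h3 h4 [h5 h6]] := IH h A (D :: G) (good_perm pl gd) (separated_perm pl sp) wt'.
  split => //.
    by move: h4; rewrite /= addnS.
  split.
    by move=> p hp; apply: h5; rewrite -(covered_perm pl).
  move=> h7; rewrite addSnnS; apply: h6 => E; rewrite inE => /orP [/eqP ->|]; last exact: h7.
  by rewrite nr.
have [g1 g2 g3 g4] := good_merge nr gd.
have sp' : separated (F ++ G).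
  case: sp => /= /andP [_ u] h1; split => // E E' hE hE'.
  by apply: h1; rewrite inE ?hE ?hE' orbT.
move: wt; rewrite cat_cons weight_cons => wt.
have [|h1 h2 h3 h4 [h5 h6]] := IH _ _ G g1 sp'; first by lia.
split => //.
  apply: leq_trans h4 _; rewrite addSn mulnSr addnA.
  have jW : ((join (lower_first A D).1 (lower_first A D).2).2 ^ 2 <= W ^ 2)%N by rewrite
    leq_exp2r //; lia.
  move: g3 jW; move: (_ ^ 2)%N (W ^ 2)%N => u v;
    move: (size _) (size _) (size F + _)%N => x y z.
  by nia.
split.
  move=> p hp; apply: h5; move: hp; rewrite /covered /= orbA => /orP [/g4 ->//|->].
  by rewrite orbT.
move=> _; left; apply: leq_ltn_trans (_ : (size F + size G < _)%N); last by lia.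
have sz hh B K L : (size (pass hh B K L).2 <= size K + size L)%N.
  elim: K hh B L => [|E K IHK] hh B L //=; case: ifP => _.
    by apply: leq_trans (IHK _ _ _) _; lia.
  by apply: leq_trans (IHK _ _ _) _; rewrite /= addnS.
exact: sz.
Qed.

Lemma pass_id h A F G : (forall D, D \in F -> ~~ near A D) ->
  pass h A F G = (h, A, catrev F G).
Proof.
elim: F G => //= D F IH G nn; rewrite (negbTE (nn D _)) ?mem_head //.
by rewrite IH // => E EF; apply: nn; rewrite inE EF orbT.
Qed.

Lemma passes_id fuel h A F : (forall D, D \in F -> ~~ near A D) ->
  let st := passes fuel (h, A, F) in
  st.1.2 = A /\ forall D, D \in st.2 -> ~~ near A D.
Proof.
elim: fuel F => //= E fuel IH F nn; rewrite pass_id //; apply: IH => D.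
by rewrite catrevE cats0 mem_rev; exact: nn.
Qed.

Lemma passes_ok s (W : nat) fuel h A F :
  good s h A F -> separated F -> (A.2 + weight F <= W)%N ->
  let st := passes fuel (h, A, F) in
  [/\ good s st.1.1 st.1.2 st.2, separated st.2, (st.1.2.2 + weight st.2 <= W)%N,
      (size st.1.1 + 6 * W ^ 2 * size st.2 <= size h + 6 * W ^ 2 * size F)%N
    & (forall p, inside A p || covered F p -> inside st.1.2 p || covered st.2 p) /\
      ((size st.2 + size fuel <= size F)%N \/
       forall D, D \in st.2 -> ~~ near st.1.2 D)].
Proof.
elim: fuel h A F => [|E fuel IH] h A F gd sp wt.
  by split => //=; split => //; left; rewrite addn0.
have := @pass_ok s W h A F [::]; rewrite cats0 => /(_ gd sp wt).
rewrite [passes _ _]/=; case: (pass h A F [::]) => [[h1 A1] F1] /= [g1 s1 w1 z1 [c1 n1]].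
have [g2 s2 w2 z2 [c2 n2]] := IH h1 A1 F1 g1 s1 w1.
split => //; first by rewrite addn0 in z1; exact: leq_trans z2 z1.
split; first by move=> p /c1 /c2.
case: n1 => // [lt|[eq nn]]; last by right; have [-> ] := passes_id fuel h1 nn.
case: n2 => n2; [left|by right].
by rewrite addn0 in lt; rewrite /= addnS; exact: leq_ltn_trans n2 lt.
Qed.

Definition bgood (s : seq point) (h : seq (seq point)) (F : seq tria) : Prop :=
  [/\ history s h,
      forall D p, D \in F -> bottom D p -> p \in head [::] h,
      forall D, D \in F -> (0 < D.2)%N,
      separated F
    & forall p, p \in s -> ~~ covered F p -> p \in head [::] h].

Lemma near_refl A : near A A.
Proof. by rewrite /near /csum; lia. Qed.

Lemma far_disjoint A D p : ~~ near A D -> inside A p -> ~~ inside D p.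
Proof.
case: A D => [[a b] n] [[a' b'] n'].
by rewrite /near /inside /in_tri /csum /=; lia.
Qed.

Lemma build_ok s0 (W : nat) s h F :
  bgood s0 h F -> {subset s <= s0} -> (weight F + size s <= W)%N ->
  let st := build s h F in
  [/\ bgood s0 st.1 st.2, (weight st.2 <= W)%N,
      (size st.1 + 6 * W ^ 2 * size st.2 <= size h + 6 * W ^ 2 * (size F + size s))%N
    & forall p, (p \in s) || covered F p -> covered st.2 p].
Proof.
elim: s h F => [|x s IH] h F bg sub wt /=.
  by split; rewrite ?addn0 //= in wt *.
have sub' : {subset s <= s0} by move=> p ps; apply: sub; rewrite inE ps orbT.
case: ifP => cx.
  have [|h1 h2 h3 h4] := IH h F bg sub'; first by apply: leq_trans wt;
    rewrite leq_add2l /= leqnSn.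
  split => //; first by apply: leq_trans h3 _; rewrite leq_add2l leq_mul2l /= addnS leqnSn orbT.
  move=> p; rewrite inE -orbA => /orP [/eqP ->|]; last exact: h4.
  by apply: h4; rewrite cx orbT.
have [hs bF F0 sp un] := bg.
have xS : x \in head [::] h by apply: un; rewrite ?cx // sub // mem_head.
have gd : good s0 h (x, 1%N) F.
  split => //.
  - case: x {wt sub cx} xS => a b xS [p q]; rewrite /bottom /inside /in_tri /= => hp.
    by have [-> ->] : p = a /\ q = b by lia.
  - by move=> D p DF bp _; exact: bF bp.
  - by move=> p ps _ nc; exact: un.
have [|g1 s1 w1 z1 [c1 n1]] := @passes_ok s0 W F h (x, 1%N) F gd sp.
  by rewrite /= in wt *; lia.
(* The potential needs the global bound [W], the sum of the sizes the sharp bound [1 + weight F]: an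
   inserted point adds at most 1 to the weight. *)
have [_ _ w0 _ _] := @passes_ok s0 (1 + weight F) F h (x, 1%N) F gd sp (leqnn _).
case: (passes _ _) g1 s1 w1 z1 c1 n1 w0 => [[h1 A1] F1] /= g1 s1 w1 z1 c1 n1 w0.
have nn D : D \in F1 -> ~~ near A1 D.
  (* With [F] itself as fuel, the first alternative leaves no triangle at all. *)
  case: n1 => n1; last exact: n1.
  by have -> : F1 = [::] by apply: size0nil; lia.
have [hs1 bA bL [A0 L0] un1] := g1.
have bg1 : bgood s0 h1 (A1 :: F1).
  split => //.
  - move=> D p; rewrite inE => /orP [/eqP -> |DF bp]; first exact: bA.
    apply: (bL D) => //; rewrite /bottom in bp; case/andP: bp => ip _.
    by apply: far_disjoint ip; rewrite near_sym; exact: nn.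
  - by move=> D; rewrite inE => /orP [/eqP -> //|]; exact: L0.
  - case: s1 => u1 s1; split.
      by rewrite /= u1 andbT; apply/negP => /nn; rewrite near_refl.
    move=> D E; rewrite !inE => /orP [/eqP ->|DF] /orP [/eqP ->|EF] // nr; last exact: s1.
      by have := nn _ EF; rewrite nr.
    by have := nn _ DF; rewrite near_sym nr.
  - move=> p ps; rewrite /covered /= negb_or => /andP [nA nc].
    exact: un1.
have [|h1' h2 h3 h4] := IH h1 (A1 :: F1) bg1 sub'.
  rewrite weight_cons; apply: leq_trans wt.
  by rewrite /= addnS -addSn leq_add2r.
split => //.
  apply: leq_trans h3 _; rewrite /= addSn addnS mulnSr mulnDr addnA.
  by rewrite mulnSr mulnDr !addnA !leq_add2r.
move=> p hp; apply: h4; rewrite /covered /=; move: hp; rewrite inE.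
case: (boolP (p \in s)) => //= _; rewrite orbF => hp; apply: c1.
case/orP: hp => [/eqP ->|->]; last by rewrite orbT.
by apply/orP; left; rewrite /inside /in_tri /=; lia.
Qed.

(** * Sorting the excess points *)

(* The targets of a full sweep enumerate the cells above the bottom row, row by
   row and, in the frame of the right corner, from left to right. *)
Definition cells (n : int) : seq point := map snd (sweep (n - 1) 0 (tn (n - 1)) [::]).

(** The row order of the normal form read in the frame of the right corner, which reverses each
    row. *)
Definition before (p q : point) : bool := (p.2 < q.2) || ((p.2 == q.2) && (q.1 < p.1)).

Lemma mem_push_row z r k (p : point) :
  (p \in map snd (push (z, r) (-1, 0) (-1, 1) k [::])) =
  [&& p.2 == r + 1, z - k%:Z <= p.1 & p.1 < z].
Proof.
elim: k z => [|k IH] z /=; first by rewrite in_nil; case: p => a b /=; lia.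
rewrite inE /padd /= addr0 IH; move: p {IH} => [a b]; rewrite xpair_eqE /=; lia.
Qed.

Lemma mem_sweep_cells N r m (p : point) :
  (p \in map snd (sweep N r m [::])) =
  [&& r < p.2, p.2 <= r + m%:Z, 0 <= p.1 & p.1 + p.2 <= N + r].
Proof.
elim: m N r => [|m IH] N r /=; first by rewrite in_nil; lia.
rewrite push_cat map_cat mem_cat mem_push_row IH.
by have := tnE N; move: p {IH} => [a b] /=; lia.
Qed.

Lemma pairwise_sweep N r m : pairwise before (map snd (sweep N r m [::])).
Proof.
elim: m N r => [|m IH] N r //=.
rewrite push_cat map_cat pairwise_cat IH andbT; apply/andP; split.
  apply/allrelP => p q; by rewrite mem_push_row mem_sweep_cells /before;
    move: p q => [a b] [a' b'] /=; lia.
move: (tn N) {IH} => k; elim: k N => [|k IH] z //=.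
rewrite /padd /= addr0 IH andbT; apply/allP => -[a b]; rewrite mem_push_row /before /padd /=;
  lia.
Qed.

Lemma mem_cells (n : nat) (p : point) :
  (p \in cells n%:Z) = [&& 0 <= p.1, 1 <= p.2 & p.1 + p.2 < n%:Z].
Proof. by rewrite /cells mem_sweep_cells; have := tnE (n%:Z - 1); case: p => a b /=; lia. Qed.

Lemma size_cells (n : nat) : size (cells n%:Z) = ((n * (n - 1)) %/ 2)%N.
Proof.
have h k r : (2 * size (sweep k%:Z r k [::]) = k * k.+1)%N.
  elim: k r => [|k IH] r //=; rewrite size_push.
  have -> : k.+1%:Z - 1 = k%:Z by lia.
  by have := IH (r + 1); lia.
rewrite /cells size_map; case: n => [|n] //.
have -> : n.+1%:Z - 1 = n%:Z by lia.
have := h n 0; rewrite /= => e.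
by rewrite subn1 /= mulnC -e mulKn.
Qed.

(** The list produced by [sweep] serves, through the targets of its exchanges, as the enumeration of
    the cells, in the program as well. *)
Fixpoint seek (c : seq point) (o : point) (ops : seq op) : option point :=
  if ops is x :: ops' then
    if frame true o x.2 \in c then Some x.2 else seek c o ops'
  else None.

Fixpoint fill (h : seq (seq point)) (o : point) (n : int) (ops : seq op) :=
  if ops is x :: ops' then
    if frame true o x.2 \in head [::] h then fill h o n ops' else
    if seek (head [::] h) o ops' is Some e then
      fill (exec h (map_frame true o (transport n e x.2) [::])) o n ops'
    else h
  else h.

Definition fill_tri (h : seq (seq point)) (D : tria) :=
  fill h (D.1.1 + D.2%:Z - 1, D.1.2) D.2%:Z (sweep (D.2%:Z - 1) 0 (tn (D.2%:Z - 1)) [::]).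

Fixpoint fill_all (h : seq (seq point)) (F : seq tria) :=
  if F is D :: F' then fill_all (fill_tri h D) F' else h.

Lemma size_slides i j tl : size (slides i j tl) = (3 * i + size tl)%N.
Proof. by elim: i => [|i IH] /=; rewrite ?IH; lia. Qed.

Lemma size_descend (n : nat) (j : int) d tl : 1 <= j ->  d%:Z < j ->
  (size (descend n%:Z j d tl) <= d * (n + 2) + size tl)%N.
Proof.
elim: d j => [|d IH] j j1 dj //=; rewrite size_push.
by have := IH (j - 1); have := tnE (n%:Z + 1 - j); lia.
Qed.

(** At most [n ^ 2] exchanges for the sweep, [3 * n] for the slides and [n ^ 2 + 2 * n] for the
    descent; then [n <= n ^ 2]. A transport is two approaches, whence 14. *)
Lemma size_approach (n : nat) (i j d : int) tl :
  0 <= i -> 1 <= j -> d < j -> i + j < n%:Z ->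
  (size (approach n%:Z i j d tl) <= 7 * n ^ 2 + size tl)%N.
Proof.
move=> i0 j1 dj ij; rewrite /approach.
have := @size_sweep n (n%:Z - 1) 0 (tn (j - 1)) (slides (tn i) j (descend n j (tn d) tl)).
rewrite size_slides => /(_ ltac:(lia)) h1.
have := @size_descend n j (tn d) tl ltac:(lia) ltac:(rewrite tnE; lia) => h2.
have h3 : (tn (j - 1) <= n)%N by have := tnE (j - 1); lia.
have h4 : (tn i <= n)%N by have := tnE i; lia.
have h5 : (tn d <= n)%N by have := tnE d; lia.
have n0 : (0 < n)%N by lia.
have e1 : (tn (j - 1) * n <= n * n)%N by rewrite leq_mul2r h3 orbT.
have e2 : (tn d * n <= n * n)%N by rewrite leq_mul2r h5 orbT.
have e3 : (n * 1 <= n * n)%N by rewrite leq_mul2l n0 orbT.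
by rewrite mulnDr in h2; rewrite expnS expn1; lia.
Qed.

Lemma size_transport (n : nat) (e t : point) :
  0 <= e.1 -> 0 <= t.1 -> 1 <= t.2 -> 1 <= e.2 -> e.1 + e.2 < n%:Z ->
  t.1 + t.2 < n%:Z -> (size (transport n%:Z e t) <= 14 * n ^ 2)%N.
Proof.
move=> h1 h2 h3 h4 h5 h6; rewrite /transport.
have := @size_approach n e.1 e.2 (e.2 - t.2)
  (revops (approach n t.1 t.2 0 [::]) [::]) h1 ltac:(lia) ltac:(lia) h5.
have := @size_approach n t.1 t.2 0 [::] h2 ltac:(lia) ltac:(lia) h6.
by rewrite size_revops /=; lia.
Qed.

Lemma seekP c o ops :
  if seek c o ops is Some e then e \in map snd ops /\ frame true o e \in c
  else forall p, p \in map snd ops -> frame true o p \notin c.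
Proof.
elim: ops => //= x ops; case: ifP => xc IH; first by rewrite inE eqxx.
case: (seek _ _ _) IH => [e [h1 h2]|IH p].
  by rewrite inE h1 orbT.
by rewrite inE => /orP [/eqP -> | /IH //]; rewrite xc.
Qed.

(** The run is computed for the set that has inside the triangle only the bottom row, the cells
    [done] and the point [e]. Other excess points may lie on the way; by monotonicity they do not
    hinder the run, which may displace them. *)
Lemma run_fill_step (n : nat) (o t e : point) (done : seq point) (S : point -> bool) :
  (forall i : int, 0 <= i < n%:Z -> S (frame true o (i, 0))) ->
  {in done, forall p, S (frame true o p)} -> S (frame true o e) ->
  {subset e :: t :: done <= cells n%:Z} ->
  before t e -> {in done, forall p, before p t} ->
  exists S' : point -> bool,
  [/\ run S (map_frame true o (transport n%:Z e t) [::]) S',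
      forall i : int, 0 <= i < n%:Z -> S' (frame true o (i, 0)),
      {in t :: done, forall p, S' (frame true o p)}
    & forall p, ~~ in_tri (0, 0) n (unframe true o p) -> S p -> S' p].
Proof.
move=> bot Sdone Se sub te dt.
pose Z p := (p \in done) || (~~ in_tri (0, 0) n p && S (frame true o p)).
have := sub e; rewrite mem_head mem_cells => /(_ isT) he.
have := sub t; rewrite !inE eqxx orbT mem_cells => /(_ isT) ht.
have Zn p : in_tri (0, 0) n p -> ~~ before p t -> ~~ Z p.
  by rewrite /Z => -> /= np; rewrite orbF; apply: contra np; exact: dt.
have r : run (level n 0 (add_cell e Z)) (transport n%:Z e t) (level n 0 (add_cell t Z)).
  apply: run_transport; try lia.
  - by move: te; rewrite /before; lia.
  - move=> x hx; apply: Zn; rewrite /in_tri /before /=; first by lia.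
    by move: te; rewrite /before; lia.
  - move=> x hx; apply: Zn; rewrite /in_tri /before /=; first by lia.
    by move: te; rewrite /before; lia.
  move=> y hy; apply: Zn; rewrite /in_tri /before /=; first by lia.
  by move: te; rewrite /before; lia.
have cell_level (Y : point -> bool) p : p \in cells n%:Z -> level n 0 Y p = Y p.
  rewrite mem_cells; case: p => a b; rewrite /level /level_q /in_tri /= => hp.
  by do ?case: ifP; lia.
have row_level (Y : point -> bool) i : 0 <= i < n%:Z -> level n 0 Y (i, 0).
  by move=> hi; rewrite /level /level_q /in_tri /=; do ?case: ifP; lia.
have out_level (Y : point -> bool) p : ~~ in_tri (0, 0) n p -> level n 0 Y p = Y p.
  by rewrite /level /level_q => /negbTE ->.
have split_tri p : [|| ~~ in_tri (0, 0) n p, (p.2 == 0) && (0 <= p.1 < n%:Z)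
                     | p \in cells n%:Z].
  by rewrite mem_cells /in_tri /=; lia.
have ZE q : Z q = (q \in done) || (~~ in_tri (0, 0) n q && S (frame true o q)) by [].
have start q : level n 0 (add_cell e Z) q -> S (frame true o q).
  case/or3P: (split_tri q) => [nq|/andP [/eqP q0 hq] _|cq].
  - rewrite out_level // /add_cell ZE nq => /or3P [/eqP -> //|qd|//].
    exact: Sdone.
  - by case: q q0 hq => a b /= -> ha; exact: bot.
  rewrite cell_level // /add_cell ZE => /orP [/eqP -> //|/orP [|]]; first exact: Sdone.
  by case/andP.
have [|S' r' s'] := run_mono (run_frame true o r) (P := S).
  by move=> p hp; rewrite -(unframeK true o p); exact: start.
have {}s' q : level n 0 (add_cell t Z) q -> S' (frame true o q).
  by move=> hq; apply: s'; rewrite -(frameK true o q) in hq.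
exists S'; split => //.
- by move=> i hi; apply: s'; rewrite row_level.
- move=> p pd; apply: s'; rewrite cell_level.
    by rewrite /add_cell ZE; move: pd; rewrite inE => /orP [->//|->]; rewrite orbT.
  by apply: sub; rewrite inE pd orbT.
move=> p np sp; rewrite -(unframeK true o p); apply: s'.
by rewrite out_level // /add_cell ZE np unframeK sp !orbT.
Qed.

Definition rank_in (o : point) (pl : seq point) (c : seq point) : nat :=
  count (fun p => unframe true o p \in pl) c.

(** [rank_in] pays for the transports: each one fills the cell [x.2], which is not visited again, so
    fewer points remain on the cells to come. *)
Lemma fill_ok s (n : nat) (o : point) (done : seq point) ops h :
  history s h ->
  (forall i : int, 0 <= i < n%:Z -> frame true o (i, 0) \in head [::] h) ->
  {in done, forall p, frame true o p \in head [::] h} ->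
  done ++ map snd ops = cells n%:Z ->
  let h' := fill h o n%:Z ops in
  [/\ history s h',
      forall i : int, 0 <= i < n%:Z -> frame true o (i, 0) \in head [::] h',
      forall p, ~~ in_tri (0,
        0) n (unframe true o p) -> p \in head [::] h -> p \in head [::] h',
      exists k, {in take k (cells n%:Z), forall p, frame true o p \in head [::] h'} /\
                {in drop k (cells n%:Z), forall p, frame true o p \notin head [::] h'}
    & (size h' <= size h + 14 * n ^ 2 * rank_in o (map snd ops) (head [::] h))%N].
Proof.
elim: ops done h => [|x ops IH] done h hs bot hd ed /=.
  split=> //; last by lia.
  exists (size (cells n%:Z)); rewrite take_size drop_size; split => // p.
  by rewrite -ed cats0; exact: hd.
have ed' : rcons done x.2 ++ map snd ops = cells n%:Z by rewrite cat_rcons.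
case: ifP => xh.
  have [|h1 h2 h3 h4 h5] := IH (rcons done x.2) h hs bot _ ed'.
    by move=> p; rewrite mem_rcons inE => /orP [/eqP -> //|]; exact: hd.
  split => //; apply: leq_trans h5 _; rewrite leq_add2l leq_mul2l; apply/orP; right.
  by apply: sub_count => p; rewrite /= inE => ->; rewrite orbT.
have := seekP (head [::] h) o ops; case: seek => [e [eops eh]|none]; last first.
  split => //; last by lia.
  (* No point is left beyond the hole, so the occupied cells are exactly the initial segment
     [done]. *)
  exists (size done); rewrite -ed take_size_cat // drop_size_cat //.
  split => // p; rewrite inE => /orP [/eqP ->|/none //]; by rewrite xh.
have pw : pairwise before (done ++ x.2 :: map snd ops).
  by rewrite -/(map snd (x :: ops)) ed; exact: pairwise_sweep.
move: pw; rewrite pairwise_cat pairwise_cons => /and3P [/allrelP ar _ /andP [/allP ax _]].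
have te : before x.2 e := ax _ eops.
have dt : {in done, forall p, before p x.2}.
  by move=> p pd; apply: ar => //; rewrite mem_head.
have sub : {subset e :: x.2 :: done <= cells n%:Z}.
  move=> p; rewrite -ed !inE mem_cat /= inE => /or3P [/eqP ->|->|->] //.
    by rewrite eops !orbT.
  by rewrite orbT.
have [S' [r b1 d1 o1]] := run_fill_step bot hd eh sub te dt.
have [hs' e' sz'] := exec_run hs r.
set h1 := exec _ _ in hs' e' sz' *.
have eh' p : (p \in head [::] h1) = S' p := e' p.
have [||h2 h3 h4 h5 h6] := IH (rcons done x.2) h1 hs' _ _ ed'.
- by move=> i hi; rewrite eh' b1.
- by move=> p; rewrite mem_rcons eh' => pd; apply: d1.
split => //.
  by move=> p np ph; apply: h4 => //; rewrite eh'; exact: o1.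
apply: leq_trans h6 _.
have he : e \in cells n%:Z by apply: sub; rewrite mem_head.
have hx : x.2 \in cells n%:Z by apply: sub; rewrite !inE eqxx orbT.
rewrite !mem_cells in he hx.
have szt : (size (map_frame true o (transport n%:Z e x.2) [::]) <= 14 * n ^ 2)%N.
  rewrite size_map_frame addn0; apply: size_transport; lia.
suff rk : (rank_in o (map snd ops) (head [::] h1) <
           rank_in o (x.2 :: map snd ops) (head [::] h))%N.
  apply: leq_trans (leq_add sz' (leqnn _)) _.
  rewrite -addnA leq_add2l; apply: leq_trans (leq_add szt (leqnn _)) _.
  by rewrite -mulnS leq_mul2l rk orbT.
pose g p := unframe true o p \in map snd ops.
apply: (@leq_trans (count g (head [::] h))); last first.
  by apply: sub_count => p; rewrite /g /= inE => ->; rewrite orbT.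
have hist_head k : history s k -> uniq (head [::] k) /\ size (head [::] k) = size s.
  by case: k => //= c k [-> [-> _]].
have [u0 s0] := hist_head _ hs; have [u1 s1] := hist_head _ hs'.
(* The number of points is constant, so it is enough that more of them lie off the cells to come:
   none of those is lost, and the point brought to [x.2] is a new one. *)
suff lt : (count (predC g) (head [::] h) < count (predC g) (head [::] h1))%N.
  have := count_predC g (head [::] h); have := count_predC g (head [::] h1).
  by rewrite s0 s1 /rank_in -/g; lia.
rewrite -!size_filter -/(size (frame true o x.2 :: _)) -ltnS.
have : uniq (frame true o x.2 :: filter (predC g) (head [::] h)).
  by rewrite /= filter_uniq // mem_filter xh andbF.
move=> /uniq_leq_size; rewrite /= ltnS; apply => p.
rewrite inE !mem_filter /= => /orP [/eqP ->|/andP [ng ph]].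
  rewrite /g frameK eh' d1 ?mem_head // andbT.
  by apply/negP => /ax; rewrite /before; lia.
rewrite ng eh' /=; move: ph ng; rewrite /g -{1 3}(unframeK true o p).
move: (unframe true o p) => q ph ng.
have : [|| ~~ in_tri (0, 0) n q, (q.2 == 0) && (0 <= q.1 < n%:Z) | q \in cells n%:Z].
  by rewrite mem_cells /in_tri /=; lia.
case/or3P => [nq|/andP [/eqP q0 hq]|].
- by apply: o1 => //; rewrite frameK.
- by case: q q0 hq {ph ng} => a b /= -> hq; exact: b1.
rewrite -ed mem_cat inE => /or3P [qd|/eqP qx|qr]; first 1 last.
- by rewrite qx xh in ph.
- by rewrite qr in ng.
by apply: d1; rewrite inE qd orbT.
Qed.

(** * Uniqueness of the normal form *)

Definition adjacent (p q : point) : bool :=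
  (q.1 - p.1, q.2 - p.2) \in [:: (1, 0); (-1, 0); (0, 1); (0, -1); (1, -1); (-1, 1)].

(** The condition on points that [separated] families and normal families share; the case [q == p]
    includes disjointness. *)
Definition apart (L : seq tria) : Prop :=
  uniq L /\ forall D E p q, D \in L -> E \in L -> inside D p -> inside E q ->
    (q == p) || adjacent p q -> D = E.

Lemma separated_apart L : separated L -> apart L.
Proof.
case=> u h; split=> // D E p q DL EL ip iq pq; apply: h => //.
case: D E p q ip iq pq {DL EL} => [[a b] n] [[a' b'] n'] [x y] [x' y'].
by rewrite /inside /in_tri /near /csum /adjacent !inE !xpair_eqE /=; lia.
Qed.

Lemma coveredP L p : reflect (exists2 D, D \in L & inside D p) (covered L p).
Proof. exact: hasP. Qed.

Lemma tri_adjacent v p q : in_tri v 2 p -> in_tri v 2 q -> (q == p) || adjacent p q.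
Proof.
case: v p q => [a b] [x y] [x' y'].
by rewrite /in_tri /adjacent !inE !xpair_eqE /=; lia.
Qed.

Lemma inside_third D v p q r : inside D p -> inside D q -> p != q ->
  in_tri v 2 p -> in_tri v 2 q -> in_tri v 2 r -> inside D r.
Proof.
case: D v p q r => [[a b] n] [v1 v2] [x y] [x' y'] [x'' y''].
by rewrite /inside /in_tri !xpair_eqE /=; lia.
Qed.

Definition part (D : tria) (P : config) : config := [fset p in P | inside D p].

Lemma mem_part D P p : (p \in part D P) = (p \in P) && inside D p.
Proof. by rewrite !inE. Qed.

Lemma move_covered L (P Q : config) :
  apart L -> (forall p, p \in P -> covered L p) -> move P Q ->
  (forall p, p \in Q -> covered L p) /\
  (forall D, D \in L -> #|` part D P| = #|` part D Q|).
Proof.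
case=> uL ap cP [v [cardP cardQ _ sub]].
have same p : ~~ in_tri v 2 p -> (p \in P) = (p \in Q).
  rewrite -shift_TE => np; apply/idP/idP => hp; apply: contraNT np => nq;
    by apply: (fsubsetP sub); rewrite in_fsetU !in_fsetD hp nq ?orbT.
have [p [q [pq hp hq]]] : exists p q, [/\ p != q,
  p \in P `&` shift v T & q \in P `&` shift v T].
  move: cardP; have := fset_uniq (P `&` shift v T).
  have mX p : (p \in P `&` shift v T) = (p \in enum_fset (P `&` shift v T)) by [].
  case eX: (enum_fset _) mX => [|p [|q l]] // mX;
    rewrite /= inE negb_or => /andP [/andP [pq _] _] _.
  by exists p, q; rewrite pq !mX !inE !eqxx !orbT.
move: hp hq; rewrite !in_fsetI !shift_TE => /andP [pP pv] /andP [qP qv].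
have /coveredP [D DL Dp] := cP p pP.
have /coveredP [E EL Eq] := cP q qP.
have DE := ap D E p q DL EL Dp Eq (tri_adjacent pv qv).
subst E.
have inD r : in_tri v 2 r -> inside D r := inside_third Dp Eq pq pv qv.
split=> [r rQ|E EL'].
  case: (boolP (in_tri v 2 r)) => [rv|nrv]; last by apply: cP; rewrite same.
  by apply/coveredP; exists D => //; exact: inD.
have [<-|nED] := eqVneq D E.
  (* The part of [D] outside the translate is unchanged and the translate holds two points before
     and after. The other triangles do not meet it. *)
  have dec R : #|` part D R| = (#|` [fset r in R | inside D r && ~~ in_tri v 2 r]| +
       #|` R `&` shift v T|)%N.
    rewrite addnC -(cardfsID (shift v T) (part D R)); congr (_ + _)%N.
      congr #|` _|; apply/fsetP => r; rewrite !in_fsetI !shift_TE mem_part.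
      by case: (boolP (in_tri v 2 r)) => [/inD ->|_]; rewrite ?andbT ?andbF.
    congr #|` _|; apply/fsetP => r; rewrite in_fsetD shift_TE !inE.
    by case: (r \in R); case: (inside D r); case: (in_tri v 2 r).
  rewrite !dec cardP cardQ; congr (_ + _)%N; congr #|` _|.
  apply/fsetP => r; rewrite !inE.
  by case: (boolP (in_tri v 2 r)) => [_|/same ->]; rewrite ?andbF.
congr #|` _|; apply/fsetP => r; rewrite !mem_part.
case: (boolP (in_tri v 2 r)) => [rv|/same -> //].
case: (boolP (inside E r)) => [rE|_]; last by rewrite !andbF.
by move: nED; rewrite (ap D E r r DL EL' (inD _ rv) rE) ?eqxx.
Qed.

Lemma orbit_covered L (P Q : config) :
  apart L -> (forall p, p \in P -> covered L p) -> solitaire_orbit P Q ->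
  (forall p, p \in Q -> covered L p) /\
  (forall D, D \in L -> #|` part D P| = #|` part D Q|).
Proof.
move=> ap cP o; elim: o cP => {P Q} [P Q m cP|P|P Q R _ IH1 _ IH2 cP].
- exact: move_covered m.
- by [].
have [c1 e1] := IH1 cP; have [c2 e2] := IH2 c1; split => // D DL.
by rewrite e1 // e2.
Qed.

Lemma move_sym P Q : move P Q -> move Q P.
Proof. by case=> v [h1 h2 h3 h4]; exists v; rewrite fsetUC. Qed.

Lemma orbit_sym P Q : solitaire_orbit P Q -> solitaire_orbit Q P.
Proof.
elim=> [P1 Q1 m|P1|P1 Q1 R1 _ h1 _ h2].
- by apply: rt_step; exact: move_sym.
- exact: rt_refl.
exact: rt_trans h2 h1.
Qed.

Lemma tria_eq (D E : tria) : (0 < D.2)%N -> (0 < E.2)%N ->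
  (forall p, inside D p -> inside E p) -> (forall p, inside E p -> inside D p) -> D = E.
Proof.
case: D E => [[a b] n] [[a' b'] n'] /= n0 n0' h1 h2.
have := h1 (a, b); have := h1 (a + n%:Z - 1, b).
have := h2 (a', b'); have := h2 (a' + n'%:Z - 1, b').
rewrite /inside /in_tri /= => h3 h4 h5 h6.
by congr (_, _, _); lia.
Qed.

(** Consecutive points of the bottom row are adjacent, hence in the same triangle of [L]; a triangle
    containing both ends of that row contains all of [D]. *)
Lemma covered_sub L D : apart L -> (0 < D.2)%N ->
  (forall p, bottom D p -> covered L p) ->
  exists2 E, E \in L & forall p, inside D p -> inside E p.
Proof.
case: D => [[a b] n] [_ ap] /= n0 bot.
have /coveredP [E EL Ea] : covered L (a, b).
  by apply: bot; rewrite /bottom /inside /in_tri /=; lia.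
exists E => //.
have h k : k%:Z < n%:Z -> inside E (a + k%:Z, b).
  elim: k => [|k IH] kn; first by rewrite addr0.
  have /coveredP [E' EL' Ea'] : covered L (a + k.+1%:Z, b).
    by apply: bot; rewrite /bottom /inside /in_tri /=; lia.
  rewrite (ap E E' (a + k%:Z, b) (a + k.+1%:Z, b)) //; first by apply: IH; lia.
  by rewrite /adjacent !inE !xpair_eqE /=; lia.
have := h (n - 1)%N.
move: Ea; case: (E) => [[a' b'] n']; rewrite /inside /in_tri /= => h1 h2 [x y] /=.
by have := h2 ltac:(lia); lia.
Qed.

Lemma nbhdE p q : (q \in nbhd p) = adjacent p q.
Proof.
case: p q => [x y] [x' y']; apply/imfsetP/idP.
  case=> d /=; rewrite !inE => hd e.
  have -> : (x', y') = (x + d.1, y + d.2) by rewrite e; case: (d).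
  by rewrite /adjacent /= !inE; move: hd; case: d {e} => a b; rewrite !xpair_eqE /=; lia.
rewrite /adjacent /= => h; exists (x' - x, y' - y) => //=.
have e (u v : point) : u + v = (u.1 + v.1, u.2 + v.2) by [].
by rewrite e /=; congr pair; lia.
Qed.

Lemma touchP v n w m :
  reflect (exists p q, [/\ in_tri v n p, in_tri w m q & adjacent q p])
    (touch (shift v (tri n)) (shift w (tri m))).
Proof.
rewrite /touch; apply: (iffP (fset0Pn _)) => [[p]|[p [q [pv qw qp]]]].
  rewrite in_fsetI shift_triE => /andP [pv] /bigfcupP [q]; rewrite andbT shift_triE nbhdE.
  by exists p, q.
exists p; rewrite in_fsetI shift_triE pv; apply/bigfcupP; exists q; last by rewrite nbhdE.
by rewrite andbT shift_triE.
Qed.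

(** In a triangle of size at least 2 every point has a neighbour, so a common point makes two
    triangles touch unless both are singletons. Then [k = 0] on both sides, the pieces coincide, and
    [uniq] applies. *)
Lemma normal_apart F : normal_family F -> apart (map fst F) /\ {in F &, injective fst}.
Proof.
case/and3P => uF /allP okF pw.
have nt (p q : piece) : p \in F -> q \in F -> p != q ->
    forall x y, inside p.1 x -> inside q.1 y -> ~~ adjacent y x && ~~ adjacent x y.
  move=> pF qF pq x y px qy.
  have gen (p' q' : piece) x' y' : (index p' F < index q' F)%N -> p' \in F -> q' \in F ->
      inside p'.1 x' -> inside q'.1 y' -> ~~ adjacent y' x' && ~~ adjacent x' y'.
    move=> lt p'F q'F ix iy.
    have := pairwiseP p' pw; move=> /(_ (index p' F) (index q' F)).
    rewrite !inE !index_mem !nth_index // => /(_ p'F q'F lt).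
    case: p' q' ix iy {lt p'F q'F} => [[v n] k] [[w m] l] /= ix iy.
    have sym a b : adjacent a b = adjacent b a.
      by case: a b => [a1 a2] [b1 b2]; rewrite /adjacent !inE !xpair_eqE /=; lia.
    rewrite (sym x' y') andbb; apply: contra => h.
    by apply/touchP; exists x', y'.
  case: (ltngtP (index p F) (index q F)) => [lt|lt|e].
  - exact: gen lt pF qF px qy.
  - by rewrite andbC; exact: gen lt qF pF qy px.
  - by move: pq; rewrite -(nth_index p pF) e nth_index // eqxx.
have nb (D : tria) x : (1 < D.2)%N -> inside D x -> exists2 z, inside D z & adjacent z x.
  case: D x => [[a b] n] [x y]; rewrite /inside /in_tri /= => n1 hx.
  have [h|h] := ltP a x.
    by exists (x - 1, y); rewrite /adjacent /= ?inE ?xpair_eqE /=; lia.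
  have [h'|h'] := ltP b y.
    by exists (x, y - 1); rewrite /adjacent /= ?inE ?xpair_eqE /=; lia.
  by exists (x + 1, y); rewrite /adjacent /= ?inE ?xpair_eqE /=; lia.
have inj : {in F &, injective fst}.
  move=> p q pF qF e; apply/eqP; case: (boolP (p == q)) => // pq.
  have := okF p pF; have := okF q qF.
  case: p q e pF qF pq => [[v n] k] [[w m] l] /= [<- <-] pF qF pq hl hk.
  have [n1|n1] := leqP n 1.
    move: pq; suff -> : k = l by rewrite eqxx.
    move: hk hl n1; case: (n) => [|[|?]] //=; rewrite subnn muln0 div0n !leqn0.
    by move=> /eqP -> /eqP ->.
  have iv : inside (v, n) v by rewrite /inside /in_tri /=; lia.
  have [z iz az] := nb (v, n) v n1 iv.
  by have := nt _ _ pF qF pq z v iz iv; rewrite az andbF.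
split => //; split; first by rewrite map_inj_in_uniq.
move=> D E x y /mapP [p pF ->] /mapP [q qF ->] ix iy xy.
have [-> //|pq] := eqVneq p q.
have /andP [n1 n2] := nt p q pF qF pq x y ix iy.
move: xy; rewrite (negbTE n2) orbF => /eqP e; subst y.
have [p1|p1] := ltnP 1 p.1.2.
  have [z iz az] := nb _ _ p1 ix.
  by have := nt p q pF qF pq z x iz iy; rewrite az andbF.
have [q1|q1] := ltnP 1 q.1.2.
  have [z iz az] := nb _ _ q1 iy.
  by have := nt p q pF qF pq x z ix iz; rewrite az.
have p0 := okF p pF; have q0 := okF q qF.
case: p q p0 q0 ix iy p1 q1 {pF qF pq nt n1 n2} => [[[a b] n] k] [[[a' b'] m] l] /=.
by rewrite /inside /in_tri /= => /andP [h1 _] /andP [h2 _] h3 h4 h5 h6; congr (_, _, _); lia.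
Qed.

(** * Row order and pieces *)

Lemma row_le_trans : transitive row_le.
Proof. by move=> [a b] [c d] [e f]; rewrite /row_le /=; lia. Qed.

Lemma row_le_anti : antisymmetric row_le.
Proof.
move=> [a b] [c d]; rewrite /row_le /= => h; congr pair; lia.
Qed.

Lemma row_le_total : total row_le.
Proof. by move=> [a b] [c d]; rewrite /row_le /=; lia. Qed.

Definition acells (n : nat) : seq point := map (frame true (n%:Z - 1, 0)) (cells n%:Z).

Lemma uniq_cells (n : nat) : uniq (cells n%:Z).
Proof.
have := pairwise_sweep (n%:Z - 1) 0 (tn (n%:Z - 1)).
rewrite -/(cells n%:Z); elim: (cells _) => //= p l IH /andP [/allP h /IH ->].
by rewrite andbT; apply/negP => /h; rewrite /before; lia.
Qed.

(** A total antisymmetric order admits only one sorted arrangement, so the abstract [sort] yields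
    the enumeration that the algorithm follows. *)
Lemma sort_cells (n : nat) : sort row_le (tri n `\` line n) = acells n.
Proof.
apply: (sorted_eq row_le_trans row_le_anti).
- exact: sort_sorted row_le_total _.
- rewrite /acells sorted_map; apply: (sub_sorted (e := before)).
    by move=> [a b] [c d]; rewrite /before /row_le /frame /=; lia.
  have := pairwise_sweep (n%:Z - 1) 0 (tn (n%:Z - 1)).
  by rewrite -/(cells n%:Z); exact: pairwise_sorted.
rewrite perm_sort; apply: uniq_perm; first exact: fset_uniq.
  by rewrite map_inj_uniq ?uniq_cells //; exact: can_inj (frameK _ _).
move=> p; rewrite -[p](unframeK true (n%:Z - 1, 0)).
rewrite mem_map; last exact: can_inj (frameK _ _).
rewrite mem_cells; move: (unframe _ _ _) => [a b].
change ((frame true (n%:Z - 1, 0) (a, b) \in tri n `\` line n) = [&& 0 <= a,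
  1 <= b & a + b < n%:Z]).
rewrite in_fsetD in_lineE in_triE /frame /in_tri /=; lia.
Qed.

Lemma mem_piece_set v n k p :
  (p \in piece_set (v, n, k)) =
  bottom (v, n) p || (unframe true (v.1 + n%:Z - 1, v.2) p \in take k (cells n%:Z)).
Proof.
rewrite /piece_set shiftP /Pnk in_fsetU in_lineE; congr (_ || _).
  by case: v p => [a b] [x y]; rewrite /bottom /inside /in_tri /=; lia.
rewrite in_fset /= sort_cells /acells -map_take -[in LHS](unframeK true (n%:Z - 1, 0) (_, _)).
rewrite mem_map; last exact: can_inj (frameK _ _).
suff -> : unframe true (n%:Z - 1, 0) (p.1 - v.1, p.2 - v.2) =
          unframe true (v.1 + n%:Z - 1, v.2) p by [].
by case: v p => [a b] [x y]; rewrite /unframe /=; congr pair; lia.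
Qed.

Lemma piece_inside q p : p \in piece_set q -> inside q.1 p.
Proof.
case: q => [[v n] k]; rewrite mem_piece_set => /orP [/andP [] //|/mem_take].
rewrite mem_cells; case: v p => [a b] [x y]; rewrite /unframe /inside /in_tri /=; lia.
Qed.

(** The sets are nested in [k], so equal cardinals force equal sets, whereas for [k < l] the cell of
    index [k] belongs to the larger one only. *)
Lemma piece_card_inj v n k l :
  (k <= (n * (n - 1)) %/ 2)%N -> (l <= (n * (n - 1)) %/ 2)%N ->
  #|` piece_set (v, n, k)| = #|` piece_set (v, n, l)| -> k = l.
Proof.
wlog kl : k l / (k <= l)%N.
  by move=> W; case: (leqP k l) => [|/ltnW] h hk hl e; [|symmetry]; apply: W.
move=> hk hl e; apply/eqP; rewrite eqn_leq kl leqNgt; apply/negP => lt.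
have sub : piece_set (v, n, k) `<=` piece_set (v, n, l).
  apply/fsubsetP => p; rewrite !mem_piece_set => /orP [->//|h].
  by rewrite -(subnKC kl) takeD mem_cat h !orbT.
have eq : piece_set (v, n, k) = piece_set (v, n, l).
  by apply/eqP; rewrite eqEfcard sub e leqnn.
pose c := nth (0, 0) (cells n%:Z) k.
have kc : (k < size (cells n%:Z))%N by rewrite size_cells; exact: leq_trans lt hl.
have cl : c \in take l (cells n%:Z).
  by rewrite /c -(nth_take _ lt) mem_nth // size_take; case: ifP => // _; exact: lt.
have ck : c \notin take k (cells n%:Z).
  rewrite in_take ?mem_nth // index_uniq ?uniq_cells // ltnn //.
have cc : c \in cells n%:Z by rewrite mem_nth.
have /fsetP /(_ (frame true (v.1 + n%:Z - 1, v.2) c)) := eq.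
rewrite !mem_piece_set !frameK cl (negbTE ck) orbF orbT /bottom.
move: cc; rewrite mem_cells /frame /=; case: (c) => a b /=; lia.
Qed.

Lemma family_covered F p : p \in family_set F -> covered (map fst F) p.
Proof.
move=> /bigfcupP [q]; rewrite andbT => qF /piece_inside ip.
by apply/coveredP; exists q.1 => //; exact: map_f.
Qed.

Lemma part_family F q : normal_family F -> q \in F ->
  part q.1 (family_set F) = piece_set q.
Proof.
move=> /normal_apart [[_ ap] inj] qF; apply/fsetP => p; rewrite mem_part.
apply/andP/idP => [[/bigfcupP [q' ] ]|pq]; last first.
  split; last exact: piece_inside pq.
  by apply/bigfcupP; exists q => //; rewrite qF.
rewrite andbT => qF' pq' ip; suff -> : q = q' by [].
apply: inj => //; apply: (ap _ _ p p) => //; rewrite ?map_f ?eqxx //.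
exact: piece_inside pq'.
Qed.

Lemma bottom_piece q p : bottom q.1 p -> p \in piece_set q.
Proof. by case: q => [[v n] k] bp; rewrite mem_piece_set bp. Qed.

Lemma piece_pos F q : normal_family F -> q \in F -> (0 < q.1.2)%N.
Proof. by case/and3P => _ /allP ok _ /ok; case: q => [[v n] k] /andP []. Qed.

(** Along an orbit the bottom rows of each family are covered by the triangles of the other. Hence
    the triangle of [q2] lies in that of some [q1], which lies in some [D] of the second family; by
    apartness [D] is the triangle of [q2], so all three coincide. The number of points in it then
    determines [k]. *)
Lemma normal_sub F1 F2 : normal_family F1 -> normal_family F2 ->
  solitaire_orbit (family_set F1) (family_set F2) -> {subset F2 <= F1}.
Proof.
move=> nF1 nF2 orb q2 q2F.
have [ap1 _] := normal_apart nF1; have [ap2 _] := normal_apart nF2.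
have [c21 cards] := orbit_covered ap1 (@family_covered F1) orb.
have [c12 _] := orbit_covered ap2 (@family_covered F2) (orbit_sym orb).
have bot F q p : q \in F -> bottom q.1 p -> p \in family_set F.
  by move=> qF bp; apply/bigfcupP; exists q; rewrite ?qF //; exact: bottom_piece.
have [|E EL sub1] := covered_sub ap1 (piece_pos nF2 q2F).
  by move=> p bp; apply: c21; exact: bot bp.
case/mapP: EL => q1 q1F eE; subst E.
have [|D DL sub2] := covered_sub ap2 (piece_pos nF1 q1F).
  by move=> p bp; apply: c12; exact: bot bp.
have iv : inside q2.1 q2.1.1.
  by have := piece_pos nF2 q2F; case: (q2.1) => [[a b] n]; rewrite /inside /in_tri /=; lia.
have eD : q2.1 = D.
  by apply: (ap2.2 _ _ q2.1.1 q2.1.1) => //; rewrite ?eqxx ?map_f //; apply: sub2; exact: sub1.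
have e12 : q1.1 = q2.1.
  by apply: tria_eq => // [||p];
    [exact: piece_pos nF1 q1F | exact: piece_pos nF2 q2F | rewrite eD; exact: sub2].
have := cards _ (map_f fst q1F); rewrite part_family // e12 part_family // => ec.
suff -> : q2 = q1 by [].
case/and3P: nF1 => _ /allP /(_ _ q1F) ok1 _; case/and3P: nF2 => _ /allP /(_ _ q2F) ok2 _.
case: q1 q2 {q1F q2F sub1 sub2 iv eD} e12 ok1 ok2 ec => [d1 k1] [d2 k2] /= e.
case: d1 d2 e => [v n] [w m] [<- <-] /andP [_ h1] /andP [_ h2] ec.
by congr pair; symmetry; exact: piece_card_inj ec.
Qed.

Lemma normal_unique F1 F2 : normal_family F1 -> normal_family F2 ->
  solitaire_orbit (family_set F1) (family_set F2) -> perm_eq F1 F2.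
Proof.
move=> n1 n2 o; apply: uniq_perm; first by case/and3P: n1.
  by case/and3P: n2.
move=> q; apply/idP/idP; last exact: normal_sub.
by apply: normal_sub => //; exact: orbit_sym.
Qed.

(** * Existence of the normal form and number of moves *)

Lemma history_orbit s h : history s h -> solitaire_orbit (fs s) (fs (head [::] h)).
Proof.
elim: h => // c [|c' r] IH /= [_ [_]]; first by move=> ->; exact: rt_refl.
by case=> m /IH o; apply: rt_trans o _; exact: rt_step.
Qed.

Lemma history_head s h : history s h -> uniq (head [::] h) /\ size (head [::] h) = size s.
Proof. by case: h => //= c h [-> [-> _]]. Qed.

Lemma card_part D c : uniq c -> #|` part D (fs c)| = count (inside D) c.
Proof.
move=> uc; rewrite -size_filter; apply: perm_size; apply: uniq_perm.
- exact: fset_uniq.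
- exact: filter_uniq.
by move=> p; rewrite mem_filter andbC -[p \in c]fsE; exact: mem_part.
Qed.

Lemma split_inside (v : point) (n : nat) p :
  inside (v, n) p ->
  bottom (v, n) p || (unframe true (v.1 + n%:Z - 1, v.2) p \in cells n%:Z).
Proof.
rewrite mem_cells; case: v p => [a b] [x y].
by rewrite /bottom /inside /in_tri /unframe /=; lia.
Qed.

Lemma fill_tri_ok s h D :
  history s h -> (forall p, bottom D p -> p \in head [::] h) ->
  let h' := fill_tri h D in
  [/\ history s h',
      forall p, bottom D p -> p \in head [::] h',
      forall p, ~~ inside D p -> p \in head [::] h -> p \in head [::] h',
      exists2 k, (k <= (D.2 * (D.2 - 1)) %/ 2)%N &
        forall p, inside D p -> (p \in head [::] h') = (p \in piece_set (D, k))
    & (size h' <= size h + 14 * D.2 ^ 2 * #|` part D (fs (head [::] h))|)%N].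
Proof.
case: D => [v n] hs bot /=.
pose o : point := (v.1 + n%:Z - 1, v.2).
have [||//|] := @fill_ok s n o [::] (sweep (n%:Z - 1) 0 (tn (n%:Z - 1)) [::]) h hs.
- move=> i hi; apply: bot; rewrite /bottom /inside /in_tri /o /frame /=; lia.
- by [].
rewrite -/(fill_tri h (v, n)); set h' := fill_tri _ _ => h1 h2 h3 [k [h4 h5]] h6.
have ins p : in_tri (0, 0) n (unframe true o p) = inside (v, n) p.
  by case: (v) p @o {h1 h2 h3 h4 h5 h6} => [a b] [x y] o;
    rewrite /inside /in_tri /unframe /=; lia.
have bot' p : bottom (v, n) p -> p \in head [::] h'.
  move=> bp; have := h2 (v.1 + n%:Z - 1 - p.1); rewrite /frame /=.
  have -> : (v.1 + n%:Z - 1 - (v.1 + n%:Z - 1 - p.1) - 0, v.2 + 0) = p.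
    case: p bp => x y; rewrite /bottom => /andP [_ /eqP /= ->]; congr pair; lia.
  by apply; move: bp; rewrite /bottom /inside /in_tri /=; lia.
split => //.
- by move=> p np; apply: h3; rewrite ins.
(* The index found by [fill_ok] is not bounded; beyond the number of cells it means the same as that
   number. *)
- exists (minn k (size (cells n%:Z))); first by rewrite -size_cells geq_minr.
  have tk : take (minn k (size (cells n%:Z))) (cells n%:Z) = take k (cells n%:Z).
    by rewrite /minn; case: ltnP => // hk; rewrite take_size take_oversize.
  move=> p ip; rewrite mem_piece_set tk -/o.
  case/orP: (split_inside ip) => [bp|]; first by rewrite bp bot'.
  rewrite -/o -{1}(cat_take_drop k (cells n%:Z)) mem_cat => /orP [pt|pd].
    by rewrite pt orbT -(unframeK true o p) h4.
  rewrite -{1}(unframeK true o p) (negbTE (h5 _ pd)).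
  have : uniq (take k (cells n%:Z) ++ drop k (cells n%:Z)) by rewrite cat_take_drop uniq_cells.
  rewrite cat_uniq => /and3P [_ /hasPn nh _].
  have /negbTE -> : unframe true o p \notin take k (cells n%:Z) := nh _ pd.
  rewrite orbF; symmetry; apply/negbTE; apply/negP => bp.
  have := mem_drop pd; rewrite mem_cells /o /unframe /=.
  by move: bp; rewrite /bottom /inside /in_tri /=; lia.
apply: leq_trans h6 _; rewrite leq_add2l leq_mul2l; apply/orP; right.
rewrite card_part; last by case: (history_head hs).
apply: sub_count => p /=; rewrite -ins -/(cells n%:Z) mem_cells /in_tri /=; lia.
Qed.

Definition shaped (c : seq point) (D : tria) : Prop :=
  exists2 k, (k <= (D.2 * (D.2 - 1)) %/ 2)%N &
    forall p, inside D p -> (p \in c) = (p \in piece_set (D, k)).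

Lemma fill_all_ok s (W : nat) (L F done : seq tria) h :
  separated L -> (forall p, p \in s -> covered L p) ->
  history s h -> {subset done ++ F <= L} -> {subset L <= done ++ F} ->
  (forall D p, D \in L -> bottom D p -> p \in head [::] h) ->
  (forall D, D \in L -> (D.2 <= W)%N) ->
  (forall D, D \in done -> shaped (head [::] h) D) ->
  let h' := fill_all h F in
  [/\ history s h', forall D, D \in L -> shaped (head [::] h') D
    & (size h' <= size h + 14 * W ^ 2 * \sum_(D <- F) #|` part D (fs s)|)%N].
Proof.
move=> sL cs; have apL := separated_apart sL.
elim: F h done => [|D F IH] h done hs sub1 sub2 bot szL sh /=.
  by split => // [D /sub2|]; rewrite ?big_nil ?muln0 ?addn0 // cats0; exact: sh.
have DL : D \in L by apply: sub1; rewrite mem_cat mem_head orbT.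
have [h1 h2 h3 h4 h5] := fill_tri_ok hs (fun p => bot D p DL).
set g := fill_tri h D in h1 h2 h3 h4 h5 *.
have same E : E \in L -> #|` part E (fs s)| = #|` part E (fs (head [::] g))|.
  move=> EL; have cs' p : p \in fs s -> covered L p by rewrite fsE; exact: cs.
  by have [_ ->] := orbit_covered apL cs' (history_orbit h1).
have same' E : E \in L -> #|` part E (fs s)| = #|` part E (fs (head [::] h))|.
  move=> EL; have cs' p : p \in fs s -> covered L p by rewrite fsE; exact: cs.
  by have [_ ->] := orbit_covered apL cs' (history_orbit hs).
have disj E p : E \in L -> E != D -> inside E p -> ~~ inside D p.
  move=> EL nE iE; apply: contra nE => iD; apply/eqP.
  by apply: (apL.2 E D p p) => //; rewrite eqxx.
have [||||H1 H2 H3] := IH g (rcons done D) h1 _ _ _ szL.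
- by rewrite cat_rcons.
- by rewrite cat_rcons.
- move=> E p EL bE; have [eED|nE] := eqVneq E D.
    by apply: h2; rewrite -eED.
  apply: h3; last exact: bot EL bE.
  by apply: disj nE _ => //; case/andP: bE.
- move=> E; rewrite mem_rcons inE => Ed.
  have [->|nE] := eqVneq E D; first exact: h4.
  move: Ed; rewrite (negbTE nE) /= => Ed.
  have EL : E \in L by apply: sub1; rewrite mem_cat Ed.
  have [k k1 k2] := sh E Ed; exists k => // p ip; rewrite -k2 //.
  (* Filling [D] is known to keep the points outside [D]; as the number of points in [E] is constant
     on the orbit, this inclusion is an equality and [E] keeps its shape. *)
  have : part E (fs (head [::] h)) = part E (fs (head [::] g)).
    apply/eqP; rewrite eqEfcard -same // -same' // leqnn andbT.
    apply/fsubsetP => q; rewrite !mem_part !fsE => /andP [qh iq].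
    by rewrite iq andbT; apply: h3 => //; exact: disj nE iq.
  by move/fsetP => /(_ p); rewrite !mem_part !fsE ip !andbT.
split => //; apply: leq_trans H3 _; rewrite big_cons mulnDr addnA leq_add2r.
apply: leq_trans h5 _; rewrite leq_add2l -same' // leq_mul2r; apply/orP; right.
by rewrite leq_mul2l leq_exp2r ?szL ?orbT.
Qed.

Lemma sum_parts L c : apart L -> uniq c ->
  (\sum_(D <- L) #|` part D (fs c)| <= size c)%N.
Proof.
move=> [uL ap] uc.
rewrite (eq_bigr (fun D => \sum_(p <- c) inside D p)%N); last first.
  by move=> D _; rewrite card_part // -sum1_count [RHS]big_mkcond /= big_mkcond;
     apply: eq_bigr => p _; case: ifP.
rewrite exchange_big /= -sum1_size; apply: leq_sum => p _.
have : (count (fun D => inside D p) L <= 1)%N.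
  elim: L uL ap => //= D L IH /andP [nD uL] ap.
  have [iD|_] := boolP (inside D p); last first.
    by apply: IH => // E E' q q' EL EL'; apply: ap; rewrite inE ?EL ?EL' orbT.
  rewrite (@eq_in_count _ _ pred0) ?count_pred0 // => E EL.
  apply/negbTE; apply: contra nD => iE.
  by rewrite (ap D E p p) ?eqxx ?mem_head // inE EL orbT.
by rewrite -sum1_count big_mkcond /=;
  under eq_bigr do rewrite -[if _ then _ else _]/(nat_of_bool _).
Qed.

Lemma pieces_exist c (L : seq tria) : (forall D, D \in L -> shaped c D) ->
  exists Qs : seq piece, map fst Qs = L /\
    forall q, q \in Qs -> (q.2 <= (q.1.2 * (q.1.2 - 1)) %/ 2)%N /\
      forall p, inside q.1 p -> (p \in c) = (p \in piece_set q).
Proof.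
elim: L => [|D L IH] sh; first by exists [::].
have [|Qs [e h]] := IH; first by move=> E EL; apply: sh; rewrite inE EL orbT.
have [k k1 k2] := sh D (mem_head _ _).
exists ((D, k) :: Qs); rewrite /= e; split => // q.
by rewrite inE => /orP [/eqP -> //|]; exact: h.
Qed.

Lemma pairwise_distinct (X : eqType) (r : rel X) (l : seq X) :
  uniq l -> {in l &, forall x y, x != y -> r x y} -> pairwise r l.
Proof.
elim: l => //= x l IH /andP [nx ul] h; apply/andP; split.
  apply/allP => y yl; apply: h; rewrite ?mem_head ?inE ?yl ?orbT //.
  by apply: contraNneq nx => ->.
by apply: IH => // y z yl zl; apply: h; rewrite inE ?yl ?zl orbT.
Qed.

Definition solve (s : seq point) : seq (seq point) :=
  fill_all (build s [:: s] [::]).1 (build s [:: s] [::]).2.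

(** The 1 counts the initial configuration. Insertion spends at most [6 * W ^ 2] moves per point and
    filling at most [14 * W ^ 2], with [W = size s]. *)
Lemma solve_ok s : uniq s ->
  [/\ history s (solve s), (size (solve s) <= 1 + 20 * size s ^ 3)%N
    & exists2 F, normal_family F & fs (head [::] (solve s)) = family_set F].
Proof.
move=> us; rewrite /solve.
have bg : bgood s [:: s] [::] by split.
have [||[hs bF F0 sp _] wt sz cv] := @build_ok s (size s) s [:: s] [::] bg.
- by [].
- by rewrite /weight big_nil.
set st := build _ _ _ in hs bF F0 sp wt sz cv *.
have cov p : p \in s -> covered st.2 p by move=> ps; apply: cv; rewrite ps.
have szL D : D \in st.2 -> (D.2 <= size s)%N.
  move=> DL; apply: leq_trans wt; rewrite /weight (big_rem D) //=; exact: leq_addr.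
have [h1 h2 h3] := @fill_all_ok s (size s) st.2 st.2 [::] st.1 sp cov hs
  (fun _ => id) (fun _ => id) bF szL (fun _ H => False_ind _ (notF H)).
split => //.
  apply: leq_trans h3 _.
  have sp' := sum_parts (separated_apart sp) us.
  have e3 : (size s ^ 3 = size s ^ 2 * size s)%N by rewrite expnSr.
  have : (14 * size s ^ 2 * \sum_(D <- st.2) #|` part D (fs s)| <= 14 * size s ^ 2 * size s)%N.
    by rewrite leq_mul2l sp' orbT.
  have : (size st.1 <= 1 + 6 * size s ^ 2 * size s)%N.
    by apply: leq_trans (leq_trans (leq_addr _ _) sz) _; rewrite add0n.
  rewrite e3 -!mulnA; move: (size s ^ 2 * size s)%N (size st.1).
  by move: (size s ^ 2 * \sum_(D <- st.2) #|` part D (fs s)|)%N; lia.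
set c := head [::] _ in h2 *.
have [Qs [eQ hQ]] := pieces_exist h2.
have [uL ap] := separated_apart sp.
have uQ : uniq Qs by apply: (@map_uniq _ _ fst); rewrite eQ.
have injQ : {in Qs &, injective fst}.
  move: uL; rewrite -eQ; elim: (Qs) => //= q l IH /andP [nq ul] x y.
  rewrite !inE => /orP [/eqP ->|xl] /orP [/eqP ->|yl] //.
  - by move=> e; rewrite e map_f in nq.
  - by move=> e; rewrite -e map_f in nq.
  by apply: IH.
have mL q : q \in Qs -> q.1 \in st.2 by move=> qQ; rewrite -eQ map_f.
exists Qs.
  apply/and3P; split => //.
    apply/allP => -[[v n] k] qQ; have [/= hk _] := hQ _ qQ.
    by rewrite hk andbT; exact: (F0 (v, n) (mL _ qQ)).
  apply: pairwise_distinct => // -[[v n] k] [[w m] l] qQ qQ'.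
  apply: contraNN => /touchP [p [q [ip iq aq]]]; apply/eqP; apply: injQ => //=.
  symmetry; apply: (ap _ _ q p (mL _ qQ') (mL _ qQ) iq ip).
  by rewrite aq orbT.
have covc p : p \in c -> covered st.2 p.
  have cs q : q \in fs s -> covered st.2 q by rewrite fsE; exact: cov.
  by have [h _] := orbit_covered (conj uL ap) cs (history_orbit h1); rewrite -fsE; exact: h.
apply/fsetP => p; rewrite fsE; apply/idP/bigfcupP => [pc|[q]].
  have /coveredP [D DL ip] := covc p pc.
  move: DL; rewrite -eQ => /mapP [q qQ eD]; exists q; first by rewrite qQ.
  by have [_ <-] := hQ q qQ; rewrite -?eD.
rewrite andbT => qQ pq; have [_ ->] := hQ q qQ => //.
exact: piece_inside pq.
Qed.

(** Puts the history in chronological order and drops its oldest entry, the initial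
    configuration. *)
Fixpoint outs (h : seq (seq point)) (acc : seq (seq point)) : seq (seq point) :=
  if h is c :: h' then
    if h' is _ :: _ then outs h' (c :: acc) else acc
  else acc.

Lemma outs_ok s h acc : history s h -> moves (fs (head [::] h)) (map fs acc) ->
  moves (fs s) (map fs (outs h acc)) /\
  last (fs s) (map fs (outs h acc)) = last (fs (head [::] h)) (map fs acc).
Proof.
elim: h acc => // c [|c' r] IH acc; first by move=> /= [_ [_ <-]].
move=> [_ [_ [m hr]]] mv.
by have [|h1 h2] := IH (c :: acc) hr.
Qed.

Lemma size_outs h acc : (size (outs h acc) = size acc + (size h).-1)%N.
Proof.
elim: h acc => [|c [|c' r] IH] acc; rewrite ?addn0 //.
rewrite [outs _ _]/(outs (c' :: r) (c :: acc)) IH /=; lia.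
Qed.

Lemma outs_sub s h acc : history s h ->
  (forall c, c \in acc -> uniq c /\ size c = size s) ->
  forall c, c \in outs h acc -> uniq c /\ size c = size s.
Proof.
elim: h acc => // c [|c' r] IH acc; first by move=> _.
move=> [u1 [s1 [_ hr]]] ha; apply: IH => // d; rewrite inE => /orP [/eqP -> //|].
exact: ha.
Qed.

(** * The program *)

Fixpoint esize (e : exp) : nat :=
  match e with
  | Var _ | Lit _ => 1
  | Add a b | Defs.Sub a b | Defs.Cons a b | Let a b => (esize a + esize b).+1
  | Fst a | Snd a | Call _ a => (esize a).+1
  | IfPos a b c | IfPair a b c => (esize a + esize b + esize c).+1
  end.

Section Cost.
Variables (p : program) (K : nat).

(* The time is measured by the number [k] of calls: between two calls each
   node of a body is evaluated at most once. *)
Definition ev (env : seq value) (e : exp) (v : value) (k : nat) : Prop :=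
  exists2 t, eval p env e v t & (t <= esize e + K * k)%N.

Definition computes (f : nat) (v w : value) (k : nat) : Prop :=
  exists2 body, onth p f = Some body &
  exists2 t, eval p [:: v] body w t & (t <= K * k.+1)%N.

Lemma ev_var env i v : onth env i = Some v -> ev env (Var i) v 0.
Proof. by move=> h; exists 1%N; [exact: EvalVar | rewrite muln0]. Qed.

Lemma ev_lit env z : ev env (Lit z) (Int z) 0.
Proof. by exists 1%N; [exact: EvalLit | rewrite muln0]. Qed.

Lemma ev_add env e1 e2 z1 z2 k1 k2 : ev env e1 (Int z1) k1 -> ev env e2 (Int z2) k2 ->
  ev env (Add e1 e2) (Int (z1 + z2)) (k1 + k2).
Proof.
move=> [t1 h1 l1] [t2 h2 l2]; exists (t1 + t2).+1; first exact: EvalAdd h1 h2.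
by rewrite mulnDr /=; lia.
Qed.

Lemma ev_sub env e1 e2 z1 z2 k1 k2 : ev env e1 (Int z1) k1 -> ev env e2 (Int z2) k2 ->
  ev env (Defs.Sub e1 e2) (Int (z1 - z2)) (k1 + k2).
Proof.
move=> [t1 h1 l1] [t2 h2 l2]; exists (t1 + t2).+1; first exact: EvalSub h1 h2.
by rewrite mulnDr /=; lia.
Qed.

Lemma ev_cons env e1 e2 v1 v2 k1 k2 : ev env e1 v1 k1 -> ev env e2 v2 k2 ->
  ev env (Defs.Cons e1 e2) (Pair v1 v2) (k1 + k2).
Proof.
move=> [t1 h1 l1] [t2 h2 l2]; exists (t1 + t2).+1; first exact: EvalCons h1 h2.
by rewrite mulnDr /=; lia.
Qed.

Lemma ev_fst env e v1 v2 k : ev env e (Pair v1 v2) k -> ev env (Fst e) v1 k.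
Proof. by move=> [t h l]; exists t.+1; first exact: EvalFst h. Qed.

Lemma ev_snd env e v1 v2 k : ev env e (Pair v1 v2) k -> ev env (Snd e) v2 k.
Proof. by move=> [t h l]; exists t.+1; first exact: EvalSnd h. Qed.

Lemma ev_pos env e e1 e2 z v k k1 : ev env e (Int z) k -> 0 < z -> ev env e1 v k1 ->
  ev env (IfPos e e1 e2) v (k + k1).
Proof.
move=> [t h l] z0 [t1 h1 l1]; exists (t + t1).+1; first exact: EvalIfPosT h z0 h1.
by rewrite mulnDr /=; lia.
Qed.

Lemma ev_neg env e e1 e2 z v k k1 : ev env e (Int z) k -> z <= 0 -> ev env e2 v k1 ->
  ev env (IfPos e e1 e2) v (k + k1).
Proof.
move=> [t h l] z0 [t1 h1 l1]; exists (t + t1).+1; first exact: EvalIfPosF h z0 h1.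
by rewrite mulnDr /=; lia.
Qed.

Lemma ev_bool env e e1 e2 (b : bool) v k k1 : ev env e (Int b%:Z) k ->
  ev env (if b then e1 else e2) v k1 -> ev env (IfPos e e1 e2) v (k + k1).
Proof. by case: b => h h1; [apply: ev_pos h _ h1 | apply: ev_neg h _ h1]. Qed.

Lemma ev_pair env e e1 e2 a b v k k1 : ev env e (Pair a b) k -> ev env e1 v k1 ->
  ev env (IfPair e e1 e2) v (k + k1).
Proof.
move=> [t h l] [t1 h1 l1]; exists (t + t1).+1; first exact: EvalIfPairT h h1.
by rewrite mulnDr /=; lia.
Qed.

Lemma ev_int env e e1 e2 z v k k1 : ev env e (Int z) k -> ev env e2 v k1 ->
  ev env (IfPair e e1 e2) v (k + k1).
Proof.
move=> [t h l] [t1 h1 l1]; exists (t + t1).+1; first exact: EvalIfPairF h h1.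
by rewrite mulnDr /=; lia.
Qed.

Lemma ev_let env e1 e2 v1 v k1 k2 : ev env e1 v1 k1 -> ev (v1 :: env) e2 v k2 ->
  ev env (Let e1 e2) v (k1 + k2).
Proof.
move=> [t1 h1 l1] [t2 h2 l2]; exists (t1 + t2).+1; first exact: EvalLet h1 h2.
by rewrite mulnDr /=; lia.
Qed.

Lemma ev_call env f e v w k1 k2 : ev env e v k1 -> computes f v w k2 ->
  ev env (Call f e) w (k1 + k2.+1).
Proof.
move=> [t1 h1 l1] [body hb [t2 h2 l2]]; exists (t1 + t2).+1; first exact: EvalCall h1 hb h2.
by rewrite mulnDr /=; lia.
Qed.

Lemma computes_intro f body v w k k' : onth p f = Some body -> (esize body <= K)%N ->
  ev [:: v] body w k' -> (k' <= k)%N -> computes f v w k.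
Proof.
move=> hb hK [t h l] kk; exists body => //; exists t => //.
by apply: leq_trans l _; rewrite mulnSr addnC leq_add // leq_mul2l kk orbT.
Qed.

End Cost.

Definition args := foldr (fun e f => if f is Some x then Some (Defs.Cons e x) else Some e) None.
Definition tup (es : seq exp) : exp := odflt (Lit 0) (args es).

(* Argument [i] of a function with [n] arguments, passed as nested pairs
   without terminator; [d] is the number of enclosing [Let]s. *)
Definition arg (d n i : nat) : exp :=
  if Nat.eqb i.+1 n then iter i Snd (Var d) else Fst (iter i Snd (Var d)).

Definition f_main := 0%N.    Definition f_peq := 1%N.      Definition f_mem := 2%N.
Definition f_repl := 3%N.    Definition f_exec := 4%N.     Definition f_push := 5%N.
Definition f_sweep := 6%N.   Definition f_absorb := 7%N.   Definition f_revops := 8%N.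
Definition f_frame := 9%N.   Definition f_mapf := 10%N.    Definition f_widen := 11%N.
Definition f_merge := 12%N.  Definition f_join := 13%N.    Definition f_near := 14%N.
Definition f_pass := 15%N.   Definition f_passes := 16%N.  Definition f_inside := 17%N.
Definition f_covered := 18%N. Definition f_build := 19%N.  Definition f_slides := 20%N.
Definition f_descend := 21%N. Definition f_approach := 22%N. Definition f_transport := 23%N.
Definition f_seek := 24%N.   Definition f_fill := 25%N.    Definition f_fill_tri := 26%N.
Definition f_fill_all := 27%N. Definition f_outs := 28%N.

Definition eadd (a b : exp) := Defs.Cons (Add (Fst a) (Fst b)) (Add (Snd a) (Snd b)).
(** This macro and the next two duplicate their arguments; they are applied to expressions without
    calls, where this costs only a constant. *)
Definition epos (e : exp) := IfPos e e (Lit 0).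
Definition emax (a b : exp) := IfPos (Defs.Sub a b) a b.
Definition emin (a b : exp) := IfPos (Defs.Sub a b) b a.
Definition ept (a b : int) := Defs.Cons (Lit a) (Lit b).

(** The only comparison is the test for positivity, so equality is the failure of four strict
    inequalities. *)
Definition b_peq : exp :=
  let p := Fst (Var 0) in let q := Snd (Var 0) in
  IfPos (Defs.Sub (Fst p) (Fst q)) (Lit 0) (IfPos (Defs.Sub (Fst q) (Fst p)) (Lit 0)
    (IfPos (Defs.Sub (Snd p) (Snd q)) (Lit 0) (IfPos (Defs.Sub (Snd q) (Snd p)) (Lit 0) (Lit
      1)))).

Definition b_mem : exp :=
  let x := arg 0 2 0 in let l := arg 0 2 1 in
  IfPair l (IfPos (Call f_peq (tup [:: x; Fst l])) (Lit 1)
                  (Call f_mem (tup [:: x; Snd l])))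
    (Lit 0).

Definition b_repl : exp :=
  let x := arg 0 3 0 in let z := arg 0 3 1 in let c := arg 0 3 2 in
  IfPair c (Defs.Cons (IfPos (Call f_peq (tup [:: Fst c; x])) z (Fst c))
                 (Call f_repl (tup [:: x; z; Snd c])))
    (Lit 0).

Definition b_exec : exp :=
  let h := arg 0 2 0 in let ops := arg 0 2 1 in
  let x := Fst (Fst ops) in let z := Snd (Fst ops) in
  IfPair ops
    (Call f_exec (tup [:: IfPos (Call f_mem (tup [:: z; Fst h])) h
                            (Defs.Cons (Call f_repl (tup [:: x; z; Fst h])) h); Snd ops]))
    h.

Definition b_push : exp :=
  let x := arg 0 5 0 in let d := arg 0 5 1 in let s := arg 0 5 2 in
  let m := arg 0 5 3 in let tl := arg 0 5 4 in
  IfPos m (Defs.Cons (Defs.Cons x (eadd x s)) (Call f_push (tup [:: eadd x d; d; s;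
    Defs.Sub m (Lit 1); tl])))
    tl.

Definition b_sweep : exp :=
  let N := arg 0 4 0 in let r := arg 0 4 1 in let m := arg 0 4 2 in let tl := arg 0 4 3 in
  IfPos m
    (Call f_push (tup [:: Defs.Cons N r; ept (-1) 0; ept (-1) 1; N;
       Call f_sweep (tup [:: Defs.Sub N (Lit 1); Add r (Lit 1); Defs.Sub m (Lit 1); tl])]))
    tl.

Definition b_absorb : exp :=
  let x := arg 0 5 0 in let N := arg 0 5 1 in let h := arg 0 5 2 in
  let l := arg 0 5 3 in let tl := arg 0 5 4 in
  IfPos l
    (Call f_push (tup [:: Defs.Cons x h; ept 0 1; ept (-1) 1; Defs.Sub N h;
       Call f_push (tup [:: Defs.Cons x (Defs.Sub h (Lit 1)); ept 0 (-1); ept (-1) 0; h;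
         Call f_absorb (tup [:: Defs.Sub x (Lit 1); Add N (Lit 1); h; Defs.Sub l (Lit 1);
           tl])])]))
    tl.

Definition b_revops : exp :=
  let ops := arg 0 2 0 in let acc := arg 0 2 1 in
  IfPair ops
    (Call f_revops (tup [:: Snd ops;
      Defs.Cons (Defs.Cons (Snd (Fst ops)) (Fst (Fst ops))) acc]))
    acc.

Definition b_frame : exp :=
  let f := arg 0 3 0 in let o := arg 0 3 1 in let p := arg 0 3 2 in
  IfPos f (Defs.Cons (Defs.Sub (Defs.Sub (Fst o) (Fst p)) (Snd p)) (Add (Snd o) (Snd p)))
    (eadd o p).

Definition b_mapf : exp :=
  let f := arg 0 4 0 in let o := arg 0 4 1 in let ops := arg 0 4 2 in let tl := arg 0 4 3 in
  IfPair ops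
    (Defs.Cons (Defs.Cons (Call f_frame (tup [:: f; o; Fst (Fst ops)]))
                (Call f_frame (tup [:: f; o; Snd (Fst ops)])))
          (Call f_mapf (tup [:: f; o; Snd ops; tl])))
    tl.

Definition esweep_full (n tl : exp) : exp :=
  Call f_sweep (tup [:: Defs.Sub n (Lit 1); Lit 0; Defs.Sub n (Lit 1); tl]).

Definition b_widen : exp :=
  let f := arg 0 6 0 in let o := arg 0 6 1 in let n := arg 0 6 2 in
  let h := arg 0 6 3 in let l := arg 0 6 4 in let tl := arg 0 6 5 in
  Call f_mapf (tup [:: f; o;
    esweep_full n (Call f_absorb (tup [:: Lit 0; n; h; l; Lit 0]));
    Call f_mapf (tup [:: f; Call f_frame (tup [:: f; o;
      Defs.Cons (Defs.Sub (Lit 0) l) (Lit 0)]);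
      Call f_revops (tup [:: esweep_full (Add n l) (Lit 0); Lit 0]); tl])]).

Definition ecsum (A : exp) : exp := Add (Add (Fst (Fst A)) (Snd (Fst A))) (Snd A).

Definition elefto (lo up : exp) : exp := epos (Defs.Sub (Fst (Fst lo)) (Fst (Fst up))).
Definition erighto (lo up : exp) : exp := epos (Defs.Sub (ecsum up) (ecsum lo)).

Definition b_merge : exp :=
  let lo := arg 0 2 0 in let up := arg 0 2 1 in
  let n := Snd lo in
  let h := Defs.Sub (Snd (Fst up)) (Snd (Fst lo)) in
  let l := elefto lo up in
  Call f_widen (tup [:: Lit 0; Fst lo; n; h; l;
    Call f_widen (tup [:: Lit 1;
      Defs.Cons (Defs.Sub (Add (Fst (Fst lo)) n) (Lit 1)) (Snd (Fst lo));
      Add n l; h; erighto lo up; Lit 0])]).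

Definition b_join : exp :=
  let lo := arg 0 2 0 in let up := arg 0 2 1 in
  Defs.Cons (Defs.Cons (Defs.Sub (Fst (Fst lo)) (elefto lo up)) (Snd (Fst lo)))
       (Add (Add (Snd lo) (elefto lo up)) (erighto lo up)).

Definition b_near : exp :=
  let A := arg 0 2 0 in let D := arg 0 2 1 in
  IfPos (Defs.Sub (Add (emax (Fst (Fst A)) (Fst (Fst D))) (emax (Snd (Fst A)) (Snd (Fst D))))
             (emin (ecsum A) (ecsum D)))
    (Lit 0) (Lit 1).

Definition b_pass : exp :=
  let h := arg 0 4 0 in let A := arg 0 4 1 in let F := arg 0 4 2 in let G := arg 0 4 3 in
  let D := Fst F in
  let merge lo up :=
    Call f_pass (tup [:: Call f_exec (tup [:: h; Call f_merge (tup [:: lo; up])]);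
                         Call f_join (tup [:: lo; up]); Snd F; G]) in
  IfPair F
    (IfPos (Call f_near (tup [:: A; D]))
      (IfPos (Defs.Sub (Snd (Fst A)) (Snd (Fst D))) (merge D A) (merge A D))
      (Call f_pass (tup [:: h; A; Snd F; Defs.Cons D G])))
    (tup [:: h; A; G]).

Definition b_passes : exp :=
  let fuel := arg 0 2 0 in let st := arg 0 2 1 in
  IfPair fuel
    (Call f_passes (tup [:: Snd fuel;
       Call f_pass (tup [:: Fst st; Fst (Snd st); Snd (Snd st); Lit 0])]))
    st.

Definition b_inside : exp :=
  let D := arg 0 2 0 in let p := arg 0 2 1 in
  IfPos (Defs.Sub (Fst (Fst D)) (Fst p)) (Lit 0)
    (IfPos (Defs.Sub (Snd (Fst D)) (Snd p)) (Lit 0)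
      (IfPos (Defs.Sub (ecsum D) (Add (Fst p) (Snd p))) (Lit 1) (Lit 0))).

Definition b_covered : exp :=
  let F := arg 0 2 0 in let x := arg 0 2 1 in
  IfPair F
    (IfPos (Call f_inside (tup [:: Fst F; x])) (Lit 1) (Call f_covered (tup [:: Snd F; x])))
    (Lit 0).

(** Under the [Let], index 0 is the state returned by [passes] and index 1 the argument of the
    function. *)
Definition b_build : exp :=
  let s := arg 0 3 0 in let h := arg 0 3 1 in let F := arg 0 3 2 in
  IfPair s
    (IfPos (Call f_covered (tup [:: F; Fst s]))
      (Call f_build (tup [:: Snd s; h; F]))
      (Let (Call f_passes (tup [:: F; h; Defs.Cons (Fst s) (Lit 1); F]))
        (Call f_build (tup [:: Snd (arg 1 3 0); arg 0 3 0;
          Defs.Cons (arg 0 3 1) (arg 0 3 2)]))))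
    (tup [:: h; F]).

Definition b_slides : exp :=
  let i := arg 0 3 0 in let j := arg 0 3 1 in let tl := arg 0 3 2 in
  let i' := Defs.Sub i (Lit 1) in let j' := Defs.Sub j (Lit 1) in
  IfPos i
    (Defs.Cons (Defs.Cons (Defs.Cons i' j') (Defs.Cons i' j)) (Defs.Cons (Defs.Cons
      (Defs.Cons i j') (Defs.Cons i' j'))
      (Defs.Cons (Defs.Cons (Defs.Cons i j) (Defs.Cons i j')) (Call f_slides (tup [:: i'; j;
        tl])))))
    tl.

Definition b_descend : exp :=
  let n := arg 0 4 0 in let j := arg 0 4 1 in let d := arg 0 4 2 in let tl := arg 0 4 3 in
  let j' := Defs.Sub j (Lit 1) in
  IfPos d
    (Defs.Cons (Defs.Cons (Defs.Cons (Lit 0) j') (Defs.Cons (Lit 1) (Defs.Sub j (Lit 2))))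
    (Defs.Cons (Defs.Cons (Defs.Cons (Lit 0) j) (Defs.Cons (Lit 0) j'))
    (Call f_push (tup [:: Defs.Cons (Lit 0) j'; ept 1 0; ept 1 (-1); Defs.Sub (Add n (Lit 1)) j;
      Call f_descend (tup [:: n; j'; Defs.Sub d (Lit 1); tl])]))))
    tl.

Definition b_approach : exp :=
  let n := arg 0 5 0 in let i := arg 0 5 1 in let j := arg 0 5 2 in
  let d := arg 0 5 3 in let tl := arg 0 5 4 in
  Call f_sweep (tup [:: Defs.Sub n (Lit 1); Lit 0; Defs.Sub j (Lit 1);
    Call f_slides (tup [:: i; j; Call f_descend (tup [:: n; j; d; tl])])]).

Definition b_transport : exp :=
  let n := arg 0 3 0 in let e := arg 0 3 1 in let t := arg 0 3 2 in
  Call f_approach (tup [:: n; Fst e; Snd e; Defs.Sub (Snd e) (Snd t);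
    Call f_revops (tup [:: Call f_approach (tup [:: n; Fst t; Snd t; Lit 0; Lit 0]); Lit 0])]).

Definition b_seek : exp :=
  let c := arg 0 3 0 in let o := arg 0 3 1 in let ops := arg 0 3 2 in
  let x := Snd (Fst ops) in
  IfPair ops
    (IfPos (Call f_mem (tup [:: Call f_frame (tup [:: Lit 1; o; x]); c])) x
      (Call f_seek (tup [:: c; o; Snd ops])))
    (Lit 0).

Definition b_fill : exp :=
  let h d := arg d 4 0 in let o d := arg d 4 1 in let n d := arg d 4 2 in
  let ops d := arg d 4 3 in let x d := Snd (Fst (ops d)) in
  IfPair (ops 0)
    (IfPos (Call f_mem (tup [:: Call f_frame (tup [:: Lit 1; o 0; x 0]); Fst (h 0)]))
      (Call f_fill (tup [:: h 0; o 0; n 0; Snd (ops 0)]))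
      (Let (Call f_seek (tup [:: Fst (h 0); o 0; Snd (ops 0)]))
        (IfPair (Var 0)
          (Call f_fill (tup [:: Call f_exec (tup [:: h 1; Call f_mapf (tup [:: Lit 1; o 1;
               Call f_transport (tup [:: n 1; Var 0; x 1]); Lit 0])]);
             o 1; n 1; Snd (ops 1)]))
          (h 1))))
    (h 0).

Definition b_fill_tri : exp :=
  let h := arg 0 2 0 in let D := arg 0 2 1 in
  Call f_fill (tup [:: h;
    Defs.Cons (Defs.Sub (Add (Fst (Fst D)) (Snd D)) (Lit 1)) (Snd (Fst D));
    Snd D; esweep_full (Snd D) (Lit 0)]).

Definition b_fill_all : exp :=
  let h := arg 0 2 0 in let F := arg 0 2 1 in
  IfPair F
    (Call f_fill_all (tup [:: Call f_fill_tri (tup [:: h; Fst F]); Snd F]))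
    h.

(** No rule gives the tail of an integer, so the history must be non-empty; a history of length one
    has the integer 0 as its tail. *)
Definition b_outs : exp :=
  let h := arg 0 2 0 in let acc := arg 0 2 1 in
  IfPair (Snd h) (Call f_outs (tup [:: Snd h; Defs.Cons (Fst h) acc])) acc.

(** [build] returns the pair of a history and a list of triangles, which already has the form of an
    argument of [fill_all]. *)
Definition b_main : exp :=
  Call f_outs (tup [:: Call f_fill_all
    (Call f_build (tup [:: Var 0; Defs.Cons (Var 0) (Lit 0); Lit 0])); Lit 0]).

Definition solver : program :=
  [:: b_main; b_peq; b_mem; b_repl; b_exec; b_push; b_sweep; b_absorb; b_revops;
      b_frame; b_mapf; b_widen; b_merge; b_join; b_near; b_pass; b_passes; b_inside;
      b_covered; b_build; b_slides; b_descend; b_approach; b_transport; b_seek;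
      b_fill; b_fill_tri; b_fill_all; b_outs].

(* The largest size of a function body of [solver]. *)
Definition unit_cost : nat := 154.

Notation evs := (ev solver unit_cost).
Notation comp := (computes solver unit_cost).

(** * Correctness and cost of the functions *)

Definition bv (b : bool) : value := Int b%:Z.
Definition lv (X : Type) (f : X -> value) (l : seq X) : value := list_val (map f l).
Definition pv : point -> value := point_val.
Definition psv : seq point -> value := lv pv.
Definition opv (o : op) : value := Pair (pv o.1) (pv o.2).
Definition opsv : seq op -> value := lv opv.
Definition tv (D : tria) : value := Pair (pv D.1) (Int D.2%:Z).
Definition tsv : seq tria -> value := lv tv.
Definition hv : seq (seq point) -> value := lv psv.

Lemma ev_le env e v k k' : (k <= k')%N -> evs env e v k -> evs env e v k'.
Proof.
move=> kk [t h l]; exists t => //; apply: leq_trans l _.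
by rewrite leq_add2l leq_mul2l kk orbT.
Qed.

Lemma ev_epos env e z k : evs env e (Int z) k -> evs env (epos e) (Int (tn z)%:Z) (k + k).
Proof.
move=> h; have [z0|z0] := ltP 0 z.
  by rewrite tn_pos ?ltW //; apply: (ev_pos _ h z0 h).
rewrite tn_neg //; apply: ev_le (ev_neg _ h z0 (ev_lit _ _ _ _)); lia.
Qed.

Lemma ev_emax env e e' z z' k k' : evs env e (Int z) k -> evs env e' (Int z') k' ->
  evs env (emax e e') (Int (Num.max z z')) (k + k' + (k + k')).
Proof.
move=> h h'; have [z0|z0] := ltP 0 (z - z').
  have -> : Num.max z z' = z by lia.
  by apply: ev_le (ev_pos _ (ev_sub h h') z0 h); lia.
have -> : Num.max z z' = z' by lia.
by apply: ev_le (ev_neg _ (ev_sub h h') z0 h'); lia.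
Qed.

Lemma ev_emin env e e' z z' k k' : evs env e (Int z) k -> evs env e' (Int z') k' ->
  evs env (emin e e') (Int (Num.min z z')) (k + k' + (k + k')).
Proof.
move=> h h'; have [z0|z0] := ltP 0 (z - z').
  have -> : Num.min z z' = z' by lia.
  by apply: ev_le (ev_pos _ (ev_sub h h') z0 h'); lia.
have -> : Num.min z z' = z by lia.
by apply: ev_le (ev_neg _ (ev_sub h h') z0 h); lia.
Qed.

(** Follows the evaluation rules through an expression, leaving values and costs to unification. It
    stops at conditionals and [Let], and leaves one [computes] goal per call. *)
Ltac ev_step :=
  lazymatch goal with
  | |- ev _ _ _ (epos _) _ _ => eapply ev_epos; ev_step
  | |- ev _ _ _ (emax _ _) _ _ => eapply ev_emax; [ev_step | ev_step]
  | |- ev _ _ _ (emin _ _) _ _ => eapply ev_emin; [ev_step | ev_step]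
  | |- ev ?p ?K ?env (elefto ?a ?b) ?v ?k =>
      change (ev p K env (epos (Defs.Sub (Fst (Fst a)) (Fst (Fst b)))) v k); ev_step
  | |- ev ?p ?K ?env (erighto ?a ?b) ?v ?k =>
      change (ev p K env (epos (Defs.Sub (ecsum b) (ecsum a))) v k); ev_step
  | |- ev ?p ?K ?env ?e ?v ?k =>
    let e' := eval hnf in e in
    change (ev p K env e' v k);
    lazymatch e' with
    | Var _ => eapply ev_var; reflexivity
    | Lit _ => eapply ev_lit
    | Defs.Add _ _ => eapply ev_add; [ev_step | ev_step]
    | Defs.Sub _ _ => eapply ev_sub; [ev_step | ev_step]
    | Defs.Cons _ _ => eapply ev_cons; [ev_step | ev_step]
    | Fst _ => eapply ev_fst; ev_step
    | Snd _ => eapply ev_snd; ev_step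
    | Call _ _ => eapply ev_call; [ev_step | ]
    | _ => idtac
    end
  end.

Ltac start := eapply computes_intro; [reflexivity | by [] | |].

Ltac ev_hnf := lazymatch goal with |- ev ?p ?K ?env ?e ?v ?k =>
  let e' := eval hnf in e in change (ev p K env e' v k) end.

Ltac ev_test := ev_hnf;
  first [ eapply ev_pos; [ev_step | by rewrite /=; lia | ]
        | eapply ev_neg; [ev_step | by rewrite /=; lia | ] ].

Lemma peq_spec p q : comp f_peq (Pair (pv p) (pv q)) (bv (p == q)) 0.
Proof.
case: p q => [a b] [c d]; rewrite xpair_eqE.
case: (ltgtP a c) => ac; [| |case: (ltgtP b d) => bd].
all: by start; [do ?ev_test; ev_step | ].
Qed.

Lemma mem_spec x l : comp f_mem (Pair (pv x) (psv l)) (bv (x \in l)) (2 * size l).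
Proof.
elim: l => [|y l IH].
  by start; [ev_hnf; eapply ev_int; [ev_step | ev_step] | ].
have := peq_spec x y; rewrite inE; case: (x == y) => pq.
all: start; [ev_hnf; eapply ev_pair; [ev_step | eapply ev_bool; [ev_step;
  exact: pq | ev_step]]|].
- by [].
- exact: IH.
by rewrite /=; lia.
Qed.

Lemma repl_spec x z c :
  comp f_repl (Pair (pv x) (Pair (pv z) (psv c))) (psv (repl x z c)) (2 * size c).
Proof.
elim: c => [|y c IH].
  by start; [ev_hnf; eapply ev_int; [ev_step | ev_step] | ].
have := peq_spec y x; rewrite /=; case: ifP => yx; move=> pq.
all: start; [ev_hnf; eapply ev_pair; [ev_step | ev_hnf; eapply ev_cons;
   [eapply ev_bool; [ev_step; exact: pq | ev_step] | ev_step; exact: IH ]]|].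
all: by rewrite /=; lia.
Qed.

(** The time bounds depend on the configurations only through the length of the current one. *)
Definition wf (P : nat) (h : seq (seq point)) : Prop := h <> [::] /\ size (head [::] h) = P.

Lemma wf_step P h o : wf P h ->
  wf P (if o.2 \in head [::] h then h else repl o.1 o.2 (head [::] h) :: h).
Proof. by case=> h1 h2; case: ifP => _; split => //=; rewrite size_map. Qed.

Lemma wf_exec P h ops : wf P h -> wf P (exec h ops).
Proof. by elim: ops h => //= o ops IH h /(wf_step o)/IH. Qed.

Lemma exec_spec P h ops : wf P h ->
  comp f_exec (Pair (hv h) (opsv ops)) (hv (exec h ops)) (size ops * (4 * P + 5)).
Proof.
elim: ops h => [|[x z] ops IH] h wh.
  by start; [ev_hnf; eapply ev_int; [ev_step | ev_step] | ].
have := IH _ (wf_step (x, z) wh); case: h wh => [[] //|c h [_ /= cP]] {}IH.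
have := mem_spec z c; move: IH; rewrite [exec _ _]/=; case: (z \in c) => IH m.
all: start; [ev_hnf; eapply ev_pair; [ev_step | ev_hnf; eapply ev_call; [ev_hnf;
  eapply ev_cons |]] | ].
all: try exact: IH.
- by eapply ev_bool; [ev_step; exact: m | ev_step].
- by ev_step.
- by rewrite cP; lia.
- by eapply ev_bool; [ev_step; exact: m | ev_step; exact: repl_spec].
- by ev_step.
- by rewrite cP; lia.
Qed.

Lemma push_spec (x d s : point) (m : int) tl :
  comp f_push (Pair (pv x) (Pair (pv d) (Pair (pv s) (Pair (Int m) (opsv tl)))))
    (opsv (push x d s (tn m) tl)) (tn m).
Proof.
move e : (tn m) => n; elim: n m x e => [|n IH] m x e.
  have m0 : m <= 0 by move: (tnE m); rewrite e; lia.
  by start; [ev_test; ev_step |].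
have m0 : 0 < m by move: (tnE m); rewrite e; lia.
have e' : tn (m - 1) = n by have := tnE m; have := tnE (m - 1); rewrite e; lia.
start; [ev_test; ev_step; exact: (IH (m - 1) (padd x d) e') |].
by lia.
Qed.

Lemma sweep_spec (N r m : int) tl :
  comp f_sweep (Pair (Int N) (Pair (Int r) (Pair (Int m) (opsv tl))))
    (opsv (sweep N r (tn m) tl)) (tn m * (tn N + 2)).
Proof.
move e : (tn m) => n; elim: n m N r e => [|n IH] m N r e.
  have m0 : m <= 0 by move: (tnE m); rewrite e; lia.
  by start; [ev_test; ev_step |].
have m0 : 0 < m by move: (tnE m); rewrite e; lia.
have e' : tn (m - 1) = n by have := tnE m; have := tnE (m - 1); rewrite e; lia.
start; [ev_test; ev_step;
  [exact: (IH (m - 1) (N - 1) (r + 1) e') | exact: (push_spec (N, r) (-1, 0) (-1, 1))] |].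
have : (n * (tn (N - 1)%R + 2) <= n * (tn N + 2))%N.
  by rewrite leq_mul2l; have := tnE N; have := tnE (N - 1); lia.
by rewrite /= mulSn; lia.
Qed.

(** [N] grows as [l] drops, so [N - h + l] is invariant and bounds the length of every upward
    push. *)
Lemma absorb_spec (M : nat) (x N h l : int) tl : (tn h <= M)%N -> N - h + (tn l)%:Z <= M%:Z ->
  comp f_absorb (Pair (Int x) (Pair (Int N) (Pair (Int h) (Pair (Int l) (opsv tl)))))
    (opsv (absorb x N h (tn l) tl)) (tn l * (2 * M + 3)).
Proof.
move=> hM; move e : (tn l) => n; elim: n l x N e => [|n IH] l x N e NM.
  have m0 : l <= 0 by move: (tnE l); rewrite e; lia.
  by start; [ev_test; ev_step |].
have m0 : 0 < l by move: (tnE l); rewrite e; lia.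
have e' : tn (l - 1) = n by have := tnE l; have := tnE (l - 1); rewrite e; lia.
start; [ev_test; ev_step; [apply: (IH (l - 1) (x - 1) (N + 1) e'); lia |
  exact: (push_spec (x, h - 1) (0, -1) (-1, 0)) | exact: (push_spec (x, h) (0, 1) (-1, 1))] |].
have : (tn (N - h)%R <= M)%N by have := tnE (N - h); lia.
by rewrite [(n.+1 * _)%N]mulSn; move: (n * _)%N (tn (N - h)) (tn h) hM; lia.
Qed.

Lemma revops_spec ops acc :
  comp f_revops (Pair (opsv ops) (opsv acc)) (opsv (revops ops acc)) (size ops).
Proof.
elim: ops acc => [|x ops IH] acc.
  by start; [ev_hnf; eapply ev_int; [ev_step | ev_step] | ].
start; [ev_hnf; eapply ev_pair; [ev_step | ev_step; exact: (IH (flip x :: acc))] | ].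
by rewrite /=; lia.
Qed.

Lemma frame_spec (f : bool) o p :
  comp f_frame (Pair (Int f%:Z) (Pair (pv o) (pv p))) (pv (frame f o p)) 0.
Proof.
by case: f; start; [ev_test; ev_step | | ev_test; ev_step |].
Qed.

Lemma mapf_spec (f : bool) o ops tl :
  comp f_mapf (Pair (Int f%:Z) (Pair (pv o) (Pair (opsv ops) (opsv tl))))
    (opsv (map_frame f o ops tl)) (3 * size ops).
Proof.
elim: ops => [|x ops IH].
  by start; [ev_hnf; eapply ev_int; [ev_step | ev_step] | ].
start; [ev_hnf; eapply ev_pair; [ev_step | ev_step;
  [exact: frame_spec | exact: frame_spec | exact: IH]]|].
by rewrite /=; lia.
Qed.

Lemma widen_spec (W : nat) (f : bool) (o : point) (n l : nat) (h : int) tl :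
  (0 < n)%N -> 0 <= h <= n%:Z -> (n + l <= W)%N ->
  comp f_widen
    (Pair (Int f%:Z) (Pair (pv o) (Pair (Int n%:Z) (Pair (Int h) (Pair (Int l%:Z) (opsv tl))))))
    (opsv (widen f o n%:Z h l%:Z tl)) (30 * W ^ 2).
Proof.
move=> n0 hn nW.
have tw (z : int) : z <= W%:Z -> (tn z * (tn z + 2) <= W * (W + 2))%N.
  by move=> zW; apply: leq_mul; have := tnE z; lia.
have s1 : (size (sweep (n%:Z - 1) 0 (tn (n%:Z - 1)) (absorb 0 n%:Z h (tn l%:Z) [::])) <= 2 *
  (W * W))%N.
  have := @size_sweep W (n%:Z - 1) 0 (tn (n%:Z - 1)) (absorb 0 n%:Z h l [::]) ltac:(lia).
  have := @size_absorb W 0 n%:Z h l [::] (or_intror hn) ltac:(lia).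
  have : (tn (n%:Z - 1) * W <= W * W)%N by rewrite leq_mul2r; have := tnE (n%:Z - 1); lia.
  have : (l * W <= W * W)%N by rewrite leq_mul2r; lia.
  by rewrite /=; move: (size _) (size _) (W * W)%N (_ * W)%N (_ * W)%N; lia.
have s2 : (size (sweep (n%:Z + l%:Z - 1) 0 (tn (n%:Z + l%:Z - 1)) [::]) <= W * W)%N.
  have := @size_sweep W (n%:Z + l%:Z - 1) 0 (tn (n%:Z + l%:Z - 1)) [::] ltac:(lia).
  have : (tn (n%:Z + l%:Z - 1) * W <= W * W)%N.
    by rewrite leq_mul2r; have := tnE (n%:Z + l%:Z - 1); lia.
  by rewrite /=; lia.
have t1 := tw (n%:Z - 1) ltac:(lia); have t2 := tw (n%:Z + l%:Z - 1) ltac:(lia).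
have hW : (tn h <= W)%N by have := tnE h; lia.
have t3 : (tn l%:Z * (2 * W + 3) <= W * (2 * W + 3))%N by rewrite leq_mul2r /=; lia.
start; [ev_step|].
- by apply: (@absorb_spec W 0 n%:Z h l%:Z [::] hW); rewrite /=; lia.
- exact: sweep_spec.
- by rewrite sub0r; exact: (frame_spec f o (- l%:Z, 0)).
- exact: (sweep_spec _ _ _ [::]).
- exact: (revops_spec _ [::]).
- exact: mapf_spec.
- exact: mapf_spec.
rewrite size_revops /= addn0 expnS expn1; move: s1 s2 t1 t2 t3.
rewrite [(W * (2 * W + 3))%N]mulnDr [(W * (2 * W))%N]mulnCA [(W * (W + 2))%N]mulnDr.
have : (W * 1 <= W * W)%N by rewrite leq_mul2l; lia.
rewrite /= muln1.
move: (size _) (size _) (_ * (_ + _))%N (_ * (_ + _))%N (_ * (_ + _))%N (W * W)%N; lia.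
Qed.

Lemma merge_spec (W : nat) lo up :
  near lo up -> lo.1.2 <= up.1.2 -> (0 < lo.2)%N -> (0 < up.2)%N ->
  ((join lo up).2 <= W)%N ->
  comp f_merge (Pair (tv lo) (tv up)) (opsv (merge_ops lo up)) (60 * W ^ 2 + 2).
Proof.
move=> nr le l0 u0 jW; rewrite /join /= in jW.
have hh : 0 <= up.1.2 - lo.1.2 <= lo.2%:Z by move: nr; rewrite /near /csum; lia.
start; [ev_step|].
- rewrite -PoszD -/(righto lo up).
  apply: (@widen_spec W true (lo.1.1 + lo.2%:Z - 1,
    lo.1.2) (lo.2 + lefto lo up) (righto lo up) _ [::]); lia.
- apply: (@widen_spec W false lo.1 lo.2 (lefto lo up)); lia.
lia.
Qed.

Lemma join_spec lo up : comp f_join (Pair (tv lo) (tv up)) (tv (join lo up)) 0.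
Proof.
by start; [rewrite /tv /join /= !PoszD; ev_step|].
Qed.

Lemma near_spec A D : comp f_near (Pair (tv A) (tv D)) (bv (near A D)) 0.
Proof.
rewrite /near; case: leP => h.
all: start; [ev_hnf|].
- by eapply ev_neg; [ev_step | rewrite /csum /= in h *; lia | ev_step].
- by [].
- by eapply ev_pos; [ev_step | rewrite /csum /= in h *; lia | ev_step].
- by [].
Qed.

Lemma inside_spec D p : comp f_inside (Pair (tv D) (pv p)) (bv (inside D p)) 0.
Proof.
case: D p => [[a b] n] [x y]; rewrite /inside /in_tri /=.
have [h1|h1] := leP a x; [have [h2|h2] := leP b y;
  [have [h3|h3] := ltP (x + y) (a + b + n%:Z)|]|].
all: by start; [do ?ev_test; ev_step|].
Qed.

Lemma covered_spec F x : comp f_covered (Pair (tsv F) (pv x)) (bv (covered F x)) (2 * size F).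
Proof.
elim: F => [|D F IH].
  by start; [ev_hnf; eapply ev_int; [ev_step | ev_step] | ].
have := inside_spec D x; rewrite /covered /=; case: (inside D x) => ix.
all: start; [ev_hnf; eapply ev_pair; [ev_step | eapply ev_bool; [ev_step;
  exact: ix | ev_step]]|].
- by [].
- exact: IH.
by rewrite /=; lia.
Qed.

Definition small (W : nat) (A : tria) (F : seq tria) : Prop :=
  [/\ (0 < A.2)%N, all (fun D : tria => (0 < D.2)%N) F & (A.2 + weight F <= W)%N].

Definition stv (st : seq (seq point) * tria * seq tria) : value :=
  Pair (hv st.1.1) (Pair (tv st.1.2) (tsv st.2)).

Lemma order_near A D (lo := (lower_first A D).1) (up := (lower_first A D).2) :
  near A D -> (0 < A.2)%N -> (0 < D.2)%N ->
  [/\ near lo up, lo.1.2 <= up.1.2, (0 < lo.2)%N, (0 < up.2)%N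
    & ((join lo up).2 <= A.2 + D.2)%N].
Proof.
move=> nr A0 D0.
have [n1 n2 n3 n4 n5] :
    [/\ near lo up, lo.1.2 <= up.1.2, (0 < lo.2)%N, (0 < up.2)%N & (lo.2 + up.2 = A.2 + D.2)%N].
  by rewrite /lo /up /lower_first; case: ifP => dA /=; split;
    rewrite // 1?near_sym // 1?addnC //; lia.
by split => //; rewrite -n5; exact: join_size.
Qed.

Lemma small_merge W A D F (lo := (lower_first A D).1) (up := (lower_first A D).2) :
  near A D -> small W A (D :: F) -> small W (join lo up) F.
Proof.
move=> nr [A0 /= /andP [D0 F0] wt]; have [_ _ l0 _ sz] := order_near nr A0 D0.
rewrite weight_cons in wt; split => //.
  by rewrite /join /= -addnA addn_gt0 l0.
by apply: leq_trans wt; rewrite addnA leq_add2r.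
Qed.

Lemma small_perm W A F F' : perm_eq F F' -> small W A F -> small W A F'.
Proof. by move=> pF [h1 h2 h3]; split; rewrite // -?(perm_all _ pF) // -(weight_perm pF). Qed.

Lemma size_weight F : all (fun D : tria => (0 < D.2)%N) F -> (size F <= weight F)%N.
Proof.
elim: F => //= D F IH /andP [D0 /IH h].
by rewrite weight_cons; apply: (leq_add D0 h).
Qed.

Lemma small_pass W h A F G (st := pass h A F G) :
  small W A (F ++ G) -> small W st.1.2 st.2.
Proof.
rewrite /st; elim: F h A G {st} => [|D F IH] h A G //= sm.
case: ifP => nr; first by apply: IH; exact: small_merge nr sm.
apply: IH; apply: small_perm sm; rewrite perm_sym.
by apply/permPl; exact: (perm_catCA F [:: D] G).
Qed.

Lemma wf_pass P h A F G : wf P h -> wf P (pass h A F G).1.1.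
Proof.
elim: F h A G => [|D F IH] h A G //= wh.
by case: ifP => _; apply: IH => //; exact: wf_exec.
Qed.

(** About [60 * W ^ 2] calls list the exchanges of a merge; then at most [6 * W ^ 2] exchanges take
    [4 * P + 5] calls each, for a membership test and a replacement that are both linear in [P]. *)
Definition c_pass (W P : nat) : nat := (60 * W ^ 2 + 6 * W ^ 2 * (4 * P + 5) + 10)%N.

Lemma pass_spec W P h A F G : wf P h -> small W A (F ++ G) ->
  comp f_pass (Pair (hv h) (Pair (tv A) (Pair (tsv F) (tsv G))))
    (stv (pass h A F G)) (size F * c_pass W P).
Proof.
elim: F h A G => [|D F IH] h A G wh sm.
  by start; [ev_hnf; eapply ev_int; [ev_step | ev_step] | ].
have [A0 /= /andP [D0 _] wt] := sm.
have nsp := near_spec A D; rewrite [pass _ _ _ _]/=; case: ifP nsp => nr nsp; last first.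
  start.
  - ev_hnf; eapply ev_pair; [ev_step | eapply ev_bool; [ev_step; exact: nsp | ev_step]].
    apply: (IH h A (D :: G)) => //; apply: small_perm sm; rewrite perm_sym.
    by apply/permPl; exact: (perm_catCA F [:: D] G).
  by rewrite mulSn /c_pass; move: (size F * _)%N => u; lia.
have [nr' le l0 u0 jz] := order_near nr A0 D0.
have jW : ((join (lower_first A D).1 (lower_first A D).2).2 <= W)%N.
  by apply: leq_trans jz (leq_trans _ wt); rewrite weight_cons addnA leq_addr.
have IH' := IH (exec h (merge_ops (lower_first A D).1 (lower_first A D).2)) _ G (wf_exec _
  wh) (small_merge nr sm).
have me := merge_spec nr' le l0 u0 jW.
have sz := size_merge_ops nr' le l0 u0 jW.
have ex := exec_spec (merge_ops (lower_first A D).1 (lower_first A D).2) wh.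
have jo := join_spec (lower_first A D).1 (lower_first A D).2.
have bound : (size (merge_ops (lower_first A D).1 (lower_first A D).2) * (4 * P + 5) <= 6 * W
  ^ 2 * (4 * P + 5))%N.
  by rewrite leq_mul2r sz orbT.
move: IH' me ex jo bound; rewrite /lower_first; case: ifP => dA IH' me ex jo bound.
all: start; [ev_hnf; eapply ev_pair; [ev_step | eapply ev_bool; [ev_step; exact: nsp |]]|].
all: rewrite 1?mulSn /c_pass.
- ev_hnf; eapply ev_pos; [ev_step | by rewrite /=; lia | ev_step].
  + exact: me.
  + exact: ex.
  + exact: jo.
  + exact: IH'.
- by move: (size F * _)%N (size _ * _)%N bound; lia.
- ev_hnf; eapply ev_neg; [ev_step | by rewrite /=; lia | ev_step].
  + exact: me.
  + exact: ex.
  + exact: jo.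
  + exact: IH'.
by move: (size F * _)%N (size _ * _)%N bound; lia.
Qed.

Lemma small_passes W fuel h A F (st := passes fuel (h, A, F)) :
  small W A F -> small W st.1.2 st.2.
Proof.
rewrite /st; elim: fuel h A F {st} => [|E fuel IH] h A F sm //=.
have := @small_pass W h A F [::]; rewrite cats0 => /(_ sm).
by case: (pass _ _ _ _) => [[h1 A1] F1]; exact: IH.
Qed.

Lemma wf_passes P fuel h A F : wf P h -> wf P (passes fuel (h, A, F)).1.1.
Proof.
elim: fuel h A F => [|E fuel IH] h A F wh //=.
have := wf_pass A F [::] wh.
by case: (pass _ _ _ _) => [[h1 A1] F1]; exact: IH.
Qed.

Definition c_passes (W P : nat) : nat := (W * c_pass W P + 2)%N.

Lemma passes_spec W P fuel h A F : wf P h -> small W A F ->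
  comp f_passes (Pair (tsv fuel) (stv (h, A, F))) (stv (passes fuel (h, A, F)))
    (size fuel * c_passes W P).
Proof.
elim: fuel h A F => [|E fuel IH] h A F wh sm.
  by start; [ev_hnf; eapply ev_int; [ev_step | ev_step] | ].
have sm' : small W A (F ++ [::]) by rewrite cats0.
have ps := pass_spec wh sm'.
have := small_pass h sm'; have := wf_pass A F [::] wh.
rewrite [passes _ _]/=; case: (pass _ _ _ _) ps => [[h1 A1] F1] ps wh1 sm1.
have FW : (size F * c_pass W P <= W * c_pass W P)%N.
  rewrite leq_mul2r; apply/orP; right; case: sm => _ /size_weight h2 h3.
  by apply: leq_trans h2 (leq_trans _ h3); exact: leq_addl.
start; [ev_hnf; eapply ev_pair; [ev_step | ev_step; [exact: ps | exact: IH wh1 sm1]]|].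
by rewrite [size (_ :: _)]/= mulSn /c_passes; lia.
Qed.

Definition c_build (W P : nat) : nat := (2 * W + W * c_passes W P + 4)%N.

Lemma build_spec W P s h F : wf P h -> all (fun D : tria => (0 < D.2)%N) F ->
  (weight F + size s <= W)%N ->
  comp f_build (Pair (psv s) (Pair (hv h) (tsv F)))
    (Pair (hv (build s h F).1) (tsv (build s h F).2)) (size s * c_build W P).
Proof.
elim: s h F => [|x s IH] h F wh F0 wt.
  by start; [ev_hnf; eapply ev_int; [ev_step | ev_step] | ].
have FW : (size F <= W)%N.
  by apply: leq_trans (size_weight F0) (leq_trans _ wt); exact: leq_addr.
have cs := covered_spec F x; rewrite [build _ _ _]/=; case: ifP cs => cx cs.
  have wt' : (weight F + size s <= W)%N.
    by apply: leq_trans wt; rewrite leq_add2l /= leqnSn.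
  start.
    ev_hnf; eapply ev_pair; [ev_step | eapply ev_bool; [ev_step; exact: cs | ev_step]].
    exact: IH.
  by rewrite [size (_ :: _)]/= mulSn /c_build; lia.
(* The sharp bound serves the recursive call, the bound [W] the cost of the passes. *)
have sm : small (1 + weight F) (x, 1%N) F by split.
have sm' : small W (x, 1%N) F.
  by case: sm => h1 h2 h3; split => //; apply: leq_trans h3 (leq_trans _ wt);
    rewrite addnC leq_add2l.
have ps := passes_spec F wh sm'.
have := small_passes F h sm; have := wf_passes F (x, 1%N) F wh.
case: (passes _ _) ps => [[h1 A1] F1] /= ps wh1 [A1p F1p w1].
have pW : (size F * c_passes W P <= W * c_passes W P)%N by rewrite leq_mul2r FW orbT.
start.
  ev_hnf; eapply ev_pair; [ev_step | eapply ev_bool; [ev_step; exact: cs | ev_hnf]].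
  eapply ev_let; [ev_step; exact: ps | ev_step].
  apply: (IH h1 (A1 :: F1)) => //; first by rewrite /= A1p.
  by rewrite weight_cons; apply: leq_trans wt; rewrite /= addnS -addSn leq_add2r.
by rewrite mulSn /c_build; lia.
Qed.

Lemma slides_spec (i j : int) tl :
  comp f_slides (Pair (Int i) (Pair (Int j) (opsv tl))) (opsv (slides (tn i) j tl)) (tn i).
Proof.
move e : (tn i) => n; elim: n i e => [|n IH] i e.
  have m0 : i <= 0 by move: (tnE i); rewrite e; lia.
  by start; [ev_test; ev_step |].
have m0 : 0 < i by move: (tnE i); rewrite e; lia.
have e' : tn (i - 1) = n by have := tnE i; have := tnE (i - 1); rewrite e; lia.
have e1 : n.+1%:Z = i by rewrite -e tn_pos ?ltW.
have e2 : n%:Z = i - 1 by rewrite -e1; lia.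
rewrite [slides _ _ _]/= e1 e2.
start; [ev_test; ev_step; exact: (IH (i - 1) e') |].
by lia.
Qed.

Lemma descend_spec (M : nat) (n j d : int) tl : n + 1 - j + (tn d)%:Z <= M%:Z ->
  comp f_descend (Pair (Int n) (Pair (Int j) (Pair (Int d) (opsv tl))))
    (opsv (descend n j (tn d) tl)) (tn d * (M + 2)).
Proof.
move e : (tn d) => k; elim: k d j e => [|k IH] d j e hM.
  have m0 : d <= 0 by move: (tnE d); rewrite e; lia.
  by start; [ev_test; ev_step |].
have m0 : 0 < d by move: (tnE d); rewrite e; lia.
have e' : tn (d - 1) = k by have := tnE d; have := tnE (d - 1); rewrite e; lia.
start; [ev_test; ev_step; [apply: (IH (d - 1) (j - 1) e');
  lia | exact: (push_spec (0, j - 1) (1, 0) (1, -1))] |].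
have : (tn (n + 1 - j)%R <= M)%N by have := tnE (n + 1 - j); lia.
by rewrite [(k.+1 * _)%N]mulSn; lia.
Qed.

Lemma approach_spec (W n : nat) (i j d : int) tl :
  0 <= i -> 1 <= j -> d < j -> i + j < n%:Z -> (n <= W)%N ->
  comp f_approach (Pair (Int n%:Z) (Pair (Int i) (Pair (Int j) (Pair (Int d) (opsv tl)))))
    (opsv (approach n%:Z i j d tl)) (12 * W ^ 2).
Proof.
move=> i0 j1 dj ij nW.
have hM : n%:Z + 1 - j + (tn d)%:Z <= W%:Z by have := tnE d; lia.
start; [ev_step|].
- exact: (descend_spec tl hM).
- exact: slides_spec.
- exact: sweep_spec.
have h1 : (tn (j - 1) * (tn (n%:Z - 1) + 2) <= W * (W + 2))%N.
  by apply: leq_mul; have := tnE (j - 1); have := tnE (n%:Z - 1); lia.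
have h2 : (tn d * (W + 2) <= W * (W + 2))%N by rewrite leq_mul2r; have := tnE d; lia.
have h3 : (tn i <= W)%N by have := tnE i; lia.
have h4 : (W * 1 <= W * W)%N by rewrite leq_mul2l; lia.
have e : (W * (W + 2) = W * W + 2 * W)%N by rewrite mulnDr [(W * 2)%N]mulnC.
rewrite e in h1 h2; rewrite expnS expn1; move: h1 h2 h3 h4.
by move: (tn (j - 1) * _)%N (tn d * _)%N (W * W)%N; lia.
Qed.

Lemma transport_spec (W n : nat) (e t : point) :
  e \in cells n%:Z -> t \in cells n%:Z -> (n <= W)%N ->
  comp f_transport (Pair (Int n%:Z) (Pair (pv e) (pv t)))
    (opsv (transport n%:Z e t)) (40 * W ^ 2).
Proof.
rewrite !mem_cells => he ht nW.
have sz := @size_approach n t.1 t.2 0 [::] ltac:(lia) ltac:(lia) ltac:(lia) ltac:(lia).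
start; [ev_step|].
- by apply: (@approach_spec W n t.1 t.2 0 [::]); lia.
- exact: (revops_spec _ [::]).
- by apply: (@approach_spec W n); lia.
have : (n ^ 2 <= W ^ 2)%N by rewrite leq_exp2r.
have : (0 < W ^ 2)%N by rewrite expn_gt0; lia.
rewrite addn0 in sz; move: sz; move: (size _) (n ^ 2)%N (W ^ 2)%N; lia.
Qed.

Definition ptv (o : option point) : value := if o is Some p then pv p else Int 0.

Lemma seek_spec c o ops :
  comp f_seek (Pair (psv c) (Pair (pv o) (opsv ops))) (ptv (seek c o ops))
    (size ops * (2 * size c + 4)).
Proof.
elim: ops => [|x ops IH].
  by start; [ev_hnf; eapply ev_int; [ev_step | ev_step] | ].
have := mem_spec (frame true o x.2) c; rewrite [seek _ _ _]/=; case: ifP => xc mc.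
all: start; [ev_hnf; eapply ev_pair; [ev_step | eapply ev_bool]|].
- by ev_step; [exact: (frame_spec true) | exact: mc].
- by ev_step.
- by rewrite [size (_ :: _)]/= mulSn; lia.
- by ev_step; [exact: (frame_spec true) | exact: mc].
- by ev_step; exact: IH.
by rewrite [size (_ :: _)]/= mulSn; lia.
Qed.

(** For one cell: the membership test, the search, the transport, its change of frame and its
    execution. *)
Definition c_fill (W P M : nat) : nat :=
  (2 * P + M * (2 * P + 4) + 40 * W ^ 2 + 3 * (14 * W ^ 2) + 14 * W ^ 2 * (4 * P + 5) + 10)%N.

Lemma wf_fill P h o n ops : wf P h -> wf P (fill h o n ops).
Proof.
elim: ops h => [|x ops IH] h wh //=; case: ifP => _; first exact: IH.
by case: (seek _ _ _) => // e; apply: IH; exact: wf_exec.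
Qed.

Lemma fill_spec (W P M n : nat) h o ops : wf P h -> (n <= W)%N -> (size ops <= M)%N ->
  {subset map snd ops <= cells n%:Z} ->
  comp f_fill (Pair (hv h) (Pair (pv o) (Pair (Int n%:Z) (opsv ops))))
    (hv (fill h o n%:Z ops)) (size ops * c_fill W P M).
Proof.
move=> + nW; elim: ops h => [|x ops IH] h wh oM sub.
  by start; [ev_hnf; eapply ev_int; [ev_step | ev_step] | ].
have oM' : (size ops <= M)%N by exact: ltnW.
have sub' : {subset map snd ops <= cells n%:Z}.
  by move=> p hp; apply: sub; rewrite /= inE hp orbT.
have xc : x.2 \in cells n%:Z by apply: sub; rewrite /= mem_head.
have IHh k (wk : wf P k) := IH k wk oM' sub'.
case: h wh => [[] //|c h] wh; have [_ /= cP] := wh.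
have := mem_spec (frame true o x.2) c; rewrite [fill _ _ _ _]/=; case: ifP => xh mc.
  start.
    ev_hnf; eapply ev_pair; [ev_step | eapply ev_bool].
      by ev_step; [exact: (frame_spec true) | exact: mc].
    by ev_step; exact: IHh.
  by rewrite [((size ops).+1 * _)%N]mulSn cP; move: (size ops * c_fill _ _ _)%N => u;
    rewrite /c_fill; lia.
have := seekP c o ops; have sk := seek_spec c o ops.
have sM : (size ops * (2 * P + 4) <= M * (2 * P + 4))%N by rewrite leq_mul2r oM' orbT.
case: (seek c o ops) sk => [e|] sk; last first.
  move=> _; start.
    ev_hnf; eapply ev_pair; [ev_step | eapply ev_bool].
      by ev_step; [exact: (frame_spec true) | exact: mc].
    ev_hnf; eapply ev_let; [ev_step; exact: sk | ev_hnf; eapply ev_int; [ev_step | ev_step]].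
  by rewrite [((size ops).+1 * _)%N]mulSn cP; move: (size ops * c_fill _ _ _)%N => u;
    rewrite /c_fill; move: sM; move: (size ops * (2 * P + 4))%N (M * _)%N (14 * W ^ 2 * _)%N;
    move: (W ^ 2)%N; lia.
case=> eo _; have ec := sub' _ eo.
have tr := transport_spec ec xc nW.
have ts : (size (transport n%:Z e x.2) <= 14 * W ^ 2)%N.
  move: ec xc; rewrite !mem_cells => he hx.
  apply: leq_trans (@size_transport n e x.2 _ _ _ _ _ _) _; try lia.
  by rewrite leq_mul2l leq_exp2r.
have ms := mapf_spec true o (transport n%:Z e x.2) [::].
have es := exec_spec (map_frame true o (transport n%:Z e x.2) [::]) wh.
have eb : (size (map_frame true o (transport n%:Z e x.2) [::]) * (4 * P + 5) <= 14 * W ^ 2 *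
  (4 * P + 5))%N.
  by rewrite leq_mul2r size_map_frame addn0 ts orbT.
start.
  ev_hnf; eapply ev_pair; [ev_step | eapply ev_bool].
    by ev_step; [exact: (frame_spec true) | exact: mc].
  ev_hnf; eapply ev_let; [ev_step; exact: sk | ev_hnf; eapply ev_pair; [ev_step | ev_step]].
  - exact: tr.
  - exact: ms.
  - exact: es.
  - by apply: IHh; exact: wf_exec.
rewrite [((size ops).+1 * _)%N]mulSn cP; move: (size ops * c_fill _ _ _)%N => u;
  rewrite /c_fill; move: ts eb sM.
move: (size ops * (2 * P + 4))%N (M * _)%N (size (map_frame _ _ _ _) * _)%N (14 * W ^ 2 * _)%N.
by move: (size (transport _ _ _)) (W ^ 2)%N; lia.
Qed.

Definition c_fill_tri (W P : nat) : nat := (W * (W + 2) + W * W * c_fill W P (W * W) + 3)%N.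

Lemma wf_fill_tri P h D : wf P h -> wf P (fill_tri h D).
Proof. exact: wf_fill. Qed.

Lemma fill_tri_spec (W P : nat) h D : wf P h -> (D.2 <= W)%N ->
  comp f_fill_tri (Pair (hv h) (tv D)) (hv (fill_tri h D)) (c_fill_tri W P).
Proof.
case: D => [v n] wh /= nW.
have tW : (tn (n%:Z - 1) <= W)%N by have := tnE (n%:Z - 1); lia.
have sz : (size (sweep (n%:Z - 1) 0 (tn (n%:Z - 1)) [::]) <= W * W)%N.
  have := @size_sweep W (n%:Z - 1) 0 (tn (n%:Z - 1)) [::] ltac:(lia).
  have : (tn (n%:Z - 1) * W <= W * W)%N by rewrite leq_mul2r tW orbT.
  by rewrite /=; lia.
have sub : {subset map snd (sweep (n%:Z - 1) 0 (tn (n%:Z - 1)) [::]) <= cells n%:Z} by [].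
start; [ev_step|].
- exact: (sweep_spec _ _ _ [::]).
- exact: (fill_spec (v.1 + n%:Z - 1, v.2) wh nW sz sub).
have h1 : (tn (n%:Z - 1) * (tn (n%:Z - 1) + 2) <= W * (W + 2))%N by apply: leq_mul; lia.
have h2 : (size (sweep (n%:Z - 1) 0 (tn (n%:Z - 1)) [::]) * c_fill W P (W * W) <=
   W * W * c_fill W P (W * W))%N by rewrite leq_mul2r sz orbT.
rewrite /c_fill_tri; move: h1 h2.
by move: (_ * c_fill _ _ _)%N (W * W * _)%N (W * (W + 2))%N (tn _ * _)%N; lia.
Qed.

Lemma fill_all_spec (W P : nat) h F : wf P h -> (forall D, D \in F -> (D.2 <= W)%N) ->
  comp f_fill_all (Pair (hv h) (tsv F)) (hv (fill_all h F)) (size F * (c_fill_tri W P + 2)).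
Proof.
elim: F h => [|D F IH] h wh FW.
  by start; [ev_hnf; eapply ev_int; [ev_step | ev_step] | ].
start.
  ev_hnf; eapply ev_pair; [ev_step | ev_step].
  - by apply: (fill_tri_spec wh); apply: FW; exact: mem_head.
  - apply: IH; first exact: wf_fill_tri.
    by move=> E EF; apply: FW; rewrite inE EF orbT.
by rewrite [size (_ :: _)]/= [((size F).+1 * _)%N]mulSn; move: (size F * _)%N; lia.
Qed.

Lemma outs_spec h acc : h <> [::] ->
  comp f_outs (Pair (hv h) (hv acc)) (hv (outs h acc)) (size h).
Proof.
elim: h acc => // c [|c' r] IH acc _.
  by start; [ev_hnf; eapply ev_int; [ev_step | ev_step] | ].
start.
  by ev_hnf; eapply ev_pair; [ev_step | ev_step; exact: (IH (c :: acc))].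
by rewrite /=; lia.
Qed.

Definition c_main (W : nat) : nat :=
  (W * c_build W W + W * (c_fill_tri W W + 2) + (1 + 20 * W ^ 3) + 4)%N.

Lemma main_spec s : uniq s ->
  comp f_main (psv s) (hv (outs (solve s) [::])) (c_main (size s)).
Proof.
move=> us; set W := size s.
have wh : wf W [:: s] by [].
have bs := @build_spec W W s [:: s] [::] wh isT; rewrite /weight big_nil in bs.
have bg : bgood s [:: s] [::] by split.
have [||[hs bF F0 sp _] wt sz cv] := @build_ok s W s [:: s] [::] bg; first by [].
  by rewrite /weight big_nil.
have [hsol szs _] := solve_ok us.
have sol0 : solve s <> [::] by case: (solve s) hsol.
have wb : wf W (build s [:: s] [::]).1.
  by split; [case: (build _ _ _).1 hs | case: (history_head hs)].
have FW : forall D, D \in (build s [:: s] [::]).2 -> (D.2 <= W)%N.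
  by move=> D DL; apply: leq_trans wt; rewrite /weight (big_rem D) //=; exact: leq_addr.
have FS : (size (build s [:: s] [::]).2 <= W)%N.
  by apply: leq_trans (size_weight _) wt; apply/allP => D; exact: F0.
have h1 : (size (build s [:: s] [::]).2 * (c_fill_tri W W + 2) <= W * (c_fill_tri W W + 2))%N.
  by rewrite leq_mul2r FS orbT.
start; [ev_step|].
- exact: bs.
- exact: (fill_all_spec wb FW).
- exact: (outs_spec [::] sol0).
rewrite /c_main; move: h1 szs; rewrite -/W.
by move: (_ * (c_fill_tri _ _ + 2))%N (W * (c_fill_tri _ _ + 2))%N (W * c_build _ _)%N (W ^
  3)%N; lia.
Qed.

(** * Polynomial bounds *)

(** The base [n.+1] is at least 1, so exponents may be raised, which gives closure under sums. *)
Definition poly_bounded (B : nat -> nat) : Prop :=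
  exists c d, forall n, (B n <= c * n.+1 ^ d)%N.

Lemma poly_const k : poly_bounded (fun _ => k).
Proof. by exists k, 0%N => n; rewrite muln1. Qed.

Lemma poly_id : poly_bounded id.
Proof. by exists 1%N, 1%N => n; rewrite mul1n expn1. Qed.

Lemma poly_add B C : poly_bounded B -> poly_bounded C -> poly_bounded (fun n => B n + C n)%N.
Proof.
move=> [c [d h]] [c' [d' h']]; exists (c + c')%N, (d + d')%N => n.
rewrite mulnDl; apply: leq_add.
  by apply: leq_trans (h n) _; rewrite leq_mul2l leq_pexp2l ?leq_addr ?orbT.
by apply: leq_trans (h' n) _; rewrite leq_mul2l leq_pexp2l ?leq_addl ?orbT.
Qed.

Lemma poly_mul B C : poly_bounded B -> poly_bounded C -> poly_bounded (fun n => B n * C n)%N.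
Proof.
move=> [c [d h]] [c' [d' h']]; exists (c * c')%N, (d + d')%N => n.
by rewrite expnD mulnACA leq_mul.
Qed.

Lemma poly_exp B k : poly_bounded B -> poly_bounded (fun n => B n ^ k)%N.
Proof.
move=> hB; elim: k => [|k IH]; first exact: poly_const.
have [c [d h]] := poly_mul hB IH; exists c, d => n.
by rewrite expnS.
Qed.

Lemma poly_main : poly_bounded (fun n => unit_cost * (c_main n).+1 + 3)%N.
Proof.
rewrite /c_main /c_build /c_fill_tri /c_passes /c_pass /c_fill.
have e (B : nat -> nat) : poly_bounded (fun n => B n + 1)%N -> poly_bounded (fun n => (B n).+1).
  by move=> [c [d h]]; exists c, d => n; rewrite -addn1.
apply: poly_add; last exact: poly_const.
apply: poly_mul; first exact: poly_const.
apply: e.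
repeat first [exact: poly_const | exact: poly_id | apply: poly_add | apply: poly_mul | apply:
  poly_exp].
Qed.

(** For positive [n], [n.+1 ^ d <= (2 * n) ^ d], whence the factor [2 ^ d]; the additive term takes
    care of [n = 0]. *)
Lemma poly_bounded_at B : poly_bounded B -> exists c d, forall n, (B n <= c * n ^ d + c)%N.
Proof.
move=> [c [d h]]; exists (c * 2 ^ d)%N, d => n; apply: leq_trans (h n) _.
case: n {h} => [|n].
  by rewrite exp1n muln1; apply: leq_trans (leq_addl _ _); rewrite leq_pmulr // expn_gt0.
apply: leq_trans (leq_addr _ _); rewrite -mulnA -expnMn leq_mul2l; apply/orP; right.
by case: d => // d; rewrite leq_exp2r //; lia.
Qed.

(** * The normal form as a function *)

(** Computed from one enumeration of [P]; uniqueness makes the result independent of that choice. *)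
Definition nf (P : config) : config := fs (head [::] (solve (enum_fset P))).

Lemma fs_perm s (P : config) : perm_eq s P -> fs s = P.
Proof. by move=> sP; apply/fsetP => p; rewrite fsE (perm_mem sP). Qed.

Lemma nf_family P : exists2 F,
  normal_family F & solitaire_orbit P (nf P) /\ nf P = family_set F.
Proof.
have [hs _ [F nF e]] := solve_ok (fset_uniq P).
exists F => //; split => //.
by have := history_orbit hs; rewrite (fs_perm (perm_refl _)).
Qed.

Lemma nf_unique P F : normal_family F -> solitaire_orbit P (family_set F) -> nf P =
  family_set F.
Proof.
move=> nF oF; have [F' nF' [o e]] := nf_family P.
rewrite e; apply: perm_big; apply: normal_unique => //.
by rewrite -e; apply: rt_trans oF; exact: orbit_sym.
Qed.

Lemma list_val_encodes (hs : seq (seq point)) : (forall c, c \in hs -> uniq c) ->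
  encodes_seq (hv hs) (map fs hs).
Proof.
move=> u; exists (map psv hs) => //.
elim: hs u => [|c hs IH] u /=; first by constructor.
constructor; last by apply: IH => d dh; apply: u; rewrite inE dh orbT.
exists c => //; apply: uniq_perm; [exact: u (mem_head _ _) | exact: fset_uniq |].
by move=> p; rewrite -fsE.
Qed.

Theorem theorem1 :
  exists nf : config -> config,
  [/\ forall P : config, normal_form P (nf P),
      forall (P : config) (F1 F2 : seq piece),
        normal_family F1 -> normal_family F2 ->
        solitaire_orbit P (family_set F1) -> solitaire_orbit P (family_set F2) ->
        perm_eq F1 F2,
      forall P Q : config, solitaire_orbit P Q <-> nf P = nf Q
    & exists (K : nat) (prog : program) (c d : nat),
        (0 < K)%N /\
        forall (P : config) (input : value), encodes input P ->
        exists (output : value) (t : nat) (Qs : seq config),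
        [/\ runs prog input output t,
            (t <= c * #|` P| ^ d + c)%N,
            encodes_seq output Qs,
            (size Qs <= K * #|` P| ^ 3)%N
          & moves P Qs /\ last P Qs = nf P]].
Proof.
exists nf; split.
- by move=> P; have [F nF [o e]] := nf_family P; split => //; exists F.
- move=> P F1 F2 n1 n2 o1 o2; apply: normal_unique => //.
  exact: rt_trans (orbit_sym o1) o2.
- move=> P Q; have [F nF [oP eP]] := nf_family P; have [G nG [oQ eQ]] := nf_family Q.
  split => [o|e].
    by rewrite eQ; apply: nf_unique => //; rewrite -eQ; exact: rt_trans o oQ.
  by apply: rt_trans oP _; rewrite e; exact: orbit_sym.
have [c [d hcd]] := poly_bounded_at poly_main.
exists 20%N, solver, c, d; split => // P input [s sP ->].
have us : uniq s by rewrite (perm_uniq sP) fset_uniq.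
have szs : size s = #|` P| by exact: perm_size sP.
have fsP := fs_perm sP.
have [hs sz [F nF eF]] := solve_ok us.
have [t et lt] : ev solver unit_cost [:: psv s] (Call f_main (Var 0))
    (hv (outs (solve s) [::])) (0 + (c_main (size s)).+1).
  by eapply ev_call; [apply: ev_var; reflexivity | exact: main_spec].
have [mv la] := outs_ok hs (acc := [::]) I.
exists (hv (outs (solve s) [::])), t, (map fs (outs (solve s) [::])); split.
- exact: et.
- rewrite -szs; apply: leq_trans lt _; apply: leq_trans (hcd _).
  by rewrite /= add0n addnC leq_add.
- apply: list_val_encodes => x xh.
  by have [] := outs_sub hs (acc := [::]) (fun _ H => False_ind _ (notF H)) xh.
- by rewrite size_map size_outs -szs add0n; move: sz; move: (size (solve s)) (20 * _)%N; lia.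
rewrite -fsP; split; first exact: mv.
(* The moves start from the enumeration [s] given as input, [nf] from its own; uniqueness identifies
   the two final sets. *)
rewrite la /= eF fsP; symmetry; apply: nf_unique => //.
by rewrite -eF -fsP; exact: history_orbit.
Qed.
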